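(* Let $k$ be a field of characteristic $3$. Then: (i) $kK_3\cong \mathrm{Mat}_3(k)\times\mathrm{Mat}_2(kC_3)$; (ii) $kK_5\cong kK_6\cong\mathrm{Mat}_{25}(kC_3)$; (iii) $kK_n=0$ for $n\ge 7$. (Isomorphisms of $k$-algebras.)
   Context: $\Gamma_n$ is the group with generators $s_1,\dots,s_{n-1}$ and relations $s_is_j=s_js_i$ for $|i-j|\ge 2$, $s_is_{i+1}s_i=s_{i+1}s_is_{i+1}$ for $1\le i\le n-2$, and $s_i^3=1$. $C_3$ is the cyclic group of order $3$. The kernel $Q$ of the morphism $\Gamma_3\to C_3$ sending $s_1,s_2$ to a fixed generator of $C_3$ is a quaternion group of order $8$. Put $\mathbf{q}=\sum_{g\in Q}g$, viewed in $k\Gamma_n$ ($n\ge3$) via the natural morphism $\Gamma_3\to\Gamma_n$. Then $kK_n$ denotes the quotient of $k\Gamma_n$ by the two-sided ideal generated by $\mathbf{q}$. *)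

(* Defs.v *)
From HB Require Import structures.
From mathcomp Require Import all_boot all_order all_algebra all_fingroup all_solvable.
From mathcomp Require Import generic_quotient finmap.
From mathcomp Require Import boolp classical_sets functions cardinality fsbigop.
From mathcomp Require Import monalg.

Set Implicit Arguments.
Unset Strict Implicit.
Unset Printing Implicit Defensive.

Import GRing.Theory.

Local Open Scope ring_scope.
Local Open Scope quotient_scope.

(* A word in the letters of X and their formal inverses: (x, false) stands for
   x and (x, true) for x^-1. *)
Definition gword (X : choiceType) : Type := seq (X * bool).

HB.instance Definition _ (X : choiceType) := Choice.on (gword X).

(* The least congruence on words that contains the relations R and makes
   x x^-1 and x^-1 x trivial. *)
Inductive gcong (X : choiceType) (R : gword X -> gword X -> Prop) :
    gword X -> gword X -> Prop :=
| gcong_rel u v of R u v : gcong R u v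
| gcong_inv x b : gcong R [:: (x, b); (x, ~~ b)] [::]
| gcong_refl u : gcong R u u
| gcong_sym u v of gcong R u v : gcong R v u
| gcong_trans v u w of gcong R u v & gcong R v w : gcong R u w
| gcong_cat u u' v v' of gcong R u u' & gcong R v v' :
    gcong R (u ++ v) (u' ++ v').

Section Presentation.
Context (X : choiceType) (R : gword X -> gword X -> Prop).

Definition gcongb (u v : gword X) : bool := `[< gcong R u v >].

Lemma gcongb_refl : reflexive gcongb.
Proof. by move=> u; apply/asboolP; exact: gcong_refl. Qed.

Lemma gcongb_sym : symmetric gcongb.
Proof. by move=> u v; apply/asboolP/asboolP => /gcong_sym. Qed.

Lemma gcongb_trans : transitive gcongb.
Proof.
by move=> v u w /asboolP uv /asboolP vw; apply/asboolP/(gcong_trans uv vw).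
Qed.

Canonical gcong_equiv := EquivRel gcongb gcongb_refl gcongb_sym gcongb_trans.

(* The group < X | R >. *)
Definition presgroup : Type := {eq_quot gcong_equiv}.

HB.instance Definition _ := Choice.on presgroup.
HB.instance Definition _ := EqQuotient.on presgroup.

Definition pres_word (u : gword X) : presgroup := \pi_presgroup u.

Lemma pres_wordP u v : pres_word u = pres_word v <-> gcong R u v.
Proof.
split=> [/eqmodP /asboolP //|uv]; first by apply/eqmodP/asboolP.
Qed.

Lemma pres_word_repr (g : presgroup) : pres_word (repr g) = g.
Proof. exact: reprK. Qed.

Definition gword_inv (u : gword X) : gword X :=
  rev [seq (p.1, ~~ p.2) | p <- u].

Lemma gcong_invr u : gcong R (u ++ gword_inv u) [::].
Proof.
elim: u => [|[x b] u IHu]; first exact: gcong_refl.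
have -> : ((x, b) :: u) ++ gword_inv ((x, b) :: u)
    = [:: (x, b)] ++ ((u ++ gword_inv u) ++ [:: (x, ~~ b)]).
  by rewrite /gword_inv /= rev_cons -cats1 catA.
apply: gcong_trans (gcong_inv R x b).
rewrite -[X in gcong R _ X]/([:: (x, b)] ++ ([::] ++ [:: (x, ~~ b)])).
apply: gcong_cat; first exact: gcong_refl.
by apply: gcong_cat => //; exact: gcong_refl.
Qed.

Lemma gword_invK : involutive gword_inv.
Proof.
move=> u; rewrite /gword_inv map_rev revK -map_comp -[RHS]map_id.
by apply: eq_map => -[x b] /=; rewrite negbK.
Qed.

Lemma gcong_invl u : gcong R (gword_inv u ++ u) [::].
Proof. by rewrite -{2}[u]gword_invK; exact: gcong_invr. Qed.

Lemma gcong_inv_mono u v : gcong R u v -> gcong R (gword_inv u) (gword_inv v).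
Proof.
move=> uv; have idu := gcong_refl R (gword_inv u).
have idv := gcong_refl R (gword_inv v).
have e1 : gcong R (gword_inv u ++ (v ++ gword_inv v)) (gword_inv u).
  by rewrite -[X in gcong R _ X]cats0; apply: gcong_cat (gcong_invr v).
have e2 : gcong R ((gword_inv u ++ v) ++ gword_inv v) (gword_inv v).
  rewrite -[X in gcong R _ X]cat0s; apply: gcong_cat => //.
  apply: gcong_trans (gcong_invl u).
  by apply: gcong_cat => //; exact: gcong_sym.
by apply: gcong_trans (gcong_sym e1) _; rewrite catA.
Qed.

Definition pres_one : presgroup := pres_word [::].
Definition pres_mul (g h : presgroup) : presgroup :=
  pres_word (repr g ++ repr h).
Definition pres_inv (g : presgroup) : presgroup :=
  pres_word (gword_inv (repr g)).

Lemma gcong_repr u : gcong R (repr (pres_word u)) u.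
Proof. by apply/pres_wordP; exact: pres_word_repr. Qed.

Lemma pres_mulE u v : pres_mul (pres_word u) (pres_word v) = pres_word (u ++ v).
Proof. by apply/pres_wordP; apply: gcong_cat; exact: gcong_repr. Qed.

Lemma pres_invE u : pres_inv (pres_word u) = pres_word (gword_inv u).
Proof. by apply/pres_wordP; apply: gcong_inv_mono; exact: gcong_repr. Qed.

Fact pres_mulA : associative pres_mul.
Proof.
move=> f g h; rewrite -[f]pres_word_repr -[g]pres_word_repr -[h]pres_word_repr.
by rewrite !pres_mulE catA.
Qed.

Fact pres_mul1g : left_id pres_one pres_mul.
Proof. by move=> g; rewrite -[g]pres_word_repr pres_mulE. Qed.

Fact pres_mulg1 : right_id pres_one pres_mul.
Proof. by move=> g; rewrite -[g]pres_word_repr pres_mulE cats0. Qed.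

Fact pres_mulVg : left_inverse pres_one pres_inv pres_mul.
Proof.
move=> g; rewrite -[g]pres_word_repr pres_invE pres_mulE.
by apply/pres_wordP; exact: gcong_invl.
Qed.

Fact pres_mulgV : right_inverse pres_one pres_inv pres_mul.
Proof.
move=> g; rewrite -[g]pres_word_repr pres_invE pres_mulE.
by apply/pres_wordP; exact: gcong_invr.
Qed.

HB.instance Definition _ := isGroup.Build presgroup
  pres_mulA pres_mul1g pres_mulg1 pres_mulVg pres_mulgV.

Lemma pres_wordM u v : pres_word (u ++ v) = (pres_word u * pres_word v)%g.
Proof. by rewrite [RHS]pres_mulE. Qed.

Definition pres_gen (x : X) : presgroup := pres_word [:: (x, false)].

End Presentation.

Section PresentationLift.
Context (X : choiceType) (R : gword X -> gword X -> Prop).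
Context (G : groupType) (f : X -> G).
Local Open Scope group_scope.

Definition gword_eval (u : gword X) : G :=
  \prod_(p <- u) (if p.2 then (f p.1)^-1 else f p.1).

(* The morphism < X | R > -> G extending f : X -> G. As a function it is
   defined through representatives of the classes of words; it is the
   expected morphism when f satisfies the relations (pres_lift_word,
   pres_liftM). *)
Definition pres_lift (g : presgroup R) : G := gword_eval (repr g).

Hypothesis fR : forall u v, R u v -> gword_eval u = gword_eval v.

Lemma gcong_eval u v : gcong R u v -> gword_eval u = gword_eval v.
Proof.
elim=> {u v} [u v /fR //|x b|//|u v _ -> //|v u w _ -> _ -> //|u u' v v' _ eu _ ev].
  by rewrite /gword_eval !big_cons !big_nil /= mulg1; case: b;
     rewrite ?mulgV ?mulVg.
by rewrite /gword_eval !big_cat /= -!/(gword_eval _) eu ev.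
Qed.

Lemma pres_lift_word u : pres_lift (pres_word R u) = gword_eval u.
Proof. by apply: gcong_eval; exact: gcong_repr. Qed.

Lemma pres_lift_gen x : pres_lift (pres_gen R x) = f x.
Proof. by rewrite pres_lift_word /gword_eval big_seq1. Qed.

Lemma pres_liftM : {morph pres_lift : g h / g * h}.
Proof.
move=> g h; rewrite -[g]pres_word_repr -[h]pres_word_repr.
by rewrite -pres_wordM !pres_lift_word /gword_eval big_cat.
Qed.

End PresentationLift.

Definition pos_word (X : choiceType) (s : seq X) : gword X :=
  [seq (x, false) | x <- s].

(* The generators s_1, ..., s_{n-1} are indexed by 'I_n.-1 from 0: the index i
   stands for s_{i+1}. *)
Variant Gamma_rel (n : nat) : gword 'I_n.-1 -> gword 'I_n.-1 -> Prop :=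
| Gamma_comm (i j : 'I_n.-1) of (i.+2 <= j)%N || (j.+2 <= i)%N :
    Gamma_rel (pos_word [:: i; j]) (pos_word [:: j; i])
| Gamma_braid (i j : 'I_n.-1) of j = i.+1 :> nat :
    Gamma_rel (pos_word [:: i; j; i]) (pos_word [:: j; i; j])
| Gamma_cube (i : 'I_n.-1) :
    Gamma_rel (pos_word [:: i; i; i]) (pos_word [::]).

Definition Gamma (n : nat) : groupType := presgroup (@Gamma_rel n).

Definition Gamma_gen (n : nat) (i : 'I_n.-1) : Gamma n :=
  pres_gen (@Gamma_rel n) i.


Section GammaLift.
Context (n : nat) (G : groupType) (f : 'I_n.-1 -> G).
Local Open Scope group_scope.

Hypothesis f_comm : forall i j : 'I_n.-1,
  (i.+2 <= j)%N || (j.+2 <= i)%N -> f i * f j = f j * f i.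
Hypothesis f_braid : forall i j : 'I_n.-1,
  j = i.+1 :> nat -> f i * f j * f i = f j * f i * f j.
Hypothesis f_cube : forall i, f i ^+ 3 = 1.

Lemma Gamma_rel_eval u v :
  Gamma_rel u v -> gword_eval f u = gword_eval f v.
Proof.
case=> [i j ij|i j ij|i]; rewrite /gword_eval !(big_cons, big_nil) /= ?mulg1.
- exact: f_comm.
- by rewrite !mulgA f_braid.
- by rewrite -[RHS](f_cube i) !expgS expg0 mulg1.
Qed.

End GammaLift.

Lemma Gamma_gen2 n (i j : 'I_n.-1) :
  (Gamma_gen i * Gamma_gen j)%g = pres_word _ (pos_word [:: i; j]).
Proof. by rewrite -[pos_word _]/([:: _] ++ [:: _]) pres_wordM. Qed.

Lemma Gamma_gen3 n (i j l : 'I_n.-1) :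
  (Gamma_gen i * Gamma_gen j * Gamma_gen l)%g
    = pres_word _ (pos_word [:: i; j; l]).
Proof.
by rewrite Gamma_gen2 -[RHS]/(pres_word _ (pos_word [:: i; j] ++ [:: _]))
           pres_wordM.
Qed.

Lemma Gamma_gen_comm n (i j : 'I_n.-1) :
  (i.+2 <= j)%N || (j.+2 <= i)%N ->
  (Gamma_gen i * Gamma_gen j = Gamma_gen j * Gamma_gen i)%g.
Proof.
by move=> ij; rewrite !Gamma_gen2; exact/pres_wordP/gcong_rel/Gamma_comm.
Qed.

Lemma Gamma_gen_braid n (i j : 'I_n.-1) :
  j = i.+1 :> nat ->
  (Gamma_gen i * Gamma_gen j * Gamma_gen i
     = Gamma_gen j * Gamma_gen i * Gamma_gen j)%g.
Proof.
by move=> ij; rewrite !Gamma_gen3; exact/pres_wordP/gcong_rel/Gamma_braid.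
Qed.

Lemma Gamma_gen_cube n (i : 'I_n.-1) : (Gamma_gen i ^+ 3 = 1)%g.
Proof.
rewrite !expgS expg0 mulg1 mulgA Gamma_gen3.
exact/pres_wordP/gcong_rel/Gamma_cube.
Qed.

Lemma leq_predn m n : (m <= n)%N -> (m.-1 <= n.-1)%N.
Proof. by case: m n => [|m] [|n]. Qed.

(* The natural morphism Gamma_m -> Gamma_n, s_i |-> s_i, for m <= n. *)
Definition Gamma_widen (m n : nat) (le_mn : (m <= n)%N) : Gamma m -> Gamma n :=
  pres_lift (fun i => Gamma_gen (widen_ord (leq_predn le_mn) i)).

Lemma Gamma_widen_gen m n (le_mn : (m <= n)%N) (i : 'I_m.-1) :
  Gamma_widen le_mn (Gamma_gen i) = Gamma_gen (widen_ord (leq_predn le_mn) i).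
Proof.
apply: pres_lift_gen; apply: Gamma_rel_eval => [a b ab|a b ab|a].
- exact: Gamma_gen_comm.
- exact: Gamma_gen_braid.
- exact: Gamma_gen_cube.
Qed.

Lemma Gamma_widenM m n (le_mn : (m <= n)%N) :
  {morph Gamma_widen le_mn : g h / (g * h)%g}.
Proof.
apply: pres_liftM; apply: Gamma_rel_eval => [a b ab|a b ab|a].
- exact: Gamma_gen_comm.
- exact: Gamma_gen_braid.
- exact: Gamma_gen_cube.
Qed.

(* The group law of 'I_3 as a groupType is the addition modulo 3. *)
Definition C3 : groupType := 'I_3.

Definition C3_gen : C3 := Zp1.

Lemma C3_genX (i : 'I_3) : (C3_gen ^+ i)%g = (i : C3).
Proof. by apply/val_inj; case: i => -[|[|[|]]]. Qed.

Definition Gamma3_to_C3 : Gamma 3 -> C3 := pres_lift (fun=> C3_gen).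

Lemma Gamma3_to_C3_gen (i : 'I_2) :
  Gamma3_to_C3 (Gamma_gen (i : 'I_3.-1)) = C3_gen.
Proof.
apply: pres_lift_gen; apply: Gamma_rel_eval => [a b ab|a b ab|a] //.
exact/eqP.
Qed.

Lemma Gamma3_to_C3M : {morph Gamma3_to_C3 : g h / (g * h)%g}.
Proof.
apply: pres_liftM; apply: Gamma_rel_eval => [a b ab|a b ab|a] //.
exact/eqP.
Qed.

Definition Q8 : set (Gamma 3) := [set g | Gamma3_to_C3 g = 1%g].

(* A k-algebra is a ring A with a ring morphism k -> A whose image is central;
   the scalar c acts on A as the product by in_pzalg c. The library's algType
   is not used because it excludes the zero ring, which the quotients below may
   be. *)
HB.mixin Record PzRing_isPzAlg (k : pzRingType) A of GRing.PzRing A := {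
  in_pzalg : {rmorphism k -> A};
  in_pzalgC : forall (c : k) (x : A), in_pzalg c * x = x * in_pzalg c
}.

#[short(type="pzAlgType")]
HB.structure Definition PzAlg (k : pzRingType) :=
  {A of GRing.PzRing A & PzRing_isPzAlg k A}.

Arguments in_pzalg {k} A : rename.

Definition alg_iso (k : pzRingType) (A B : pzAlgType k) : Prop :=
  exists2 f : {rmorphism A -> B},
    bijective f & forall c : k, f (in_pzalg A c) = in_pzalg B c.

Definition regular_in (k : comNzRingType) : {rmorphism k -> k^o} :=
  (idfun : {rmorphism k -> k}).

Fact regular_inC (k : comNzRingType) (c : k) (x : k^o) :
  regular_in k c * x = x * regular_in k c.
Proof. exact: mulrC. Qed.

HB.instance Definition _ (k : comNzRingType) :=
  PzRing_isPzAlg.Build k k^o (@regular_inC k).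

Section PairAlg.
Context (k : pzRingType) (A B : pzAlgType k).

Definition pair_in (c : k) : A * B := (in_pzalg A c, in_pzalg B c).

Fact pair_in_zmod_morphism : zmod_morphism pair_in.
Proof. by move=> c d; congr (_, _); exact: rmorphB. Qed.

Fact pair_in_monoid_morphism : monoid_morphism pair_in.
Proof.
by split=> [|c d]; congr (_, _); first [exact: rmorph1|exact: rmorphM].
Qed.

HB.instance Definition _ :=
  GRing.isZmodMorphism.Build k (A * B)%type pair_in pair_in_zmod_morphism.
HB.instance Definition _ :=
  GRing.isMonoidMorphism.Build k (A * B)%type pair_in pair_in_monoid_morphism.

Fact pair_inC c (x : A * B) : pair_in c * x = x * pair_in c.
Proof. by congr (_, _); exact: in_pzalgC. Qed.

HB.instance Definition _ := PzRing_isPzAlg.Build k (A * B)%type pair_inC.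

End PairAlg.

Section MatrixAlg.
Context (k : pzRingType) (A : pzAlgType k) (n : nat).

Definition mx_in (c : k) : 'M[A]_n := (in_pzalg A c)%:M.

Fact mx_in_zmod_morphism : zmod_morphism mx_in.
Proof. by move=> c d; rewrite /mx_in rmorphB raddfB. Qed.

Fact mx_in_monoid_morphism : monoid_morphism mx_in.
Proof.
by split=> [|c d]; rewrite /mx_in ?rmorph1 // rmorphM scalar_mxM.
Qed.

HB.instance Definition _ :=
  GRing.isZmodMorphism.Build k 'M[A]_n mx_in mx_in_zmod_morphism.
HB.instance Definition _ :=
  GRing.isMonoidMorphism.Build k 'M[A]_n mx_in mx_in_monoid_morphism.

Fact mx_inC c (M : 'M[A]_n) : mx_in c * M = M * mx_in c.
Proof.
rewrite [LHS]mul_scalar_mx; apply/matrixP=> i j; rewrite [RHS]mxE (bigD1 j) //=.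
rewrite !mxE eqxx mulr1n in_pzalgC big1 ?addr0 // => l ne_lj.
by rewrite !mxE (negPf ne_lj) mulr0.
Qed.

HB.instance Definition _ := PzRing_isPzAlg.Build k 'M[A]_n mx_inC.

End MatrixAlg.

(* The finitely supported functions G -> k, with the convolution product. The
   library's ring structure on {malg k[G]} requires G to be a monomType, which
   a nontrivial group is not. *)
Definition galg (k : fieldType) (G : groupType) : Type := {malg k[G]}.

Section GroupAlgebra.
Context (k : fieldType) (G : groupType).

HB.instance Definition _ := GRing.Zmodule.copy (galg k G) {malg k[G]}.

Implicit Types (x y z : galg k G) (a b : k) (g h : G).

Definition galg_of (g : G) : galg k G := << g >>.

Definition galg_mul x y : galg k G :=
  \sum_(g <- msupp x) \sum_(h <- msupp y) << x@_g * y@_h *g (g * h)%g >>.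

Lemma galg_mulw (d1 d2 : {fset G}) x y :
  (msupp x `<=` d1)%fset -> (msupp y `<=` d2)%fset ->
  galg_mul x y = \sum_(g <- d1) \sum_(h <- d2) << x@_g * y@_h *g (g * h)%g >>.
Proof.
move=> le1 le2; rewrite /galg_mul (big_fset_incl _ le1) /=; last first.
  move=> g _ /mcoeff_outdom xg; rewrite big1 // => h _.
  by rewrite xg mul0r monalgU0.
apply: eq_bigr => g _; apply: big_fset_incl => // h _ /mcoeff_outdom ->.
by rewrite mulr0 monalgU0.
Qed.

Lemma galg_mulUU a b g h :
  galg_mul << a *g g >> << b *g h >> = << a * b *g (g * h)%g >>.
Proof.
by rewrite (galg_mulw msuppU_le msuppU_le) !big_seq_fset1 !mcoeffUU.
Qed.

Fact galg_mulDl : left_distributive galg_mul +%R.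
Proof.
move=> x y z; have sx := fsubsetUl (msupp x) (msupp y).
have sy := fsubsetUr (msupp x) (msupp y); have sz := fsubset_refl (msupp z).
rewrite (galg_mulw (msuppD_le x y) sz) (galg_mulw sx sz) (galg_mulw sy sz).
rewrite -big_split; apply: eq_bigr => g _.
rewrite -big_split; apply: eq_bigr => h _ /=.
by rewrite mcoeffD mulrDl monalgUD.
Qed.

Fact galg_mulDr : right_distributive galg_mul +%R.
Proof.
move=> z x y; have sx := fsubsetUl (msupp x) (msupp y).
have sy := fsubsetUr (msupp x) (msupp y); have sz := fsubset_refl (msupp z).
rewrite (galg_mulw sz (msuppD_le x y)) (galg_mulw sz sx) (galg_mulw sz sy).
rewrite -big_split; apply: eq_bigr => g _.
rewrite -big_split; apply: eq_bigr => h _ /=.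
by rewrite mcoeffD mulrDr monalgUD.
Qed.

Lemma galg_mul0l : left_zero 0 galg_mul.
Proof. by move=> x; rewrite /galg_mul msupp0 big_seq_fset0. Qed.

Lemma galg_mul0r : right_zero 0 galg_mul.
Proof.
by move=> x; rewrite /galg_mul big1 // => g _; rewrite msupp0 big_seq_fset0.
Qed.

Lemma galg_ind (P : galg k G -> Prop) :
  P 0 -> (forall x y, P x -> P y -> P (x + y)) ->
  (forall a g, P << a *g g >>) -> forall x, P x.
Proof.
move=> P0 PD PU x; rewrite [x]monalgE.
by elim/big_ind: _ => // y z; exact: PD.
Qed.

Fact galg_mulA : associative galg_mul.
Proof.
move=> x y z; elim/galg_ind: x => [|x x' IH IH'|a g].
- by rewrite !galg_mul0l.
- by rewrite !galg_mulDl IH IH'.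
elim/galg_ind: y => [|y y' IH IH'|b h].
- by rewrite galg_mul0l !galg_mul0r galg_mul0l.
- by rewrite galg_mulDl !galg_mulDr galg_mulDl IH IH'.
elim/galg_ind: z => [|z z' IH IH'|c l].
- by rewrite !galg_mul0r.
- by rewrite !galg_mulDr IH IH'.
by rewrite !galg_mulUU mulrA mulgA.
Qed.

Fact galg_mul1l : left_id (galg_of 1%g) galg_mul.
Proof.
elim/galg_ind=> [|x y IHx IHy|a g].
- by rewrite galg_mul0r.
- by rewrite galg_mulDr IHx IHy.
by rewrite galg_mulUU mul1r mul1g.
Qed.

Fact galg_mul1r : right_id (galg_of 1%g) galg_mul.
Proof.
elim/galg_ind=> [|x y IHx IHy|a g].
- by rewrite galg_mul0l.
- by rewrite galg_mulDl IHx IHy.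
by rewrite galg_mulUU mulr1 mulg1.
Qed.

HB.instance Definition _ := GRing.Zmodule_isPzRing.Build (galg k G)
  galg_mulA galg_mul1l galg_mul1r galg_mulDl galg_mulDr.

Lemma galg_ofM g h : galg_of (g * h)%g = galg_of g * galg_of h.
Proof. by rewrite [RHS]galg_mulUU mulr1. Qed.

Lemma galg_of1 : galg_of 1%g = 1.
Proof. by []. Qed.

Definition galg_in (a : k) : galg k G := << a *g 1%g >>.

Fact galg_in_zmod_morphism : zmod_morphism galg_in.
Proof. by move=> a b; exact: monalgUB. Qed.

Fact galg_in_monoid_morphism : monoid_morphism galg_in.
Proof. by split=> [//|a b]; rewrite [RHS]galg_mulUU mulg1. Qed.

HB.instance Definition _ :=
  GRing.isZmodMorphism.Build k (galg k G) galg_in galg_in_zmod_morphism.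
HB.instance Definition _ :=
  GRing.isMonoidMorphism.Build k (galg k G) galg_in galg_in_monoid_morphism.

Fact galg_inC a x : galg_in a * x = x * galg_in a.
Proof.
elim/galg_ind: x => [|x y IHx IHy|b g]; first by rewrite mulr0 mul0r.
  by rewrite mulrDr mulrDl IHx IHy.
by rewrite [LHS]galg_mulUU [RHS]galg_mulUU mulrC mulg1 mul1g.
Qed.

HB.instance Definition _ := PzRing_isPzAlg.Build k (galg k G) galg_inC.

End GroupAlgebra.

(* The k-linear extension kG -> kH of a map G -> H. *)
Definition galg_map (k : fieldType) (G H : groupType) (f : G -> H)
    (x : galg k G) : galg k H :=
  \sum_(g <- msupp x) << x@_g *g f g >>.

Lemma galg_map_of (k : fieldType) (G H : groupType) (f : G -> H) (g : G) :
  galg_map f (galg_of k g) = galg_of k (f g).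
Proof. by rewrite /galg_map msuppU oner_eq0 big_seq_fset1 mcoeffUU. Qed.

Definition two_sided_ideal (A : pzRingType) (I : set A) : Prop :=
  [/\ I 0, forall x y, I x -> I y -> I (x + y)
    & forall a x b, I x -> I (a * x * b)].

Section QuotientAlgebra.
Context (k : pzRingType) (A : pzAlgType k) (S : set A).
Implicit Types (x y : A).

Definition ideal_gen : set A := smallest (@two_sided_ideal A) S.

Lemma ideal_gen_ideal : two_sided_ideal ideal_gen.
Proof.
split=> [J [[J0 _ _] _] //|x y Ix Iy J JS|a x b Ix J JS]; have [[_ JD JM] _] := JS.
  by apply: JD; [exact: Ix|exact: Iy].
by apply: JM; exact: Ix.
Qed.

Lemma ideal_gen0 : ideal_gen 0.
Proof. by have [] := ideal_gen_ideal. Qed.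

Lemma ideal_genD x y : ideal_gen x -> ideal_gen y -> ideal_gen (x + y).
Proof. by have [_ + _] := ideal_gen_ideal; exact. Qed.

Lemma ideal_genMl a x : ideal_gen x -> ideal_gen (a * x).
Proof. by have [_ _ /(_ a x 1)] := ideal_gen_ideal; rewrite mulr1. Qed.

Lemma ideal_genMr x b : ideal_gen x -> ideal_gen (x * b).
Proof. by have [_ _ /(_ 1 x b)] := ideal_gen_ideal; rewrite mul1r. Qed.

Lemma ideal_genN x : ideal_gen x -> ideal_gen (- x).
Proof. by move=> /(ideal_genMl (- 1)); rewrite mulN1r. Qed.

Definition quot_rel x y : bool := `[< ideal_gen (x - y) >].

Lemma quot_rel_refl : reflexive quot_rel.
Proof. by move=> x; apply/asboolP; rewrite subrr; exact: ideal_gen0. Qed.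

Lemma quot_rel_sym : symmetric quot_rel.
Proof.
by move=> x y; apply/asboolP/asboolP => /ideal_genN; rewrite opprB.
Qed.

Lemma quot_rel_trans : transitive quot_rel.
Proof.
move=> y x z /asboolP xy /asboolP yz; apply/asboolP.
by have := ideal_genD xy yz; rewrite addrA subrK.
Qed.

Canonical quot_equiv :=
  EquivRel quot_rel quot_rel_refl quot_rel_sym quot_rel_trans.

(* The quotient of A by the two-sided ideal generated by S. *)
Definition quotalg : Type := {eq_quot quot_equiv}.

HB.instance Definition _ := Choice.on quotalg.
HB.instance Definition _ := EqQuotient.on quotalg.

Definition quot_proj (x : A) : quotalg := \pi_quotalg x.

Lemma quot_projP x y : quot_proj x = quot_proj y <-> ideal_gen (x - y).
Proof.
by split=> [/eqmodP /asboolP //|xy]; apply/eqmodP/asboolP.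
Qed.

Lemma quot_proj_repr (u : quotalg) : quot_proj (repr u) = u.
Proof. exact: reprK. Qed.

Lemma quot_ind (P : quotalg -> Prop) :
  (forall x, P (quot_proj x)) -> forall u, P u.
Proof. by move=> Px u; rewrite -[u]quot_proj_repr. Qed.

Lemma repr_quot_proj x : ideal_gen (repr (quot_proj x) - x).
Proof. by apply/quot_projP; exact: quot_proj_repr. Qed.

Definition quot_add (u v : quotalg) := quot_proj (repr u + repr v).
Definition quot_opp (u : quotalg) := quot_proj (- repr u).
Definition quot_mul (u v : quotalg) := quot_proj (repr u * repr v).

Lemma quot_addE x y : quot_add (quot_proj x) (quot_proj y) = quot_proj (x + y).
Proof.
by apply/quot_projP; rewrite opprD addrACA; apply: ideal_genD;
   exact: repr_quot_proj.
Qed.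

Lemma quot_oppE x : quot_opp (quot_proj x) = quot_proj (- x).
Proof.
by apply/quot_projP; rewrite -opprD; apply: ideal_genN; exact: repr_quot_proj.
Qed.

Lemma quot_mulE x y : quot_mul (quot_proj x) (quot_proj y) = quot_proj (x * y).
Proof.
apply/quot_projP; set x' := repr _; set y' := repr _.
have -> : x' * y' - x * y = (x' - x) * y' + x * (y' - y).
  by rewrite mulrBl mulrBr addrA subrK.
by apply: ideal_genD; [apply: ideal_genMr|apply: ideal_genMl];
   exact: repr_quot_proj.
Qed.

Fact quot_addA : associative quot_add.
Proof.
by elim/quot_ind=> x; elim/quot_ind=> y; elim/quot_ind=> z;
   rewrite !quot_addE addrA.
Qed.

Fact quot_addC : commutative quot_add.
Proof. by elim/quot_ind=> x; elim/quot_ind=> y; rewrite !quot_addE addrC. Qed.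

Fact quot_add0 : left_id (quot_proj 0) quot_add.
Proof. by elim/quot_ind=> x; rewrite quot_addE add0r. Qed.

Fact quot_addN : left_inverse (quot_proj 0) quot_opp quot_add.
Proof. by elim/quot_ind=> x; rewrite quot_oppE quot_addE addNr. Qed.

HB.instance Definition _ := GRing.isZmodule.Build quotalg
  quot_addA quot_addC quot_add0 quot_addN.

Fact quot_mulA : associative quot_mul.
Proof.
by elim/quot_ind=> x; elim/quot_ind=> y; elim/quot_ind=> z;
   rewrite !quot_mulE mulrA.
Qed.

Fact quot_mul1l : left_id (quot_proj 1) quot_mul.
Proof. by elim/quot_ind=> x; rewrite quot_mulE mul1r. Qed.

Fact quot_mul1r : right_id (quot_proj 1) quot_mul.
Proof. by elim/quot_ind=> x; rewrite quot_mulE mulr1. Qed.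

Fact quot_mulDl : left_distributive quot_mul quot_add.
Proof.
by elim/quot_ind=> x; elim/quot_ind=> y; elim/quot_ind=> z;
   rewrite quot_addE !quot_mulE quot_addE mulrDl.
Qed.

Fact quot_mulDr : right_distributive quot_mul quot_add.
Proof.
by elim/quot_ind=> x; elim/quot_ind=> y; elim/quot_ind=> z;
   rewrite quot_addE !quot_mulE quot_addE mulrDr.
Qed.

HB.instance Definition _ := GRing.Zmodule_isPzRing.Build quotalg
  quot_mulA quot_mul1l quot_mul1r quot_mulDl quot_mulDr.

Fact quot_proj_zmod_morphism : zmod_morphism quot_proj.
Proof. move=> x y; transitivity (quot_add (quot_proj x) (quot_opp (quot_proj y))) => //.
by rewrite quot_oppE quot_addE. Qed.

Fact quot_proj_monoid_morphism : monoid_morphism quot_proj.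
Proof. by split=> [//|x y]; rewrite [RHS]quot_mulE. Qed.

HB.instance Definition _ :=
  GRing.isZmodMorphism.Build A quotalg quot_proj quot_proj_zmod_morphism.
HB.instance Definition _ :=
  GRing.isMonoidMorphism.Build A quotalg quot_proj quot_proj_monoid_morphism.

Definition quot_in : {rmorphism k -> quotalg} := quot_proj \o in_pzalg A.

Fact quot_inC (c : k) (u : quotalg) : quot_in c * u = u * quot_in c.
Proof.
by elim/quot_ind: u => x; rewrite -!(rmorphM quot_proj) in_pzalgC.
Qed.

HB.instance Definition _ := PzRing_isPzAlg.Build k quotalg quot_inC.

End QuotientAlgebra.

(* The sum over a set is the finitely supported sum; Q8 is finite. *)
Definition q3 (k : fieldType) : galg k (Gamma 3) :=
  \sum_(g \in Q8) galg_of k g.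

Definition qn (k : fieldType) (n : nat) (le3n : (3 <= n)%N) : galg k (Gamma n) :=
  galg_map (Gamma_widen le3n) (q3 k).

Definition kK (k : fieldType) (n : nat) (le3n : (3 <= n)%N) : pzAlgType k :=
  quotalg [set qn k le3n].

Arguments kK k n le3n : clear implicits.

(* Main.v *)
From HB Require Import structures.
From Stdlib Require Import BinPos.
From Stdlib Require List.
Require Import Defs.
From mathcomp Require Import all_boot all_algebra.
From mathcomp Require Import fingroup generic_quotient finmap.
From mathcomp Require Import boolp classical_sets fsbigop.
From mathcomp Require Import monalg.

Set Implicit Arguments.
Unset Strict Implicit.
Unset Printing Implicit Defensive.

Import GRing.Theory.
Local Open Scope ring_scope.

(* Let B = kK_5, and let c be the generator of C_3. There are explicit matrices
   S_1, ..., S_5 over the field with three elements such that s_i |-> c S_i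
   defines morphisms from kK_5 and kK_6 to the algebra of matrices of size 25
   over kC_3.

   On kK_5 this morphism f is injective. Let G be the product
   (1 + z) (1 + a) (1 - b) in kQ, where z, a, b are the central involution and
   two generators of Q. A rewriting computation shows that 75 words span
   B G / B G (s_4 - 1); since (s_4 - 1)^3 = 0 and s_4 commutes with G, every
   element of B G is the sum of c_j (s_4 - 1)^j for j < 3, where the c_j are
   combinations of these words. The images of the words by f, multiplied by
   (f(s_4) - 1)^2, are linearly independent, hence f is injective on B G. So the
   elements annihilated on the left by the kernel of f form a two-sided ideal
   which contains G; another rewriting computation shows that G generates B, and
   the kernel is zero. The morphism f is surjective because f(G s_1 s_3 s_4 G)
   is a multiple of a matrix of rank one over the prime field.

   If y^3 = 1 in an algebra that receives a morphism from kK_5, y commutes with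
   s_1, s_2, s_3 and satisfies the braid relation with s_4, then y is the image of
   c S_5: as a matrix over the centralizer of the matrices over k, it has entries
   constrained by linear equations, whose solution depends on one entry, and this
   entry commutes with c, has the order of c and satisfies a braid relation with
   it. So kK_5 -> kK_6 is surjective. When n >= 7, s_5 is in the subalgebra
   generated by s_1, ..., s_4 and commutes with s_6; then the braid relation gives
   s_5 = s_6, all the generators are equal, and q becomes 8 = - 1.

   The algebra kK_3 has the dimension 21 given by a rewriting computation, and is
   mapped isomorphically by the symmetric square and c times the natural
   representation of SL_2 over the prime field. *)

(** * Noncommutative rewriting over the field with three elements *)

Variant F3 := O3 | P3 | M3.

Definition add3 a b :=
  match a, b with
  | O3, x | x, O3 => x
  | P3, P3 => M3 | M3, M3 => P3
  | _, _ => O3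
  end.

Definition opp3 a := match a with O3 => O3 | P3 => M3 | M3 => P3 end.

Definition mul3 a b :=
  match a with O3 => O3 | P3 => b | M3 => opp3 b end.

Definition is0 a := if a is O3 then true else false.

Section Value.
Context (A : pzRingType).

Definition val3 (a : F3) : A := match a with O3 => 0 | P3 => 1 | M3 => -1 end.

Lemma val3N a : val3 (opp3 a) = - val3 a.
Proof. by case: a; rewrite /= ?oppr0 ?opprK. Qed.

Lemma val3M a b : val3 (mul3 a b) = val3 a * val3 b.
Proof. by case: a; rewrite /= ?mul0r ?mul1r ?mulN1r ?val3N. Qed.

Lemma val3C a (x : A) : val3 a * x = x * val3 a.
Proof. by case: a; rewrite /= ?mul0r ?mulr0 ?mul1r ?mulr1 ?mulN1r ?mulrN1. Qed.

Hypothesis three : 3%:R = 0 :> A.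

Lemma val3D a b : val3 (add3 a b) = val3 a + val3 b.
Proof.
have two : 1 + 1 = -1 :> A.
  by apply/eqP; rewrite -subr_eq0 opprK -addrA -three !mulrS addr0.
have two' : - (1 : A) - 1 = 1 by rewrite -opprD two opprK.
by case: a; case: b; rewrite /= ?addr0 ?add0r ?subrr ?addNr ?two ?two'.
Qed.

End Value.

Arguments val3 {A} a.

Variant letter := L0 | L1 | L2 | L3 | L4.

Definition word := seq letter.

Definition same_letter x y :=
  match x, y with
  | L0, L0 | L1, L1 | L2, L2 | L3, L3 | L4, L4 => true
  | _, _ => false
  end.

Fixpoint same_word (u v : word) :=
  match u, v with
  | [::], [::] => true
  | x :: u', y :: v' => same_letter x y && same_word u' v'
  | _, _ => false
  end.

Lemma same_wordP u v : same_word u v -> u = v.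
Proof.
by elim: u v => [|x u IHu] [|y v] //= /andP[xy /IHu ->]; case: x y xy => -[].
Qed.

(* Noncommutative polynomials over the field with three elements: lists of
   terms, and tries, whose node reached by a word holds the coefficient of that
   word. *)
Definition ncpoly := seq (word * F3).

Inductive ptrie := PLeaf | PNode of F3 & ptrie & ptrie & ptrie & ptrie & ptrie.

Definition pnode t :=
  if t is PLeaf then PNode O3 PLeaf PLeaf PLeaf PLeaf PLeaf else t.

Fixpoint padd (w : word) (c : F3) (t : ptrie) : ptrie :=
  match pnode t with
  | PLeaf => PLeaf
  | PNode d t0 t1 t2 t3 t4 =>
    match w with
    | [::] => PNode (add3 c d) t0 t1 t2 t3 t4
    | L0 :: v => PNode d (padd v c t0) t1 t2 t3 t4
    | L1 :: v => PNode d t0 (padd v c t1) t2 t3 t4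
    | L2 :: v => PNode d t0 t1 (padd v c t2) t3 t4
    | L3 :: v => PNode d t0 t1 t2 (padd v c t3) t4
    | L4 :: v => PNode d t0 t1 t2 t3 (padd v c t4)
    end
  end.

Definition isleaf t := if t is PLeaf then true else false.

Definition pmk c t0 t1 t2 t3 t4 :=
  if [&& is0 c, isleaf t0, isleaf t1, isleaf t2, isleaf t3 & isleaf t4]
  then PLeaf else PNode c t0 t1 t2 t3 t4.

(** These words may multiply a left module on the left: they avoid [L4], the letter of its
    generator. *)
Definition pure (w : word) := all (fun x => ~~ same_letter x L4) w.

(** The lexicographically greatest word comes out first, with [L4] the greatest letter and [L0] the
    least. As each trie of [levels] is meant for a single length, terms are treated in decreasing
    degree-lexicographic order. *)
Fixpoint ppop (t : ptrie) : option (word * F3 * ptrie) :=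
  match t with
  | PLeaf => None
  | PNode c t0 t1 t2 t3 t4 =>
    match ppop t4 with Some (w, d, t') => Some (L4 :: w, d, pmk c t0 t1 t2 t3 t')
    | None =>
    match ppop t3 with Some (w, d, t') => Some (L3 :: w, d, pmk c t0 t1 t2 t' t4)
    | None =>
    match ppop t2 with Some (w, d, t') => Some (L2 :: w, d, pmk c t0 t1 t' t3 t4)
    | None =>
    match ppop t1 with Some (w, d, t') => Some (L1 :: w, d, pmk c t0 t' t2 t3 t4)
    | None =>
    match ppop t0 with Some (w, d, t') => Some (L0 :: w, d, pmk c t' t1 t2 t3 t4)
    | None => Some ([::], c, PLeaf)
    end end end end end
  end.

(* The tries of a list contain words of decreasing lengths: a term whose word
   is shorter by d than those of the first trie goes into the trie number d. *)
Fixpoint addat (d : nat) (w : word) (c : F3) (ls : seq ptrie) {struct ls} :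
    seq ptrie :=
  match ls with
  | [::] => [:: padd w c PLeaf]
  | t :: ls' => if d is d'.+1 then t :: addat d' w c ls' else padd w c t :: ls'
  end.

(* The rule (l, r) rewrites l to the sum of the terms (d, (w, c)) of r, where
   d is the difference between the lengths of l and w. *)
Definition rule : Type := word * seq (nat * (word * F3)).

(* Indexed by the reversed left-hand sides. *)
Inductive rtrie :=
  RLeaf | RNode of option rule & rtrie & rtrie & rtrie & rtrie & rtrie.

Definition rnode t :=
  if t is RLeaf then RNode None RLeaf RLeaf RLeaf RLeaf RLeaf else t.

Fixpoint radd (p : word) (r : rule) (t : rtrie) : rtrie :=
  match rnode t with
  | RLeaf => RLeaf
  | RNode o t0 t1 t2 t3 t4 =>
    match p with
    | [::] => RNode (Some r) t0 t1 t2 t3 t4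
    | L0 :: v => RNode o (radd v r t0) t1 t2 t3 t4
    | L1 :: v => RNode o t0 (radd v r t1) t2 t3 t4
    | L2 :: v => RNode o t0 t1 (radd v r t2) t3 t4
    | L3 :: v => RNode o t0 t1 t2 (radd v r t3) t4
    | L4 :: v => RNode o t0 t1 t2 t3 (radd v r t4)
    end
  end.

(** Here [p] is the reversed prefix already read: a match is a left-hand side that ends at the
    current position, and the returned word is what precedes it, still reversed. *)
Fixpoint rback (p : word) (t : rtrie) {struct t} : option (word * rule) :=
  match t with
  | RLeaf => None
  | RNode (Some r) _ _ _ _ _ => Some (p, r)
  | RNode None t0 t1 t2 t3 t4 =>
    match p with
    | [::] => None
    | L0 :: q => rback q t0
    | L1 :: q => rback q t1
    | L2 :: q => rback q t2
    | L3 :: q => rback q t3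
    | L4 :: q => rback q t4
    end
  end.

Fixpoint rfind (R : rtrie) (p w : word) : option (word * rule * word) :=
  match rback p R with
  | Some (p', r) => Some (p', r, w)
  | None => if w is x :: w' then rfind R (x :: p) w' else None
  end.

(** The factorization found by [rfind] is tested again before it is used, so soundness needs no
    invariant of the index: a wrong lookup would only leave the term as it is. *)
Definition step (R : rtrie) (st : seq ptrie * ncpoly) :
    (seq ptrie * ncpoly) + ncpoly :=
  match st.1 with
  | [::] => inr st.2
  | t :: ls =>
    match ppop t with
    | None => inl (ls, st.2)
    | Some (w, c, t') =>
      if is0 c then inl (t' :: ls, st.2) else
      match rfind R [::] w with
      | None => inl (t' :: ls, (w, c) :: st.2)
      | Some (p, r, v) =>
        if pure p && same_word w (catrev p (r.1 ++ v)) then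
          inl (foldl (fun ls' m => addat m.1 (catrev p (m.2.1 ++ v))
                 (mul3 c m.2.2) ls') (t' :: ls) r.2, st.2)
        else inl (t' :: ls, (w, c) :: st.2)
      end
    end
  end.

(* At most 2 ^ k steps. *)
Fixpoint steps (k : nat) (R : rtrie) (st : seq ptrie * ncpoly) :=
  if k is k'.+1 then
    match steps k' R st with inl st' => steps k' R st' | inr p => inr p end
  else step R st.

Definition levels (p : ncpoly) : seq ptrie :=
  let m := foldr (fun t => maxn (size t.1)) 0%N p in
  foldl (fun ls t => addat (m - size t.1) t.1 t.2 ls) (nseq m.+1 PLeaf) p.

(** Irreducible terms pile up from the greatest to the least; after the reversal the head is the
    leading term, which [rule_of] turns into a left-hand side. *)
Definition reduce (R : rtrie) (p : ncpoly) : option ncpoly :=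
  if steps 30 R (levels p, [::]) is inr q then Some (rev q) else None.

(* The overlap of the rules a and b where the left-hand side of b starts at the
   position o of the left-hand side of a. *)
Definition spoly (a b : rule) (o : nat) : ncpoly :=
  let u := take o a.1 in
  let va := drop (size a.1 - o) b.1 in
  let vb := drop (o + size b.1) a.1 in
  if pure u && same_word (a.1 ++ va) (u ++ b.1 ++ vb) then
    [seq (m.2.1 ++ va, m.2.2) | m <- a.2]
      ++ [seq (u ++ m.2.1 ++ vb, opp3 m.2.2) | m <- b.2]
  else [::].

(** A nonzero element of the prime field is its own inverse, so multiplying by [c] makes the
    polynomial monic. The degenerate cases give the trivial rule from the empty word to itself. *)
Definition rule_of (p : ncpoly) : rule :=
  if p is (w, c) :: q then
    if is0 c then ([::], [:: (0%N, ([::], P3))]) else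
    (w, [seq (size w - size t.1, (t.1, opp3 (mul3 c t.2)))%N | t <- q])
  else ([::], [:: (0%N, ([::], P3))]).

(* Derived rules are referred to by their age, from the most recent one. *)
Variant job := In of nat | Ov of nat & nat & nat.

Definition gbstate : Type := seq rule * rtrie.

Definition rule0 : rule := rule_of [::].

Definition job_poly (ins : seq ncpoly) (rs : seq rule) (j : job) : ncpoly :=
  match j with
  | In i => nth [::] ins i
  | Ov a b o => spoly (nth rule0 rs a) (nth rule0 rs b) o
  end.

(** A job without result still records [rule0], outside of the index, so that ages count jobs. *)
Definition run_job (ins : seq ncpoly) (st : gbstate) (j : job) : gbstate :=
  if reduce st.2 (job_poly ins st.1 j) is Some ((_ :: _) as q) then
    (rule_of q :: st.1, radd (rev (rule_of q).1) (rule_of q) st.2)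
  else (rule0 :: st.1, st.2).

Definition run (ins : seq ncpoly) (js : seq job) : rtrie :=
  (foldl (run_job ins) ([::], RLeaf) js).2.

(** Growing words on the left is enough, since a suffix of an irreducible word is irreducible. That
    [k] lengths suffice is certified by [closed]. *)
Fixpoint normals (k : nat) (R : rtrie) (ls : seq letter) (ws : seq word) :=
  if k is k'.+1 then
    ws ++ normals k' R ls (flatten [seq [seq x :: w | x <- ls
                             & ~~ isSome (rfind R [::] (x :: w))] | w <- ws])
  else [::].

Definition closed (R : rtrie) (ls : seq letter) (ws : seq word) :=
  all (fun w => all (fun x =>
    if reduce R [:: (x :: w, P3)] is Some q then
      all (fun t => has (same_word t.1) ws) q else false) ls) ws.

(** * Soundness of the rewriting modulo a subgroup *)

Section Soundness.
Context (T : zmodType).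
Hypothesis three : forall x : T, x *+ 3 = 0.

Definition act3 (a : F3) (x : T) : T :=
  match a with O3 => 0 | P3 => x | M3 => - x end.

Lemma act3N a x : act3 (opp3 a) x = - act3 a x.
Proof. by case: a; rewrite /= ?oppr0 ?opprK. Qed.

Lemma act3M a b x : act3 (mul3 a b) x = act3 a (act3 b x).
Proof. by case: a => //=; rewrite act3N. Qed.

Lemma act3D a b x : act3 (add3 a b) x = act3 a x + act3 b x.
Proof.
have e : x + x = - x by apply/eqP; rewrite -addr_eq0 -(three x) !mulrS addr0 addrA.
have e' : - x - x = x by rewrite -opprD e opprK.
by case: a; case: b; rewrite /= ?addr0 ?add0r ?subrr ?addNr ?e ?e'.
Qed.

Lemma act3_0 a : act3 a 0 = 0.
Proof. by case: a; rewrite //= oppr0. Qed.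

Lemma act3DR a x y : act3 a (x + y) = act3 a x + act3 a y.
Proof. by case: a; rewrite /= ?addr0 // opprD. Qed.

Lemma act3NR a x : act3 a (- x) = - act3 a x.
Proof. by case: a; rewrite /= ?oppr0. Qed.

Definition lin (F : word -> T) (p : ncpoly) : T := \sum_(t <- p) act3 t.2 (F t.1).

Fixpoint plin (F : word -> T) (t : ptrie) : T :=
  if t is PNode c t0 t1 t2 t3 t4 then
    act3 c (F [::]) + (plin (fun w => F (L0 :: w)) t0 +
    (plin (fun w => F (L1 :: w)) t1 + (plin (fun w => F (L2 :: w)) t2 +
    (plin (fun w => F (L3 :: w)) t3 + plin (fun w => F (L4 :: w)) t4))))
  else 0.

Lemma plin_pnode F t : plin F (pnode t) = plin F t.
Proof. by case: t => //=; rewrite !addr0. Qed.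

Lemma plin_padd F w c t : plin F (padd w c t) = act3 c (F w) + plin F t.
Proof.
elim: w F t => [|x w IHw] F t; rewrite -[in RHS]plin_pnode.
  by case: t => [|d t0 t1 t2 t3 t4] /=; rewrite act3D -!addrA.
have -> : padd (x :: w) c t = padd (x :: w) c (pnode t) by case: t.
have [d [t0 [t1 [t2 [t3 [t4 ->]]]]]] : exists d t0 t1 t2 t3 t4,
    pnode t = PNode d t0 t1 t2 t3 t4.
  by case: t => [|d t0 t1 t2 t3 t4]; do 6!eexists.
by case: x => /=; rewrite IHw /= -?addrA !(addrCA _ (act3 c _)).
Qed.

Lemma plin_pmk F c t0 t1 t2 t3 t4 :
  plin F (pmk c t0 t1 t2 t3 t4) = plin F (PNode c t0 t1 t2 t3 t4).
Proof.
rewrite /pmk; case: ifP => // /and5P[]; case: c => // _.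
by case: t0 => // _; case: t1 => // _; case: t2 => // _ /andP[];
   case: t3 => // _; case: t4 => // _ /=; rewrite !addr0.
Qed.

Lemma ppop_none t : ppop t = None -> t = PLeaf.
Proof.
case: t => [//|c t0 t1 t2 t3 t4] /=.
by do 5!case: (ppop _) => [[[? ?] ?]//|].
Qed.

Lemma plin_ppop F t w c t' :
  ppop t = Some (w, c, t') -> plin F t = act3 c (F w) + plin F t'.
Proof.
elim: t F w c t' => [//|d t0 IH0 t1 IH1 t2 IH2 t3 IH3 t4 IH4] F w c t' /=.
case E4: (ppop t4) => [[[w4 c4] t4']|].
  by case=> <- <- <-; rewrite plin_pmk /= (IH4 _ _ _ _ E4) !(addrCA _ (act3 c4 _)).
case E3: (ppop t3) => [[[w3 c3] t3']|].
  case=> <- <- <-; rewrite plin_pmk /= (IH3 _ _ _ _ E3).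
  by rewrite -!addrA !(addrCA _ (act3 c3 _)).
case E2: (ppop t2) => [[[w2 c2] t2']|].
  case=> <- <- <-; rewrite plin_pmk /= (IH2 _ _ _ _ E2).
  by rewrite -!addrA !(addrCA _ (act3 c2 _)).
case E1: (ppop t1) => [[[w1 c1] t1']|].
  case=> <- <- <-; rewrite plin_pmk /= (IH1 _ _ _ _ E1).
  by rewrite -!addrA !(addrCA _ (act3 c1 _)).
case E0: (ppop t0) => [[[w0 c0] t0']|].
  case=> <- <- <-; rewrite plin_pmk /= (IH0 _ _ _ _ E0).
  by rewrite -!addrA !(addrCA _ (act3 c0 _)).
by case=> <- <- <-; rewrite (ppop_none E0) (ppop_none E1) (ppop_none E2)
  (ppop_none E3) (ppop_none E4) /= !addr0.
Qed.

Definition llin F (ls : seq ptrie) : T := \sum_(t <- ls) plin F t.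

Lemma llin_addat F d w c ls :
  llin F (addat d w c ls) = act3 c (F w) + llin F ls.
Proof.
elim: ls d => [|t ls IHls] d; rewrite /llin /=.
  by rewrite big_seq1 big_nil plin_padd.
case: d => [|d]; rewrite !big_cons; first by rewrite plin_padd addrA.
by rewrite -!/(llin _ _) IHls addrCA.
Qed.

Lemma lin_cat F p q : lin F (p ++ q) = lin F p + lin F q.
Proof. exact: big_cat. Qed.

Lemma lin_rev F p : lin F (rev p) = lin F p.
Proof.
elim: p => [//|t p IHp].
by rewrite rev_cons -cats1 lin_cat IHp /lin big_seq1 big_cons addrC.
Qed.

Lemma llin_levels F p : llin F (levels p) = lin F p.
Proof.
rewrite /levels; set m := foldr _ _ _.
have e ls : llin F (foldl (fun ls t => addat (m - size t.1) t.1 t.2 ls) ls p)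
    = lin F p + llin F ls.
  elim: p {m} ls m => [|t p IHp] ls m /=; first by rewrite [lin _ _]big_nil add0r.
  by rewrite IHp llin_addat [lin F (_ :: _)]big_cons addrCA addrA.
rewrite e -[RHS]addr0; congr (_ + _).
by rewrite /llin; elim: (m.+1) => [|k IHk]; rewrite ?big_nil // big_cons IHk addr0.
Qed.

Variable L : T -> Prop.
Hypothesis L_0 : L 0.
Hypothesis LD : forall x y, L x -> L y -> L (x + y).
Hypothesis LN : forall x, L x -> L (- x).

Lemma L_act3 a x : L x -> L (act3 a x).
Proof. by case: a => //=; exact: LN. Qed.

Variable E : word -> T.

Definition ctx (u v : word) (w : word) : T := E (u ++ w ++ v).

(** One notion serves two cases: [L] is zero for relations in a ring, and a left ideal for a cyclic
    left module. In the second case letters before [L4] act on the generator and letters after it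
    are ignored, hence pure left contexts and arbitrary right ones. *)
Definition valid (p : ncpoly) :=
  forall u v, pure u -> L (lin (ctx u v) p).

Definition valid_rule (r : rule) :=
  forall u v, pure u ->
  L (ctx u v r.1 - \sum_(m <- r.2) act3 m.2.2 (ctx u v m.2.1)).

Fixpoint rvalid (t : rtrie) : Prop :=
  if t is RNode o t0 t1 t2 t3 t4 then
    (if o is Some r then valid_rule r else True) /\
    [/\ rvalid t0, rvalid t1, rvalid t2, rvalid t3 & rvalid t4]
  else True.

Lemma rvalid_radd p r t : valid_rule r -> rvalid t -> rvalid (radd p r t).
Proof.
move=> rv; elim: p t => [|x p IHp] t tv.
  by case: t tv => [|o t0 t1 t2 t3 t4] /= => [_|[_ ?]]; split.
have -> : radd (x :: p) r t = radd (x :: p) r (rnode t) by case: t {tv}.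
have {tv}: rvalid (rnode t) by case: t tv.
have [o [t0 [t1 [t2 [t3 [t4 ->]]]]]] : exists o t0 t1 t2 t3 t4,
    rnode t = RNode o t0 t1 t2 t3 t4.
  by case: t => [|o t0 t1 t2 t3 t4]; do 6!eexists.
by case: x => /= -[? [*]]; split=> //; split=> //; exact: IHp.
Qed.

Lemma rvalid_rback p t p' r : rvalid t -> rback p t = Some (p', r) -> valid_rule r.
Proof.
elim: t p => [//|o t0 IH0 t1 IH1 t2 IH2 t3 IH3 t4 IH4] p /=.
case: o => [s|] [sv [v0 v1 v2 v3 v4]]; first by case=> _ <-.
by case: p => [//|[] p]; [exact: IH0|exact: IH1|exact: IH2|exact: IH3|exact: IH4].
Qed.

Lemma rvalid_rfind R p w p' r v :
  rvalid R -> rfind R p w = Some (p', r, v) -> valid_rule r.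
Proof.
move=> Rv; elim: w p => [|x w IHw] p /=; case e: rback => [[q s]|] //;
  try by [case=> _ <- _; apply: rvalid_rback e | exact: IHw].
Qed.

Lemma pure_cat u v : pure (u ++ v) = pure u && pure v.
Proof. exact: all_cat. Qed.

Lemma pure_rev u : pure (rev u) = pure u.
Proof. exact: all_rev. Qed.

Definition stlin F (st : seq ptrie * ncpoly) := llin F st.1 + lin F st.2.

Lemma lin_cons F t p : lin F (t :: p) = act3 t.2 (F t.1) + lin F p.
Proof. exact: big_cons. Qed.

Section Step.
Variables (R : rtrie) (u v : word).
Hypotheses (Rv : rvalid R) (pu : pure u).
Let F := ctx u v.

(** The rule is valid in the context enlarged by the prefix and the suffix of the rewritten word, so
    its use changes the value by an element of [L]; the other cases only move terms. *)
Lemma step_sound st :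
  match step R st with
  | inl st' => L (stlin F st - stlin F st')
  | inr q => stlin F st = lin F q
  end.
Proof.
have Lrefl x y : x = y -> L (x - y) by move=> ->; rewrite subrr.
case: st => [[|t ls] p]; rewrite /step /stlin /=; first by rewrite [llin _ _]big_nil add0r.
rewrite [llin F (t :: ls)]big_cons -!/(llin F ls).
case et: (ppop t) => [[[w c] t']|]; last first.
  by rewrite (ppop_none et) add0r; exact: Lrefl.
rewrite (plin_ppop F et).
have llc s : llin F (s :: ls) = plin F s + llin F ls by exact: big_cons.
case c0: (is0 c).
  by case: c c0 et => //= _ et; rewrite add0r llc; exact: Lrefl.
have Lkeep : L (act3 c (F w) + plin F t' + llin F ls + lin F p -
    (llin F (t' :: ls) + lin F ((w, c) :: p))).
  rewrite llc lin_cons; apply: Lrefl => /=; rewrite -!addrA.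
  by rewrite (addrCA (llin F ls)) (addrCA (plin F t') (act3 c (F w))).
case ef: rfind => [[[q r] z]|] //; case: ifP => // /andP[pq /same_wordP ew].
have /(_ (u ++ rev q) (z ++ v)) := rvalid_rfind Rv ef.
rewrite pure_cat pu pure_rev pq => /(_ isT) /(L_act3 c).
have ectx x : ctx (u ++ rev q) (z ++ v) x = F (catrev q (x ++ z)).
  by rewrite /F /ctx catrevE -!catA.
rewrite act3DR act3NR ectx -ew.
set S := \sum_(m <- _) _; set ls' := foldl _ _ _.
have els : llin F ls' = act3 c S + llin F (t' :: ls).
  rewrite /ls' /S; elim: r.2 (t' :: ls) => [|m ms IHm] ks /=.
    by rewrite big_nil act3_0 add0r.
  by rewrite IHm llin_addat big_cons act3DR act3M ectx addrCA addrA.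
rewrite els llc; set a := act3 c _; set b := act3 c _ => Lab.
suff -> : a + plin F t' + llin F ls + lin F p
  - (b + (plin F t' + llin F ls) + lin F p) = a - b by [].
by rewrite -2!(addrA a) -(addrA b) opprD addrACA subrr addr0.
Qed.

End Step.

Lemma steps_sound k R u v st : rvalid R -> pure u ->
  match steps k R st with
  | inl st' => L (stlin (ctx u v) st - stlin (ctx u v) st')
  | inr q => L (stlin (ctx u v) st - lin (ctx u v) q)
  end.
Proof.
move=> Rv pu; elim: k st => [|k IHk] st /=.
  have := step_sound v Rv pu st; case: step => // q ->.
  by rewrite subrr.
have := IHk st; case: (steps k R st) => [st' h|//].
have := IHk st'; case: steps => x h'.
  by have := LD h h'; rewrite addrA subrK.
by have := LD h h'; rewrite addrA subrK.
Qed.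

Lemma reduce_sound R p q u v : rvalid R -> pure u ->
  reduce R p = Some q -> L (lin (ctx u v) p - lin (ctx u v) q).
Proof.
move=> Rv pu; rewrite /reduce.
have := steps_sound 30 v (levels p, [::]) Rv pu.
case: steps => // r + [<-]; rewrite /stlin llin_levels lin_rev.
by rewrite [lin _ [::]]big_nil addr0.
Qed.

Lemma rule0_valid : valid_rule rule0.
Proof. by move=> u v pu; rewrite big_seq1 /= subrr. Qed.

Lemma rule_of_valid p : valid p -> valid_rule (rule_of p).
Proof.
case: p => [_|[w c] p pv]; first exact: rule0_valid.
rewrite /rule_of; case: ifP => [_|c0]; first exact: rule0_valid.
move=> u v pu; have := L_act3 c (pv u v pu).
have cK x : act3 c (act3 c x) = x by case: c c0 {pv} => //=; rewrite opprK.
rewrite lin_cons act3DR /= big_map cK -/(lin _ _).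
suff -> : act3 c (lin (ctx u v) p)
    = - \sum_(t <- p) act3 (opp3 (mul3 c t.2)) (ctx u v t.1) by [].
elim: p {pv} => [|t q IHq]; first by rewrite /lin !big_nil act3_0 oppr0.
by rewrite lin_cons act3DR IHq big_cons opprD act3N act3M opprK.
Qed.

(** By the test made in [spoly], both rules rewrite the same overlap word; subtracting the two
    congruences leaves the difference of the right-hand sides in [L]. *)
Lemma spoly_valid a b o : valid_rule a -> valid_rule b -> valid (spoly a b o).
Proof.
move=> av bv u v pu; rewrite /spoly; set p := take _ _; set x := drop _ b.1.
set y := drop _ a.1; case: ifP => [/andP[pp /same_wordP e]|_]; last first.
  by rewrite [lin _ _]big_nil.
have ax := av u (x ++ v) pu.
have by_ : L (ctx (u ++ p) (y ++ v) b.1 -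
    \sum_(m <- b.2) act3 m.2.2 (ctx (u ++ p) (y ++ v) m.2.1)).
  by apply: bv; rewrite pure_cat pu.
have e1 : ctx u (x ++ v) a.1 = ctx (u ++ p) (y ++ v) b.1.
  by rewrite /ctx -catA; congr (E (u ++ _)); rewrite catA e -!catA.
have := LD by_ (LN ax); rewrite opprB e1 addrC addrA subrK.
rewrite lin_cat /lin !big_map -sumrN /=.
have -> : \sum_(m <- a.2) act3 m.2.2 (ctx u v (m.2.1 ++ x))
    = \sum_(m <- a.2) act3 m.2.2 (ctx u (x ++ v) m.2.1).
  by apply: eq_bigr => m _; rewrite /ctx -!catA.
have -> : \sum_(m <- b.2) act3 (opp3 m.2.2) (ctx u v (p ++ m.2.1 ++ y))
    = \sum_(m <- b.2) - act3 m.2.2 (ctx (u ++ p) (y ++ v) m.2.1).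
  by apply: eq_bigr => m _; rewrite /ctx -!catA act3N.
by [].
Qed.

Lemma run_valid ins js : (forall p, List.In p ins -> valid p) -> rvalid (run ins js).
Proof.
move=> insv.
have nthv i : valid (nth [::] ins i).
  elim: ins insv i => [|p ins IHins] insv [|i] /=;
    try by move=> u v _; rewrite [lin _ _]big_nil.
    by apply: insv; left.
  by apply: IHins => q qi; apply: insv; right.
pose rsv rs := forall i, valid_rule (nth rule0 rs i).
rewrite /run; set st := (_, _); have stv : rsv st.1 /\ rvalid st.2.
  by split=> // i; rewrite nth_nil; exact: rule0_valid.
elim: js st stv => [|j js IHjs] [rs R] /= [rv Rv] //.
apply: IHjs; rewrite /run_job /=.
have cv r rs' : valid_rule r -> rsv rs' -> rsv (r :: rs') by move=> ? ? [].
case e: reduce => [[|t q]|]; try by split=> //; apply: cv => //; exact: rule0_valid.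
have qv : valid (t :: q).
  move=> u v pu; have jv : valid (job_poly ins rs j).
    by case: j {e} => [i|a b o] /=; [exact: nthv|exact: spoly_valid].
  have := LD (LN (reduce_sound v Rv pu e)) (jv u v pu).
  by rewrite opprB subrK.
have tv := rule_of_valid qv.
by split; [exact: cv|exact: rvalid_radd].
Qed.

End Soundness.

(** * Evaluation of words in the generators *)

Section LinearExtension.
Context (k : fieldType) (G : groupType) (T : pzAlgType k) (f : G -> T).

Definition lext (x : galg k G) : T :=
  \sum_(g <- msupp x) in_pzalg T x@_g * f g.

Lemma lextw (d : {fset G}) x : (msupp x `<=` d)%fset ->
  lext x = \sum_(g <- d) in_pzalg T x@_g * f g.
Proof.
move=> le; apply: big_fset_incl => // g _ /mcoeff_outdom ->.
by rewrite rmorph0 mul0r.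
Qed.

Fact lext_zmod_morphism : zmod_morphism lext.
Proof.
move=> x y; have sx := fsubsetUl (msupp x) (msupp y).
have sy := fsubsetUr (msupp x) (msupp y).
rewrite (lextw (msuppB_le x y)) (lextw sx) (lextw sy) -sumrB.
by apply: eq_bigr => g _; rewrite mcoeffB rmorphB mulrBl.
Qed.

HB.instance Definition _ :=
  GRing.isZmodMorphism.Build (galg k G) T lext lext_zmod_morphism.

Lemma lextU a g : lext << a *g g >> = in_pzalg T a * f g.
Proof. by rewrite (lextw msuppU_le) big_seq_fset1 mcoeffUU. Qed.

Lemma lext_of g : lext (galg_of k g) = f g.
Proof. by rewrite lextU rmorph1 mul1r. Qed.

Lemma lext_in a : f 1%g = 1 -> lext (in_pzalg _ a) = in_pzalg T a.
Proof. by move=> f1; rewrite [LHS]lextU f1 mulr1. Qed.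

Lemma lextM : {morph f : g h / (g * h)%g >-> g * h} ->
  {morph lext : x y / x * y}.
Proof.
move=> fM x y; elim/galg_ind: x => [|x x' IH IH'|a g].
- by rewrite mul0r raddf0 mul0r.
- by rewrite mulrDl !raddfD /= IH IH' mulrDl.
elim/galg_ind: y => [|y y' IH IH'|b h].
- by rewrite mulr0 raddf0 mulr0.
- by rewrite mulrDr !raddfD /= IH IH' mulrDr.
rewrite [_ * _]galg_mulUU !lextU fM rmorphM -!mulrA; congr (_ * _).
by rewrite !mulrA in_pzalgC.
Qed.

End LinearExtension.

Lemma galg_mapE (k : fieldType) (G H : groupType) (f : G -> H) x :
  galg_map f x = lext (fun g => galg_of k (f g)) x.
Proof. by apply: eq_bigr => g _; rewrite [RHS]galg_mulUU mulr1 mul1g. Qed.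

Lemma galg_of_inj (k : fieldType) (G : groupType) : injective (@galg_of k G).
Proof.
move=> g h /(congr1 (mcoeff h)); rewrite !mcoeffU eqxx.
by case: eqP => // _ /esym/eqP; rewrite oner_eq0.
Qed.

Section GammaEval.
Context (T : pzRingType) (n : nat) (s : nat -> T).
Hypothesis s_comm : forall i j,
  (i.+1 < j)%N -> (j < n.-1)%N -> s i * s j = s j * s i.
Hypothesis s_braid : forall i, (i.+1 < n.-1)%N ->
  s i * s i.+1 * s i = s i.+1 * s i * s i.+1.
Hypothesis s_cube : forall i, (i < n.-1)%N -> s i * s i * s i = 1.

(** An inverse letter goes to the square of the generator, which is its inverse by the cubic
    relation; thus the target can be any ring, without passing to units. *)
Definition geval (u : gword 'I_n.-1) : T :=
  foldr (fun (p : 'I_n.-1 * bool) y => (if p.2 then s p.1 * s p.1 else s p.1) * y) 1 u.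

Lemma geval_cat u v : geval (u ++ v) = geval u * geval v.
Proof. by elim: u => [|p u IHu] /=; rewrite ?mul1r // IHu mulrA. Qed.

Lemma gcong_geval u v : gcong (@Gamma_rel n) u v -> geval u = geval v.
Proof.
elim=> {u v} [u v|x b|//|u v _ -> //|v u w _ -> _ -> //|u u' v v' _ eu _ ev].
- case=> [i j ij|i j ij|i]; rewrite /= ?mulr1.
  + by case/orP: ij => ij; [rewrite s_comm|rewrite -s_comm].
  + by rewrite ij !mulrA s_braid // -ij.
  + by rewrite !mulrA s_cube.
- by rewrite /= mulr1; case: b => /=; rewrite ?mulrA s_cube.
- by rewrite !geval_cat eu ev.
Qed.

Definition glift (g : Gamma n) : T := geval (repr g).

Lemma glift_word u : glift (pres_word _ u) = geval u.
Proof. exact/gcong_geval/gcong_repr. Qed.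

Lemma gliftM g h : glift (g * h)%g = glift g * glift h.
Proof.
rewrite -[g]pres_word_repr -[h]pres_word_repr -pres_wordM !glift_word.
exact: geval_cat.
Qed.

Lemma glift1 : glift 1%g = 1.
Proof. exact: glift_word. Qed.

Lemma glift_gen (i : 'I_n.-1) : glift (Gamma_gen i) = s i.
Proof. by rewrite glift_word /= mulr1. Qed.

End GammaEval.

(* The letter L3 stands for s_1, L2 for s_2, L1 for s_3 and L0 for s_4. The
   letter L4 is kept for a generator of a left module; its index is junk. *)
Definition letter_index (x : letter) : nat :=
  match x with L3 => 0 | L2 => 1 | L1 => 2 | _ => 3 end.

Definition wprod (T : pzRingType) (s : letter -> T) (w : word) : T :=
  foldr (fun x y => s x * y) 1 w.

Lemma wprod_cat (T : pzRingType) (s : letter -> T) u v :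
  wprod s (u ++ v) = wprod s u * wprod s v.
Proof. by elim: u => [|x u IHu] /=; rewrite ?mul1r // IHu mulrA. Qed.

Lemma rmorph_wprod (T T' : pzRingType) (f : {rmorphism T -> T'})
  (s : letter -> T) w : f (wprod s w) = wprod (fun x => f (s x)) w.
Proof. by elim: w => [|x w IHw] /=; rewrite ?rmorph1 // rmorphM IHw. Qed.

Definition gens (T : pzRingType) (s : nat -> T) (x : letter) : T :=
  s (letter_index x).

(** The eight elements of Q as normal words of Gamma_3: those of length divisible by 3. *)
Definition Q8words : seq word :=
  [:: [::];
      [:: L3; L2; L2];
      [:: L2; L3; L2];
      [:: L3; L3; L2];
      [:: L2; L2; L3];
      [:: L2; L3; L3];
      [:: L2; L2; L3; L3; L2; L2];
      [:: L2; L2; L3; L2; L2; L3]].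

(** The defining relations of kK_n, for a family in any ring. Nothing is required of the indices
    from [n.-1] on, so one family can be used for several n. *)
Definition rels (T : pzRingType) (n : nat) (s : nat -> T) : Prop :=
  [/\ forall i j, (i.+1 < j)%N -> (j < n.-1)%N -> s i * s j = s j * s i,
      forall i, (i.+1 < n.-1)%N -> s i * s i.+1 * s i = s i.+1 * s i * s i.+1,
      forall i, (i < n.-1)%N -> s i * s i * s i = 1
    & \sum_(w <- Q8words) wprod (gens s) w = 0].

Definition braid_polys (ls : seq letter) : seq ncpoly :=
  [seq [:: ([:: x; x; x], P3); ([::], M3)] | x <- ls] ++
  flatten [seq [seq
     if letter_index y == (letter_index x).+1
     then [:: ([:: x; y; x], P3); ([:: y; x; y], M3)]
     else [:: ([:: x; y], P3); ([:: y; x], M3)]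
     | y <- ls & (letter_index x < letter_index y)%N] | x <- ls].

(* Which overlaps to resolve, and in which order, was found by a search outside
   of Rocq; the soundness of the resulting rules does not depend on it. *)
Definition Gamma3_schedule : seq job :=
  [:: In 0; In 1; In 2; Ov 0 0 2; Ov 0 1 3; Ov 1 1 3; Ov 4 1 2].
Definition K3_schedule : seq job :=
  [:: In 0; In 1; In 2; Ov 0 0 2; In 3; Ov 1 2 3; Ov 4 1 1; Ov 3 3 3].
Definition collapse_schedule : seq job :=
  [:: In 5; In 6; In 8; In 0; In 1; In 2; In 3; In 4; In 7; In 9; Ov 2 9 2;
   Ov 3 3 2; Ov 1 11 3; In 10; In 11; Ov 3 7 3; Ov 4 11 4; Ov 3 0 2; Ov 1 0 0;
   Ov 7 0 0; Ov 2 11 2; Ov 5 2 1; Ov 0 13 2; Ov 10 5 4; Ov 3 19 4; Ov 12 0 0;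
   Ov 1 20 2; Ov 3 2 0; Ov 0 20 2; Ov 25 0 0; Ov 1 28 1; Ov 4 1 2; Ov 10 0 0;
   Ov 5 1 2; Ov 4 32 2; Ov 5 34 2; Ov 34 0 0; Ov 4 1 2; Ov 28 1 0; Ov 4 3 3;
   Ov 2 0 1; Ov 32 1 1; Ov 8 4 0; Ov 36 0 0].
Definition left_schedule : seq job :=
  [:: In 5; In 6; In 8; In 13; In 0; In 1; In 2; In 3; In 4; In 7; In 9; Ov 8 7 1;
   In 11; In 12; Ov 11 2 1; Ov 6 14 2; Ov 6 13 2; Ov 12 4 1; Ov 9 0 2;
   Ov 3 1 3; In 10; Ov 12 12 2; Ov 12 12 2; Ov 12 12 2; Ov 15 11 2; Ov 9 23 3;
   Ov 10 25 3; Ov 10 24 3; Ov 19 8 1; Ov 5 25 4; Ov 14 5 3; Ov 4 13 4;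
   Ov 16 13 3; Ov 11 24 3; Ov 11 24 3; Ov 11 24 3; Ov 12 24 4; Ov 11 35 4;
   Ov 11 13 4; Ov 12 37 4; Ov 37 10 1; Ov 25 10 1; Ov 25 22 3; Ov 37 22 1;
   Ov 0 34 3; Ov 0 20 4; Ov 23 35 4; Ov 23 32 4; Ov 20 38 4; Ov 43 20 2;
   Ov 40 21 2; Ov 48 14 1; Ov 14 51 5; Ov 9 36 3; Ov 38 10 3; Ov 10 46 4;
   Ov 3 38 6; Ov 35 35 3; Ov 0 57 4; Ov 0 58 5; Ov 0 42 6; Ov 39 41 4;
   Ov 39 39 3; Ov 2 0 1; Ov 20 1 2; Ov 0 40 5; Ov 42 42 3; Ov 39 47 4;
   Ov 51 39 3; Ov 52 38 3; Ov 48 38 3; Ov 64 36 2; Ov 33 0 1; Ov 1 70 4;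
   Ov 52 1 1; Ov 69 2 1; Ov 2 73 5; Ov 6 2 1; Ov 70 42 2; Ov 69 37 2;
   Ov 70 37 1; Ov 37 53 3; Ov 38 59 3; Ov 73 37 2; Ov 37 73 5; Ov 82 37 1;
   Ov 83 34 1; Ov 27 62 6; Ov 82 24 1; Ov 4 85 7; Ov 62 61 4; Ov 63 60 4;
   Ov 75 59 3; Ov 76 51 3; Ov 77 48 3; Ov 72 49 3; Ov 32 0 1; Ov 9 1 2;
   Ov 89 2 1; Ov 19 0 1; Ov 34 0 2; Ov 57 1 1; Ov 97 2 2; Ov 19 2 1; Ov 8 0 1;
   Ov 100 1 1; Ov 17 1 2; Ov 52 8 1; Ov 34 5 4; Ov 92 2 3; Ov 93 2 3;
   Ov 56 104 6; Ov 0 106 5; Ov 0 108 4; Ov 0 103 3; Ov 71 1 2; Ov 99 2 3;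
   Ov 32 0 1; Ov 4 51 2; Ov 29 4 1; Ov 11 5 0; Ov 6 111 4; Ov 6 119 5;
   Ov 95 9 4; Ov 50 10 4; Ov 124 5 1; Ov 3 123 6; Ov 104 60 4; Ov 9 0 1;
   Ov 1 122 5; Ov 53 0 1; Ov 1 119 3; Ov 5 2 3; Ov 8 3 0; Ov 4 119 3;
   Ov 11 4 0; Ov 6 130 4; Ov 0 133 3; Ov 2 1 4; Ov 25 2 2; Ov 11 0 1; Ov 2 1 2;
   Ov 55 10 3; Ov 22 11 3; Ov 18 6 4; Ov 12 13 3; Ov 123 8 4; Ov 7 98 1;
   Ov 8 13 2; Ov 143 9 2; Ov 149 9 1; Ov 9 139 6; Ov 61 7 1; Ov 100 85 1;
   Ov 144 85 1; Ov 138 85 1; Ov 128 84 4; Ov 85 129 4; Ov 84 141 5;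
   Ov 85 139 5; Ov 137 81 4; Ov 79 142 6; Ov 145 60 3; Ov 137 59 4;
   Ov 136 57 4; Ov 164 55 1; Ov 6 0 1; Ov 157 57 1; Ov 167 57 1; Ov 77 0 1;
   Ov 160 59 1; Ov 154 56 3; Ov 149 57 3; Ov 55 94 4; Ov 59 56 1; Ov 44 61 5;
   Ov 166 45 2; Ov 154 45 4; Ov 60 46 4; Ov 65 44 3; Ov 65 42 5; Ov 29 0 1;
   Ov 3 0 1; Ov 34 0 1; Ov 182 3 1; Ov 174 3 1; Ov 184 4 1; Ov 186 4 1;
   Ov 186 4 1; Ov 35 1 1; Ov 188 46 1; Ov 54 46 1; Ov 191 47 1; Ov 191 47 1;
   Ov 112 30 1; Ov 194 26 1; Ov 172 16 1; Ov 196 0 1; Ov 45 0 1; Ov 196 14 1;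
   Ov 198 15 1; Ov 199 15 1; Ov 40 0 1; Ov 11 0 1; Ov 11 0 1; Ov 4 0 1;
   Ov 203 19 1; Ov 205 20 1; Ov 207 20 1; Ov 206 20 1; Ov 208 21 1;
   Ov 132 17 1; Ov 209 18 1; Ov 6 0 1; Ov 59 1 1; Ov 213 21 1; Ov 215 18 1;
   Ov 4 0 1; Ov 31 1 1; Ov 218 2 1; Ov 17 0 1; Ov 214 4 1; Ov 20 0 1;
   Ov 19 0 1; Ov 6 1 1; Ov 20 1 1; Ov 37 0 1; Ov 2 1 1; Ov 160 1 1; Ov 34 11 1;
   Ov 65 12 1; Ov 60 11 2; Ov 64 10 2; Ov 232 11 1; Ov 35 10 2; Ov 45 10 1;
   Ov 26 11 1; Ov 22 9 1; Ov 68 10 1; Ov 72 10 1; Ov 40 11 1; Ov 110 7 1;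
   Ov 46 7 1; Ov 174 0 1; Ov 5 1 1; Ov 17 1 1; Ov 165 2 1; Ov 12 2 1;
   Ov 138 3 1; Ov 11 4 1; Ov 139 4 1; Ov 11 5 1; Ov 83 5 1; Ov 89 6 1;
   Ov 13 7 1; Ov 26 7 1; Ov 90 8 1; Ov 187 8 1; Ov 16 9 1; Ov 65 9 1;
   Ov 54 9 1; Ov 53 9 1; Ov 48 9 1; Ov 77 9 1; Ov 55 9 1; Ov 54 9 1; Ov 54 9 1;
   Ov 51 9 1; Ov 49 9 1; Ov 89 9 1; Ov 49 9 1; Ov 126 9 1; Ov 74 9 1;
   Ov 85 8 1; Ov 223 0 1; Ov 25 1 1; Ov 28 1 1; Ov 28 2 1; Ov 235 3 1;
   Ov 24 3 1; Ov 181 4 1; Ov 30 4 1; Ov 206 5 1; Ov 102 5 1; Ov 102 5 1;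
   Ov 33 5 1; Ov 42 6 1; Ov 33 6 1; Ov 66 6 1; Ov 44 7 1; Ov 34 8 1; Ov 48 8 1;
   Ov 75 9 1; Ov 40 10 1; Ov 97 10 1; Ov 111 11 1; Ov 39 11 1; Ov 51 12 1;
   Ov 78 13 1; Ov 41 13 1; Ov 40 12 1].

(** * Matrices over the field with three elements *)

(* Matrices as lists of rows; missing entries are zero. *)
Definition nmx := seq (seq F3).

Definition ent (X : nmx) i j := nth O3 (nth [::] X i) j.

Fixpoint addrow (r s : seq F3) : seq F3 :=
  match r, s with
  | x :: r', y :: s' => add3 x y :: addrow r' s'
  | [::], t | t, [::] => t
  end.

Definition scalerow c (r : seq F3) := map (mul3 c) r.

Fixpoint lincomb (r : seq F3) (X : nmx) : seq F3 :=
  match r, X with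
  | O3 :: r', _ :: X' => lincomb r' X'
  | c :: r', s :: X' => addrow (scalerow c s) (lincomb r' X')
  | _, _ => [::]
  end.

Definition nmul (X Y : nmx) : nmx := [seq lincomb r Y | r <- X].

Fixpoint nadd (X Y : nmx) : nmx :=
  match X, Y with
  | r :: X', s :: Y' => addrow r s :: nadd X' Y'
  | [::], Z | Z, [::] => Z
  end.

Definition nscale c (X : nmx) : nmx := map (scalerow c) X.

Definition nid n : nmx :=
  mkseq (fun i => mkseq (fun j => if i == j then P3 else O3) n) n.

Definition same3 a b :=
  match a, b with O3, O3 | P3, P3 | M3, M3 => true | _, _ => false end.

Definition neq n (X Y : nmx) :=
  all (fun i => all (fun j => same3 (ent X i j) (ent Y i j)) (iota 0 n))
    (iota 0 n).

Lemma same3P a b : reflect (a = b) (same3 a b).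
Proof. by case: a; case: b; constructor. Qed.

Lemma neqP n X Y : reflect (forall i j, (i < n)%N -> (j < n)%N ->
  ent X i j = ent Y i j) (neq n X Y).
Proof.
apply: (iffP allP) => [h i j lt_in lt_jn|h i].
  have /h/allP h' : i \in iota 0 n by rewrite mem_iota.
  by have /h'/same3P : j \in iota 0 n by rewrite mem_iota.
rewrite mem_iota => lt_in; apply/allP => j; rewrite mem_iota => lt_jn.
exact/same3P/h.
Qed.

Lemma nth_addrow r s j : nth O3 (addrow r s) j = add3 (nth O3 r j) (nth O3 s j).
Proof.
elim: r s j => [|x r IHr] [|y s] [|j] //=; rewrite ?nth_nil //=; first by case: x.
by case: (nth _ _ _).
Qed.

Lemma nth_scalerow c r j : nth O3 (scalerow c r) j = mul3 c (nth O3 r j).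
Proof.
by elim: r j => [|x r IHr] [|j] //=; rewrite ?nth_nil //; case: c.
Qed.

Lemma ent_nadd X Y i j : ent (nadd X Y) i j = add3 (ent X i j) (ent Y i j).
Proof.
rewrite /ent; elim: X Y i => [|r X IHX] [|s Y] [|i] //=;
  rewrite ?nth_addrow ?nth_nil //=; try by case: (nth _ _ _).
Qed.

Lemma ent_nscale c X i j : ent (nscale c X) i j = mul3 c (ent X i j).
Proof.
rewrite /ent; elim: X i => [|r X IHX] [|i] //=; rewrite ?nth_nil ?nth_scalerow //;
  by case: c.
Qed.

Lemma ent_nid n i j : (i < n)%N -> (j < n)%N ->
  ent (nid n) i j = if i == j then P3 else O3.
Proof. by move=> lt_in lt_jn; rewrite /ent !nth_mkseq. Qed.

Section Numeric.
Context (A : pzRingType).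
Hypothesis three : 3%:R = 0 :> A.

Lemma val3_lincomb r X j : val3 (nth O3 (lincomb r X) j)
  = \sum_(i < size X) val3 (nth O3 r i) * val3 (ent X i j) :> A.
Proof.
elim: X r => [|s X IHX] [|c r] /=; rewrite ?big_ord0 ?nth_nil //.
- by case: c; rewrite /= nth_nil.
- by rewrite big1 // => i _; rewrite nth_nil mul0r.
have -> : nth O3 (match c with
    | O3 => lincomb r X | _ => addrow (scalerow c s) (lincomb r X) end) j
  = add3 (mul3 c (nth O3 s j)) (nth O3 (lincomb r X) j).
  by case: c => //; rewrite nth_addrow nth_scalerow.
by rewrite big_ord_recl (val3D three) val3M IHX.
Qed.

Definition mxn n (X : nmx) : 'M[A]_n := \matrix_(i, j) val3 (ent X i j).

Lemma mxn_mul n X Y : (size Y <= n)%N -> mxn n (nmul X Y) = mxn n X *m mxn n Y.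
Proof.
move=> Yn; apply/matrixP=> i j; rewrite !mxE /ent.
have [lt_iX|le_Xi] := ltnP i (size X); last first.
  have eX : nth [::] X i = [::] by rewrite nth_default.
  rewrite [nth [::] _ _]nth_default ?size_map // nth_nil big1 // => l _.
  by rewrite !mxE /ent eX nth_nil mul0r.
rewrite (nth_map [::]) // val3_lincomb.
rewrite (big_ord_widen n (fun l => val3 (nth O3 (nth [::] X i) l)
  * val3 (ent Y l j)) Yn) big_mkcond /=.
apply: eq_bigr => l _; rewrite !mxE; case: ifP => // /negbT; rewrite -leqNgt => le_Yl.
by rewrite [ent Y l j]/ent (nth_default [::]) // nth_nil mulr0.
Qed.

Lemma mxn_add n X Y : mxn n (nadd X Y) = mxn n X + mxn n Y.
Proof. by apply/matrixP=> i j; rewrite !mxE ent_nadd (val3D three). Qed.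

Lemma mxn_scale n c X : mxn n (nscale c X) = act3 c (mxn n X).
Proof.
by apply/matrixP=> i j; rewrite !mxE ent_nscale val3M;
   case: c; rewrite /= ?mxE ?mul0r ?mul1r ?mulN1r.
Qed.

Lemma mxn_id n : mxn n (nid n) = 1%:M.
Proof.
by apply/matrixP=> i j; rewrite !mxE ent_nid // (inj_eq val_inj); case: eqP.
Qed.

Lemma mxn_eq n X Y : neq n X Y -> mxn n X = mxn n Y.
Proof. by move/neqP=> e; apply/matrixP=> i j; rewrite !mxE e. Qed.

Lemma val3_inj : 1 != 0 :> A -> injective (@val3 A).
Proof.
move=> nz; have two : 1 + 1 != 0 :> A.
  apply: contraNneq nz => two; rewrite -three mulrS.
  by rewrite [2%:R]mulrS two addr0.
have N1 : -1 != 0 :> A by rewrite oppr_eq0.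
have P1 : 1 != -1 :> A by rewrite -subr_eq0 opprK.
case=> -[] //= /eqP; rewrite ?(eq_sym 0) ?(eq_sym (-1) 1);
  by rewrite ?(negPf nz) ?(negPf N1) ?(negPf P1).
Qed.

Lemma mxn_inj n X Y : 1 != 0 :> A -> mxn n X = mxn n Y -> neq n X Y.
Proof.
move=> nz /matrixP e; apply/neqP => i j lt_in lt_jn; apply: (val3_inj nz).
by have := e (Ordinal lt_in) (Ordinal lt_jn); rewrite !mxE.
Qed.

Definition nword n (S : letter -> nmx) (w : word) : nmx :=
  foldr (fun x => nmul (S x)) (nid n) w.

Lemma mxn_word n S w : (forall x, size (S x) <= n)%N ->
  mxn n (nword n S w) = wprod (fun x => mxn n (S x)) w.
Proof.
move=> Sn; elim: w => [|x w IHw] /=; first exact: mxn_id.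
rewrite mxn_mul ?IHw //.
by case: w {IHw} => [|y w] /=; rewrite ?size_mkseq // size_map.
Qed.

End Numeric.

(** * The quaternion subgroup *)

Definition poly_words (ws : seq word) : ncpoly := [seq (w, P3) | w <- ws].

Section RingRewriting.
Context (A : pzRingType) (s : letter -> A).
Hypothesis three : 3%:R = 0 :> A.

Definition pev (p : ncpoly) : A := lin (wprod s) p.

Lemma three_act (x : A) : x *+ 3 = 0.
Proof. by rewrite -mulr_natr three mulr0. Qed.

Lemma act3E a (x : A) : act3 a x = val3 a * x.
Proof. by case: a; rewrite /= ?mul0r ?mul1r ?mulN1r. Qed.

Lemma pevE p : pev p = \sum_(t <- p) val3 t.2 * wprod s t.1.
Proof. by apply: eq_bigr => t _; exact: act3E. Qed.

Lemma pev_word w : pev [:: (w, P3)] = wprod s w.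
Proof. exact: big_seq1. Qed.

Lemma lin_ctx u v p : lin (ctx (wprod s) u v) p = wprod s u * pev p * wprod s v.
Proof.
rewrite /pev /lin mulr_sumr mulr_suml; apply: eq_bigr => t _.
by rewrite /ctx !wprod_cat !act3E !mulrA val3C.
Qed.

Lemma valid_pev p : pev p = 0 -> valid (fun x => x = 0) (wprod s) p.
Proof. by move=> p0 u v _; rewrite lin_ctx p0 mulr0 mul0r. Qed.

Lemma run_rvalid R ins js : R = run ins js ->
  (forall r, List.In r ins -> pev r = 0) -> rvalid (fun x => x = 0) (wprod s) R.
Proof.
move=> -> ins0.
have D0 (x y : A) : x = 0 -> y = 0 -> x + y = 0 by move=> -> ->; rewrite addr0.
have N0 (x : A) : x = 0 -> - x = 0 by move=> ->; rewrite oppr0.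
by apply: (run_valid three_act) => // r /ins0; exact: valid_pev.
Qed.

Lemma run_reduce R ins js p q : R = run ins js ->
  (forall r, List.In r ins -> pev r = 0) ->
  reduce R p = Some q -> pev p = pev q.
Proof.
move=> /run_rvalid Rv /Rv{}Rv e; apply: subr0_eq.
have D0 (x y : A) : x = 0 -> y = 0 -> x + y = 0 by move=> -> ->; rewrite addr0.
have N0 (x : A) : x = 0 -> - x = 0 by move=> ->; rewrite oppr0.
have := reduce_sound three_act erefl D0 N0 (u := [::]) [::] Rv isT e.
by rewrite !lin_ctx /= !mul1r !mulr1.
Qed.

End RingRewriting.

Lemma In_map (I J : Type) (f : I -> J) y xs :
  List.In y (map f xs) -> exists2 x, List.In x xs & y = f x.
Proof.
elim: xs => //= x xs IHxs [<-|/IHxs[x' ? ?]]; first by exists x => //; left.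
by exists x' => //; right.
Qed.

Lemma In_map_mem (I : Type) (J : eqType) (f : I -> J) x xs :
  List.In x xs -> f x \in map f xs.
Proof.
elim: xs => //= y xs IHxs [->|/IHxs fx]; rewrite inE ?eqxx //.
by rewrite fx orbT.
Qed.

Lemma mem_map_In (I : Type) (J : eqType) (f : I -> J) y xs :
  y \in map f xs -> exists2 x, List.In x xs & y = f x.
Proof.
elim: xs => //= x xs IHxs; rewrite inE => /orP[/eqP ->|/IHxs[x' x'xs ->]].
  by exists x => //; left.
by exists x' => //; right.
Qed.

Lemma allP_In (I : Type) (a : pred I) s :
  all a s -> forall x, List.In x s -> a x.
Proof.
by elim: s => //= y s IHs /andP[ay /IHs as_] x [<-|/as_].
Qed.

Lemma In_cat (I : Type) (x : I) s t : List.In x (s ++ t) -> List.In x s \/ List.In x t.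
Proof.
elim: s => /= [|y s IHs]; first by right.
by case=> [?|/IHs[]]; [left; left|left; right|right].
Qed.

Lemma In_flatten (I : Type) (x : I) ss :
  List.In x (flatten ss) -> exists2 s, List.In s ss & List.In x s.
Proof.
elim: ss => [//|s ss IHss] /= x_in; case: (In_cat x_in) => [xs|xs].
  by exists s => //; left.
by have [t ts xt] := IHss xs; exists t => //; right.
Qed.

Lemma In_filter (I : Type) (x : I) (a : pred I) s :
  List.In x (filter a s) -> List.In x s /\ a x.
Proof.
elim: s => //= y s IHs; case: ifP => ay /=; last by case/IHs; split=> //; right.
by case=> [<-|/IHs[]]; split=> //; [left|right].
Qed.

Lemma braid_polys_eq0 (A : pzRingType) (n : nat) (s : nat -> A) ls p :
  (forall i j, (i.+1 < j)%N -> (j < n.-1)%N -> s i * s j = s j * s i) ->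
  (forall i, (i.+1 < n.-1)%N -> s i * s i.+1 * s i = s i.+1 * s i * s i.+1) ->
  (forall i, (i < n.-1)%N -> s i * s i * s i = 1) ->
  (forall x, List.In x ls -> letter_index x < n.-1)%N ->
  List.In p (braid_polys ls) -> pev (gens s) p = 0.
Proof.
move=> s_comm s_braid s_cube lsn p_in; case: (In_cat p_in) => {}p_in.
  have [x /lsn xn ->] := In_map p_in.
  by rewrite /pev /lin big_cons big_seq1 /= mulr1 mulrA s_cube ?subrr.
have [ps ps_in {}p_in] := In_flatten p_in.
have [x _ e] := In_map ps_in; rewrite e in p_in.
have [y y_in ->] := In_map p_in; have [/lsn yn xy] := In_filter y_in.
case: eqP => [exy|/eqP ne]; rewrite /pev /lin big_cons big_seq1 /= !mulr1.
  by rewrite !mulrA /gens exy s_braid ?subrr // -exy.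
by rewrite s_comm ?subrr // ltn_neqAle eq_sym ne.
Qed.

Lemma In_braid1 x : List.In x [:: L3; L2] -> (letter_index x < 2)%N.
Proof. by case=> [<-|[<-|]]. Qed.

Lemma In_braid3 x : List.In x [:: L3; L2; L1; L0] -> (letter_index x < 4)%N.
Proof. by do 4!case=> [<-//|]. Qed.

(** Generators have order 3, so their inverses are positive words. *)
Lemma Gamma_ind n (P : Gamma n -> Prop) : P 1%g ->
  (forall i g, P g -> P (Gamma_gen i * g)%g) -> forall g, P g.
Proof.
move=> P1 PM g; rewrite -[g]pres_word_repr; elim: (repr g) => [//|[i b] u Pu].
have -> : (i, b) :: u = [:: (i, b)] ++ u by [].
rewrite pres_wordM; case: b; last exact: PM.
have e : (pres_word (@Gamma_rel n) [:: (i, true)] * Gamma_gen i)%g = 1%g.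
  by rewrite -pres_wordM; apply/pres_wordP/gcong_inv.
have -> : pres_word (@Gamma_rel n) [:: (i, true)] = (Gamma_gen i * Gamma_gen i)%g.
  rewrite -[LHS]mulg1 -(Gamma_gen_cube i) !expgS expg0 mulg1.
  by rewrite mulgA e mul1g.
by rewrite -mulgA; exact: (PM _ _ (PM _ _ Pu)).
Qed.

Section Gamma3.
Context (k : fieldType) (char_k : 3%N \in [pchar k]).

Lemma three_k : 3%:R = 0 :> k.
Proof. exact: pcharf0 char_k. Qed.

Lemma three_alg (A : pzAlgType k) : 3%:R = 0 :> A.
Proof. by rewrite -(rmorph_nat (in_pzalg A)) three_k rmorph0. Qed.

Definition gen3 (x : letter) : Gamma 3 :=
  Gamma_gen (inord (letter_index x) : 'I_3.-1).

Definition gword3 (w : word) : Gamma 3 := foldr (fun x g => gen3 x * g)%g 1%g w.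

Definition Gamma3_rules := run (braid_polys [:: L3; L2]) Gamma3_schedule.
Definition words3 := normals 8 Gamma3_rules [:: L3; L2] [:: [::]].

(** Stability under left multiplication, with the empty word, makes the normal words cover Gamma_3.
    A product reduces to one word with coefficient 1, which is an equality in the group because
    group elements are distinct in the group algebra. *)
Lemma words3_closed : all (fun w => all (fun x =>
    if reduce Gamma3_rules [:: (x :: w, P3)] is Some [:: (v, P3)] then
      has (same_word v) words3 else false) [:: L3; L2]) words3.
Proof. by vm_compute. Qed.

Lemma words3_Q8 :
  all (fun w => (size w %% 3 == 0)%N ==> has (same_word w) Q8words) words3.
Proof. by vm_compute. Qed.

Let s3 (i : nat) : galg k (Gamma 3) := galg_of k (Gamma_gen (inord i : 'I_3.-1)).

Lemma wprod_gword3 w : wprod (gens s3) w = galg_of k (gword3 w).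
Proof. by elim: w => [|x w IHw] //=; rewrite IHw galg_ofM. Qed.

Lemma s3_braid_eq0 p : List.In p (braid_polys [:: L3; L2]) -> pev (gens s3) p = 0.
Proof.
apply: (@braid_polys_eq0 _ 3) => [i j lt_ij lt_j2|i lt_i|i _|x]; last exact: In_braid1.
- by exfalso; case: j lt_ij lt_j2 => [|[|j]].
- rewrite -!galg_ofM Gamma_gen_braid //.
  by case: i lt_i => // _; rewrite !inordK.
- rewrite -!galg_ofM -galg_of1; congr galg_of.
  by rewrite -(Gamma_gen_cube (inord i : 'I_3.-1)) !expgS expg0 mulg1 mulgA.
Qed.

Lemma has_same_word w ws : has (same_word w) ws -> List.In w ws.
Proof.
by elim: ws => //= v ws IHws /orP[/same_wordP ->|/IHws]; [left|right].
Qed.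

Lemma Gamma3_rulesE : Gamma3_rules = run (braid_polys [:: L3; L2]) Gamma3_schedule.
Proof. by []. Qed.

Lemma reduce3 w v : reduce Gamma3_rules [:: (w, P3)] = Some [:: (v, P3)] ->
  gword3 w = gword3 v.
Proof.
move=> e; apply: (@galg_of_inj k).
have := run_reduce (three_alg (galg k (Gamma 3))) Gamma3_rulesE s3_braid_eq0 e.
by rewrite !pev_word !wprod_gword3.
Qed.

Lemma words3_step w x : List.In w words3 -> List.In x [:: L3; L2] ->
  exists2 v, List.In v words3 & gword3 (x :: w) = gword3 v.
Proof.
move=> ww xl; have := allP_In (allP_In words3_closed ww) xl.
case e: (reduce Gamma3_rules [:: (x :: w, P3)]) => [[|[v []] []]|] // /has_same_word vw.
by exists v => //; exact: reduce3.
Qed.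

Lemma words3_nil : List.In [::] words3.
Proof. by apply: has_same_word; vm_compute. Qed.

Lemma gword3_ex g : exists2 w, List.In w words3 & g = gword3 w.
Proof.
elim/Gamma_ind: g => [|i g [w ww ->]]; first by exists [::]; first exact: words3_nil.
have [x xl ->] : exists2 x, List.In x [:: L3; L2] & Gamma_gen i = gen3 x.
  case: i => -[|[|//]] lt_i; [exists L3; first by left|exists L2; first by right; left].
    by apply: (congr1 (@Gamma_gen 3)); apply: val_inj; rewrite /= inordK.
  by apply: (congr1 (@Gamma_gen 3)); apply: val_inj; rewrite /= inordK.
exact: words3_step.
Qed.

Lemma Gamma3_to_C3_gword3 w : Gamma3_to_C3 (gword3 w) = (C3_gen ^+ size w)%g.
Proof.
elim: w => [|x w IHw] /=.
  by apply: (mulgI (Gamma3_to_C3 1)); rewrite -Gamma3_to_C3M !mulg1.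
by rewrite Gamma3_to_C3M IHw expgS Gamma3_to_C3_gen.
Qed.

Lemma C3_genX_eq1 n : (C3_gen ^+ n == 1)%g = (n %% 3 == 0)%N.
Proof.
have C3 : (C3_gen ^+ 3 = 1)%g by exact/eqP.
rewrite {1}(divn_eq n 3) expgD mulnC expgM C3 expg1n mul1g.
by have := ltn_pmod n (isT : 0 < 3)%N; case: (n %% 3)%N => [|[|[|]]].
Qed.

Lemma Q8_gword3 g :
  Gamma3_to_C3 g = 1%g <-> exists2 w, List.In w Q8words & g = gword3 w.
Proof.
split=> [g1|[w ww ->]].
  have [w ww eg] := gword3_ex g; exists w => //; apply: has_same_word.
  have /implyP := allP_In words3_Q8 ww; apply.
  by rewrite -C3_genX_eq1 -Gamma3_to_C3_gword3 -eg g1.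
rewrite Gamma3_to_C3_gword3; apply/eqP; rewrite C3_genX_eq1.
by have := allP_In (isT : all (fun w => size w %% 3 == 0)%N Q8words) ww.
Qed.

(** Two transvections that satisfy the relations of Gamma_3, whence a morphism to SL_2 of the prime
    field. *)
Definition SL2mx (x : letter) : nmx :=
  if x is L2 then [:: [:: P3; O3]; [:: M3; P3]]
  else [:: [:: P3; P3]; [:: O3; P3]].

Lemma size_SL2mx x : (size (SL2mx x) <= 2)%N.
Proof. by case: x. Qed.

(** The eight words already have distinct images in SL_2 of the prime field. *)
Lemma gword3_uniq : uniq [seq gword3 w | w <- Q8words].
Proof.
pose s i : 'M[k]_2 := mxn k 2 (SL2mx (if i is 0 then L3 else L2)).
have s_braid i : (i.+1 < 3.-1)%N -> s i * s i.+1 * s i = s i.+1 * s i * s i.+1.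
  by case: i => // _; rewrite /s -!mulmxE -!(mxn_mul three_k).
have s_cube i : (i < 3.-1)%N -> s i * s i * s i = 1.
  case: i => [|[]] // _; rewrite /s -!mulmxE -!(mxn_mul three_k) // -[1]/1%:M -mxn_id;
    by apply: mxn_eq; vm_compute.
have s_comm i j : (i.+1 < j)%N -> (j < 3.-1)%N -> s i * s j = s j * s i.
  by move=> lt_ij lt_j; exfalso; case: j lt_ij lt_j => [|[|j]].
(* For [L1], [L0] and [L4] the index is out of range and [inord] gives 0, in agreement with the
   default case of [SL2mx]; so [e] below holds for every word. *)
have inord2 i : (inord i : 'I_2) = (if i is 1 then 1 else 0)%N :> nat.
  case: i => [|[|i]]; [by rewrite inordK|by rewrite inordK|].
  by rewrite /inord /insubd insubF.
have e w : glift s (gword3 w) = mxn k 2 (nword 2 SL2mx w).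
  rewrite (mxn_word three_k _ size_SL2mx); elim: w => [|x w IHw].
    exact: (glift1 s_comm s_braid s_cube).
  rewrite [LHS](gliftM s_comm s_braid s_cube) IHw; congr (_ * _).
  rewrite (glift_gen s_comm s_braid s_cube) /s.
  by rewrite inord2; case: x.
apply: (@map_uniq _ _ (glift s)); rewrite -map_comp.
rewrite (eq_map (g := fun w => mxn k 2 (nword 2 SL2mx w))) //.
rewrite uniq_pairwise pairwise_map.
have : pairwise (fun v w => ~~ neq 2 (nword 2 SL2mx v) (nword 2 SL2mx w)) Q8words.
  by vm_compute.
apply: sub_pairwise => v w /=; apply: contraNneq.
by move/(mxn_inj three_k); apply; exact: oner_neq0.
Qed.

Lemma q3E : q3 k = \sum_(w <- Q8words) galg_of k (gword3 w).
Proof.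
rewrite /q3; have -> : Q8 = [set` [seq gword3 w | w <- Q8words]]%classic.
  apply/seteqP; split=> g.
    by move/Q8_gword3 => [w ww ->]; exact: (In_map_mem gword3 ww).
  by move=> gQ; apply/Q8_gword3; exact: (mem_map_In gQ).
by rewrite -fsbig_seq ?gword3_uniq // big_map.
Qed.

End Gamma3.

(** * The algebras kK_n and their morphisms *)

Section GammaAlgebra.
Context (k : fieldType) (char_k : 3%N \in [pchar k]) (n : nat) (le3n : (3 <= n)%N).

Lemma low_Q8words w : List.In w Q8words -> all (fun x => letter_index x < 2)%N w.
Proof.
exact: (allP_In (isT : all (all (fun x => letter_index x < 2)%N) Q8words)).
Qed.

Lemma hom_gword3 (T : pzRingType) (s : nat -> T) (h : Gamma n -> T) w :
  h 1%g = 1 -> {morph h : x y / (x * y)%g >-> x * y} ->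
  (forall i : 'I_n.-1, h (Gamma_gen i) = s i) ->
  all (fun x => letter_index x < 2)%N w ->
  h (Gamma_widen le3n (gword3 w)) = wprod (gens s) w.
Proof.
move=> h1 hM hs; elim: w => [_|x w IHw /= /andP[x2 w2]].
  rewrite (_ : Gamma_widen le3n _ = 1%g) //.
  by apply: (mulgI (Gamma_widen le3n 1)); rewrite -Gamma_widenM !mulg1.
rewrite Gamma_widenM hM IHw // Gamma_widen_gen hs; congr (s _ * _).
by rewrite /= inordK.
Qed.

Lemma qnE : qn k le3n =
  \sum_(w <- Q8words) galg_of k (Gamma_widen le3n (gword3 w)).
Proof.
rewrite /qn (q3E char_k) galg_mapE raddf_sum; apply: eq_bigr => w _.
exact: lext_of.
Qed.

Lemma big_In (I : Type) (T : nmodType) (f g : I -> T) xs :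
  (forall x, List.In x xs -> f x = g x) ->
  \sum_(x <- xs) f x = \sum_(x <- xs) g x.
Proof.
elim: xs => [|x xs IHxs] fg; first by rewrite !big_nil.
rewrite !big_cons fg; last by left.
by rewrite IHxs // => y yxs; apply: fg; right.
Qed.

Definition kgen (i : nat) : kK k n le3n :=
  if insub i is Some o then
    quot_proj _ (galg_of k (Gamma_gen (o : 'I_n.-1)))
  else 0.

Lemma kgenE (i : 'I_n.-1) : kgen i = quot_proj _ (galg_of k (Gamma_gen i)).
Proof. by rewrite /kgen valK. Qed.

Let proj_of (g : Gamma n) : kK k n le3n := quot_proj _ (galg_of k g).

Lemma proj_ofM : {morph proj_of : x y / (x * y)%g >-> x * y}.
Proof. by move=> x y; rewrite /proj_of galg_ofM rmorphM. Qed.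

Lemma proj_of1 : proj_of 1%g = 1.
Proof. exact: rmorph1. Qed.

Lemma rels_kK : rels n kgen.
Proof.
have kE i (lt_i : (i < n.-1)%N) : kgen i = proj_of (Gamma_gen (Ordinal lt_i)).
  exact: (kgenE (Ordinal lt_i)).
split=> [i j lt_ij lt_j|i lt_i|i lt_i|].
- have lt_i : (i < n.-1)%N by apply: ltn_trans lt_j; exact: ltnW.
  by rewrite !kE -!proj_ofM Gamma_gen_comm //= lt_ij.
- by rewrite (kE _ (ltnW lt_i)) (kE _ lt_i) -!proj_ofM Gamma_gen_braid.
- rewrite kE -!proj_ofM -proj_of1; congr proj_of.
  by rewrite -(Gamma_gen_cube (Ordinal lt_i)) !expgS expg0 mulg1 mulgA.
have qn0 : quot_proj [set qn k le3n] (qn k le3n) = 0.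
  rewrite -(rmorph0 (quot_proj [set qn k le3n])); apply/quot_projP.
  by rewrite subr0 => J [_]; apply.
apply: etrans qn0.
rewrite (congr1 (quot_proj [set qn k le3n]) qnE) rmorph_sum; apply: big_In => w /low_Q8words w2.
by rewrite -(hom_gword3 proj_of1 proj_ofM (fun i => esym (kgenE i)) w2).
Qed.

(** The algebra is spanned by products of generators, and these are built from the left to fit the
    closure of normal words under left multiplication. *)
Lemma kK_ind (P : kK k n le3n -> Prop) :
  (forall x y, P x -> P y -> P (x + y)) ->
  (forall c x, P x -> P (in_pzalg _ c * x)) ->
  P 1 -> (forall i x, (i < n.-1)%N -> P x -> P (kgen i * x)) ->
  forall x, P x.
Proof.
move=> PD PZ P1 PM; have P0 : P 0.
  by have := PZ 0 1 P1; rewrite rmorph0 mul0r.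
elim/quot_ind => x; elim/galg_ind: x => [|x y Px Py|a g].
- by rewrite rmorph0.
- by rewrite rmorphD; exact: PD.
have -> : << a *g g >> = galg_in (Gamma n) a * galg_of k g :> galg k (Gamma n).
  by rewrite [RHS]galg_mulUU mulr1 mul1g.
rewrite rmorphM; apply: (PZ a).
elim/Gamma_ind: g => [|i g Pg]; first by rewrite galg_of1 rmorph1.
rewrite galg_ofM rmorphM; have := PM i _ (ltn_ord i) Pg; by rewrite kgenE.
Qed.

Section Lift.
Context (T : pzAlgType k) (s : nat -> T) (sR : rels n s).

Let f : Gamma n -> T := glift s.

Let fM : {morph f : x y / (x * y)%g >-> x * y}.
Proof. by case: sR => *; exact: gliftM. Qed.

Let f1 : f 1%g = 1.
Proof. by case: sR => *; exact: glift1. Qed.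

Let f_gen (i : 'I_n.-1) : f (Gamma_gen i) = s i.
Proof. by case: sR => *; exact: glift_gen. Qed.

Lemma lext_qn : lext f (qn k le3n) = 0.
Proof.
have [_ _ _ <-] := sR; rewrite qnE raddf_sum; apply: big_In => w /low_Q8words w2.
by rewrite [LHS]lext_of (hom_gword3 f1 fM f_gen w2).
Qed.

Lemma lext_ideal x : ideal_gen [set qn k le3n] x -> lext f x = 0.
Proof.
move=> /(_ (fun y => lext f y = 0)); apply; split=> [|y ->]; last exact: lext_qn.
split=> [|y z /= y0 z0|a y b /= y0]; first exact: raddf0.
- by rewrite [LHS](raddfD (lext f)) [X in X + _]y0 [X in _ + X]z0 addr0.
- by rewrite !(lextM fM) [X in _ * X * _]y0 mulr0 mul0r.
Qed.

Definition kK_lift (u : kK k n le3n) : T := lext f (repr u).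

Lemma kK_lift_proj x : kK_lift (quot_proj _ x) = lext f x.
Proof.
have h := lext_ideal (@repr_quot_proj _ _ _ x).
by apply: subr0_eq; rewrite -[RHS]h [RHS](raddfB (lext f)).
Qed.

Fact kK_lift_zmod_morphism : zmod_morphism kK_lift.
Proof.
elim/quot_ind=> x; elim/quot_ind=> y.
by rewrite -rmorphB !kK_lift_proj raddfB.
Qed.

Fact kK_lift_monoid_morphism : monoid_morphism kK_lift.
Proof.
split=> [|]; first by rewrite -[1]/(quot_proj _ 1) kK_lift_proj [LHS]lext_of.
elim/quot_ind=> x; elim/quot_ind=> y.
by rewrite -rmorphM !kK_lift_proj (lextM fM).
Qed.

HB.instance Definition _ :=
  GRing.isZmodMorphism.Build (kK k n le3n) T kK_lift kK_lift_zmod_morphism.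
HB.instance Definition _ :=
  GRing.isMonoidMorphism.Build (kK k n le3n) T kK_lift kK_lift_monoid_morphism.

(** The universal property of kK_n among k-algebras. *)
Lemma kK_lift_ex : exists F : {rmorphism kK k n le3n -> T},
  (forall c, F (in_pzalg _ c) = in_pzalg T c) /\
  (forall i, (i < n.-1)%N -> F (kgen i) = s i).
Proof.
exists kK_lift; split=> [c|i lt_i]; first by rewrite [LHS]kK_lift_proj lext_in.
rewrite (kgenE (Ordinal lt_i)) [LHS]kK_lift_proj [LHS]lext_of.
exact: (f_gen (Ordinal lt_i)).
Qed.

End Lift.

End GammaAlgebra.

(** * Linear forms and spanning words *)

(* Each row of an echelon basis comes with the position of its pivot. *)
Definition redrow (bs : seq (nat * seq F3)) (r : seq F3) : seq F3 :=
  foldl (fun r b =>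
    let c := nth O3 r b.1 in
    if is0 c then r else addrow r (scalerow (opp3 c) b.2)) r bs.

(** The leading entry is its own inverse, so the scaled row has pivot 1. A new row vanishes at the
    earlier pivots, so one pass of [redrow] in the order of insertion clears all of them. *)
Definition insrow (bs : seq (nat * seq F3)) (r : seq F3) :=
  let r' := redrow bs r in
  let p := find (fun a => ~~ is0 a) r' in
  if (p < size r')%N then rcons bs (p, scalerow (nth O3 r' p) r') else bs.

Definition echelon (rs : seq (seq F3)) := foldl insrow [::] rs.

Definition entails (bs : seq (nat * seq F3)) (r : seq F3) :=
  all is0 (redrow bs r).

Definition urow i : seq F3 := ncons i O3 [:: P3].

Section LinearForms.
Context (T : zmodType).
Hypothesis three : forall x : T, x *+ 3 = 0.

Fixpoint linf (r : seq F3) (b : nat -> T) : T :=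
  if r is c :: r' then act3 c (b 0) + linf r' (fun i => b i.+1) else 0.

Lemma linf_addrow r s b : linf (addrow r s) b = linf r b + linf s b.
Proof.
elim: r s b => [|x r IHr] [|y s] b /=; rewrite ?add0r ?addr0 //.
by rewrite IHr (act3D three) addrACA.
Qed.

Lemma linf_scalerow c r b : linf (scalerow c r) b = act3 c (linf r b).
Proof.
by elim: r b => [|x r IHr] b /=; rewrite ?act3_0 // IHr act3DR act3M.
Qed.

Lemma linf_all0 r b : all is0 r -> linf r b = 0.
Proof. by elim: r b => //= -[] //= r IHr b /IHr ->; rewrite addr0. Qed.

Lemma linf_urow i b : linf (urow i) b = b i.
Proof. by elim: i b => [|i IHi] b /=; rewrite ?addr0 // add0r IHi. Qed.

Lemma linfE n r b : (size r <= n)%N ->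
  linf r b = \sum_(i < n) act3 (nth O3 r i) (b i).
Proof.
elim: n r b => [|n IHn] [|c r] b //=; rewrite ?big_ord0 //.
  by move=> _; rewrite big1 // => i _; rewrite nth_nil.
by move=> rn; rewrite big_ord_recl /= IHn.
Qed.

Variable b : nat -> T.

Definition basis0 (bs : seq (nat * seq F3)) :=
  forall pr, List.In pr bs -> linf pr.2 b = 0.

Lemma linf_redrow bs r : basis0 bs -> linf (redrow bs r) b = linf r b.
Proof.
rewrite /redrow; elim: bs r => //= pr bs IHbs r bs0.
rewrite IHbs => [|qs qbs]; last by apply: bs0; right.
case: ifP => // _; rewrite linf_addrow linf_scalerow (bs0 pr) ?act3_0 ?addr0 //.
by left.
Qed.

Lemma basis0_echelon rs :
  (forall r, List.In r rs -> linf r b = 0) -> basis0 (echelon rs).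
Proof.
rewrite /echelon => rs0; have: basis0 [::] by [].
elim: rs rs0 [::] => //= r rs IHrs rs0 bs bs0.
apply: IHrs => [s srs|]; first by apply: rs0; right.
rewrite /insrow; case: ifP => // _ pr; rewrite -cats1 => pr_in.
case: (In_cat pr_in) => [/bs0 //|[<-|//]] /=.
by rewrite linf_scalerow linf_redrow // rs0 ?act3_0 //; left.
Qed.

Lemma entails_linf rs r : (forall s, List.In s rs -> linf s b = 0) ->
  entails (echelon rs) r -> linf r b = 0.
Proof.
move=> rs0 /linf_all0 e; rewrite -(linf_redrow r (basis0_echelon rs0)).
exact: e.
Qed.

End LinearForms.

(* Two bits for each entry, from the lowest ones, and a final mark. *)
Fixpoint trits (p : positive) : seq F3 :=
  match p with
  | xO (xO q) => O3 :: trits q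
  | xI (xO q) => P3 :: trits q
  | xO (xI q) => M3 :: trits q
  | _ => [::]
  end.

Definition nmx_of (ps : seq positive) : nmx := map trits ps.

Section NumericGenerators.
Context (A : pzRingType) (C : A) (N : nat) (S : nat -> nmx).
Hypothesis three : 3%:R = 0 :> A.
Hypothesis CC : forall x, C * x = x * C.
Hypothesis C3 : C ^+ 3 = 1.
Hypothesis sizeS : forall i, (size (S i) <= N)%N.

Definition ngen (i : nat) : 'M[A]_N := C%:M * mxn A N (S i).

Definition nletter (x : letter) : nmx := S (letter_index x).

Lemma scalar_mxCA (a : A) (M : 'M[A]_N) :
  (forall x, a * x = x * a) -> a%:M * M = M * a%:M.
Proof.
move=> aC; rewrite [LHS]mul_scalar_mx; apply/matrixP=> i j.
rewrite [RHS]mxE (bigD1 j) //= !mxE eqxx mulr1n aC big1 ?addr0 // => l ne_lj.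
by rewrite !mxE (negPf ne_lj) mulr0.
Qed.

(** The factors [C] are central and gather in front; in particular words of length divisible by 3
    have values over the prime field. *)
Lemma wprod_ngen w : wprod (gens ngen) w
  = (C ^+ size w)%:M * mxn A N (nword N nletter w).
Proof.
rewrite (mxn_word three _ (fun x => sizeS _)).
elim: w => [|x w IHw] /=; first by rewrite expr0 mulr1.
rewrite IHw exprS scalar_mxM -mulmxE !mulmxA; congr (_ *m _).
rewrite -!mulmxA; congr (_ *m _).
apply/esym/scalar_mxCA => y.
exact: (esym (commrX (size w) (esym (CC y)))).
Qed.

Lemma C_mod3 m : (m %% 3 = 0)%N -> C ^+ m = 1.
Proof.
by move=> m3; rewrite (divn_eq m 3) m3 addn0 mulnC exprM C3 expr1n.
Qed.

End NumericGenerators.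

Definition seqsum (Xs : seq nmx) : nmx := foldr nadd [::] Xs.

Lemma mxn_sum (A : pzRingType) (I : Type) (three : 3%:R = 0 :> A) n
    (f : I -> nmx) xs :
  mxn A n (seqsum (map f xs)) = \sum_(x <- xs) mxn A n (f x).
Proof.
elim: xs => [|x xs IHxs] /=.
  by rewrite big_nil; apply/matrixP=> i j; rewrite !mxE /ent !nth_nil.
by rewrite big_cons (mxn_add three) IHxs.
Qed.

Definition check_rels (n N : nat) (S : nat -> nmx) : bool :=
  [&& all (fun j => all (fun i => (i.+1 < j)%N ==>
        neq N (nmul (S i) (S j)) (nmul (S j) (S i))) (iota 0 n.-1)) (iota 0 n.-1),
      all (fun i => (i.+1 < n.-1)%N ==>
        neq N (nmul (S i) (nmul (S i.+1) (S i)))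
          (nmul (S i.+1) (nmul (S i) (S i.+1)))) (iota 0 n.-1),
      all (fun i => neq N (nmul (S i) (nmul (S i) (S i))) (nid N)) (iota 0 n.-1)
    & neq N (seqsum [seq nword N (nletter S) w | w <- Q8words]) [::]].

Lemma central_mul2 (R : pzRingType) (c : R) : (forall x, c * x = x * c) ->
  forall x y, c * x * (c * y) = c * c * (x * y).
Proof. by move=> cC x y; rewrite -!mulrA; congr (_ * _); rewrite !mulrA cC. Qed.

Lemma central_mul3 (R : pzRingType) (c : R) : (forall x, c * x = x * c) ->
  forall x y z, c * x * (c * y) * (c * z) = c * c * c * (x * (y * z)).
Proof.
move=> cC x y z; rewrite central_mul2 // -!mulrA; do 2!congr (_ * _).
by rewrite !mulrA -(cC (x * y)) -!mulrA.
Qed.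

(** Each relation compares words whose lengths agree modulo 3, so the powers of [C] match and the
    relations of the numerical matrices suffice. *)
Lemma rels_ngen (A : pzRingType) (C : A) n N S :
  3%:R = 0 :> A -> (forall x, C * x = x * C) -> C ^+ 3 = 1 ->
  (forall i, size (S i) <= N)%N ->
  check_rels n N S -> rels n (ngen C N S).
Proof.
move=> three CC C3 sizeS /and4P[h_comm h_braid h_cube h_q].
have CM M : C%:M * M = M * C%:M :> 'M_N by exact: scalar_mxCA.
have sM X Y : (size (nmul X Y) <= N)%N = (size X <= N)%N by rewrite size_map.
have M2 i j : ngen C N S i * ngen C N S j
    = C%:M * C%:M * mxn A N (nmul (S i) (S j)).
  by rewrite (mxn_mul three _ (sizeS j)) /ngen central_mul2.
have M3 i j l : ngen C N S i * ngen C N S j * ngen C N S l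
    = mxn A N (nmul (S i) (nmul (S j) (S l))).
  rewrite (mxn_mul three) ?sM // (mxn_mul three) // /ngen central_mul3 //.
  by rewrite -!mulmxE -!scalar_mxM -mulrA -expr2 -exprS C3 mul1mx.
have inI i : (i < n.-1)%N -> i \in iota 0 n.-1 by rewrite mem_iota.
split=> [i j lt_ij lt_j|i lt_i|i lt_i|].
- have lt_i : (i < n.-1)%N by apply: ltn_trans lt_j; exact: ltnW.
  have := allP (allP h_comm j (inI j lt_j)) i (inI i lt_i).
  by rewrite lt_ij /= => /mxn_eq e; rewrite !M2 e.
- have := allP h_braid i (inI i (ltnW lt_i)); rewrite lt_i /= => /mxn_eq e.
  by rewrite !M3 e.
- by have /mxn_eq e := allP h_cube i (inI i lt_i); rewrite M3 e mxn_id.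
have nil0 : mxn A N [::] = 0.
  by apply/matrixP=> i j; rewrite !mxE /ent !nth_nil.
apply: etrans nil0; rewrite -(mxn_eq A h_q) (mxn_sum three).
apply: big_In => w ww; rewrite (wprod_ngen three CC sizeS) C_mod3 ?mul1r //.
apply/eqP.
exact: (allP_In (isT : all (fun w => size w %% 3 == 0)%N Q8words) ww).
Qed.

Lemma closed_step (T : zmodType) (three : forall x : T, x *+ 3 = 0)
    (L : T -> Prop) (E : word -> T) R ls ws w x :
  L 0 -> (forall y z, L y -> L z -> L (y + z)) -> (forall y, L y -> L (- y)) ->
  rvalid L E R -> closed R ls ws -> List.In w ws -> List.In x ls ->
  exists2 q, forall t, List.In t q -> List.In t.1 ws & L (E (x :: w) - lin E q).
Proof.
move=> L0 LD LN Rv cR ww xl; have := allP_In (allP_In cR ww) xl.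
case e: (reduce R [:: (x :: w, P3)]) => [q|] // qws; exists q => [t tq|].
  exact: has_same_word (allP_In qws tq).
have := reduce_sound three L0 LD LN (u := [::]) [::] Rv isT e.
have lin_ctx0 p : lin (ctx E [::] [::]) p = lin E p.
  by apply: eq_bigr => t _; rewrite /ctx cats0.
by rewrite !lin_ctx0 {1}/lin big_seq1.
Qed.

Lemma in_val3 (k : fieldType) (A : pzAlgType k) a :
  in_pzalg A (val3 a) = val3 a.
Proof. by case: a; rewrite /= ?rmorph0 ?rmorph1 ?rmorphN1. Qed.

(** * Spans of words modulo a left ideal *)

Section Span.
Context (k : fieldType) (A : pzAlgType k) (s : letter -> A) (F : word -> A).
Context (L : A -> Prop) (ls : seq letter) (ws : seq word).
Hypothesis L0 : L 0.
Hypothesis LD : forall x y, L x -> L y -> L (x + y).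
Hypothesis LM : forall a x, L x -> L (a * x).
Hypothesis FS : forall x w, List.In x ls -> F (x :: w) = s x * F w.
Hypothesis step_ws : forall w x, List.In w ws -> List.In x ls ->
  exists2 q, forall t, List.In t q -> List.In t.1 ws & L (F (x :: w) - lin F q).

Definition comb (c : nat -> k) : A :=
  \sum_(i < size ws) in_pzalg A (c i) * F (nth [::] ws i).

Definition spanned (y : A) : Prop := exists c, L (y - comb c).

Lemma spannedD x y : spanned x -> spanned y -> spanned (x + y).
Proof.
move=> [c Lx] [d Ly]; exists (fun i => c i + d i).
have -> : x + y - comb (fun i => c i + d i) = x - comb c + (y - comb d).
  rewrite addrACA -opprD; congr (_ - _); rewrite -big_split.
  by apply: eq_bigr => i _; rewrite rmorphD mulrDl.
exact: LD.
Qed.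

Lemma spannedZ a x : spanned x -> spanned (in_pzalg A a * x).
Proof.
move=> [c Lx]; exists (fun i => a * c i).
have -> : comb (fun i => a * c i) = in_pzalg A a * comb c.
  by rewrite mulr_sumr; apply: eq_bigr => i _; rewrite rmorphM mulrA.
by rewrite -mulrBr; exact: LM.
Qed.

Lemma spanned0 : spanned 0.
Proof.
exists (fun=> 0); rewrite /comb big1 ?subrr // => i _.
by rewrite rmorph0 mul0r.
Qed.

Lemma spannedL x y : L (x - y) -> spanned y -> spanned x.
Proof. by move=> Lxy [c Ly]; exists c; have := LD Lxy Ly; rewrite addrA subrK. Qed.

Lemma spanned_word w : List.In w ws -> spanned (F w).
Proof.
move=> ww; have [j lt_j <-] : exists2 j, (j < size ws)%N & nth [::] ws j = w.
  elim: (ws) ww => //= v vs IHvs [->|/IHvs[j lt_j <-]]; first by exists 0%N.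
  by exists j.+1.
exists (fun i => (i == j)%:R); rewrite /comb (bigD1 (Ordinal lt_j)) //= eqxx.
rewrite rmorph1 mul1r big1 ?addr0 ?subrr // => i /eqP ne_ij.
case: eqP => [e|_]; last by rewrite rmorph0 mul0r.
by case: ne_ij; exact: val_inj.
Qed.

Lemma spanned_lin q : (forall t, List.In t q -> List.In t.1 ws) -> spanned (lin F q).
Proof.
elim: q => [|t q IHq] qws; first by rewrite /lin big_nil; exact: spanned0.
rewrite lin_cons act3E -in_val3; apply: spannedD; last first.
  by apply: IHq => u uq; apply: qws; right.
by apply/spannedZ/spanned_word/qws; left.
Qed.

Lemma spanned_gen x y : List.In x ls -> spanned y -> spanned (s x * y).
Proof.
move=> xl [c Ly]; apply: (@spannedL _ (s x * comb c)).
  by rewrite -mulrBr; exact: LM.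
rewrite /comb; elim/big_rec: _ => [|i z _ sz]; first by rewrite mulr0; exact: spanned0.
rewrite mulrDr; apply: spannedD sz.
rewrite mulrA -in_pzalgC -mulrA; apply: spannedZ; rewrite -FS //.
have ww : List.In (nth [::] ws i) ws.
  elim: (ws) (nat_of_ord i) (ltn_ord i) => //= v vs IHvs [|j] lt_j; first by left.
  by right; exact: IHvs.
have [q qws Lq] := step_ws ww xl.
by apply: spannedL Lq _; exact: spanned_lin.
Qed.

End Span.

(** * Coordinates in the group algebra of C_3 *)

Section GroupAlgebraC3.
Context (k : fieldType).

Definition cgen : galg k C3 := galg_of k C3_gen.

Lemma cgenX m : cgen ^+ m = galg_of k (C3_gen ^+ m)%g.
Proof.
elim: m => [|m IHm]; first by rewrite expr0 expg0 galg_of1.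
by rewrite exprS IHm expgS galg_ofM.
Qed.

Lemma cgenC x : cgen * x = x * cgen.
Proof.
elim/galg_ind: x => [|x y IHx IHy|a g]; first by rewrite mulr0 mul0r.
  by rewrite mulrDr mulrDl IHx IHy.
rewrite [LHS]galg_mulUU [RHS]galg_mulUU mulrC -(C3_genX g).
by rewrite -expgS -expgSr.
Qed.

Lemma cgen3 : cgen ^+ 3 = 1.
Proof.
rewrite cgenX -galg_of1; congr galg_of.
by apply/eqP; rewrite C3_genX_eq1.
Qed.

Definition cf (d : nat) (z : galg k C3) : k := mcoeff (C3_gen ^+ d)%g z.

Lemma cfD d x y : cf d (x + y) = cf d x + cf d y.
Proof. exact: mcoeffD. Qed.

Lemma cfZ d a x : cf d (in_pzalg _ a * x) = a * cf d x.
Proof.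
elim/galg_ind: x => [|x y IHx IHy|b g]; first by rewrite mulr0 /cf mcoeff0 mulr0.
  by rewrite (mulrDr (in_pzalg _ a)) !cfD IHx IHy -mulrDr.
by rewrite [_ * _]galg_mulUU /cf !mcoeffU mul1g mulrnAr.
Qed.

Lemma cf_inj z : (forall d, (d < 3)%N -> cf d z = 0) -> z = 0.
Proof.
move=> z0; apply/malgP => g; rewrite mcoeff0 -(C3_genX g).
exact: z0.
Qed.

Lemma cf_cgenX d m e : (d < 3)%N ->
  cf d (cgen ^+ m * val3 e) = if (m %% 3 == d)%N then val3 e else 0.
Proof.
move=> lt_d; rewrite -in_val3 -in_pzalgC cfZ cgenX /cf mcoeffU.
have -> : (C3_gen ^+ m == C3_gen ^+ d)%g = (m %% 3 == d)%N.
  rewrite {1}(divn_eq m 3) expgD mulnC expgM.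
  have -> : (C3_gen ^+ 3)%g = 1%g by apply/eqP; rewrite C3_genX_eq1.
  rewrite expg1n mul1g.
  have lt_r := ltn_pmod m (isT : 0 < 3)%N.
  by rewrite (C3_genX (Ordinal lt_r)) (C3_genX (Ordinal lt_d)).
by case: ifP; rewrite ?mulr1 ?mulr0.
Qed.

End GroupAlgebraC3.

(** * The algebra kK_3 *)

(** The rows generate every linear form in [d] variables. *)
Definition indep d rows : bool :=
  let bs := echelon rows in all (fun i => entails bs (urow i)) (iota 0 d).

(** Each coordinate form is a combination of the rows over the prime field, hence vanishes where
    they do. *)
Lemma coords_free (k : fieldType) (three : 3%:R = 0 :> k) d rows (c : nat -> k) :
  all (fun r => size r <= d)%N rows ->
  indep d rows ->
  (forall j, (j < size rows)%N ->
     \sum_(i < d) c i * val3 (nth O3 (nth [::] rows j) i) = 0) ->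
  forall i, (i < d)%N -> c i = 0.
Proof.
move=> rowsd check rows0 i lt_i; rewrite -(linf_urow i c).
have iI : i \in iota 0 d by rewrite mem_iota.
apply: (entails_linf (three_act three)) (allP check i iI) => r rin.
have [j lt_j <-] : exists2 j, (j < size rows)%N & nth [::] rows j = r.
  elim: (rows) rin => //= v vs IHvs [->|/IHvs[j lt_j <-]]; first by exists 0%N.
  by exists j.+1.
have /(all_nthP [::])/(_ j lt_j) rjd := rowsd; rewrite (@linfE _ d) //.
by rewrite -[RHS](rows0 j lt_j); apply: eq_bigr => l _; rewrite act3E mulrC.
Qed.

(** With as many rows as unknowns, the trivial kernel given by [coords_free] makes the matrix
    invertible. *)
Lemma coords_full (k : fieldType) (three : 3%:R = 0 :> k) d rows (t : nat -> k) :
  size rows = d -> all (fun r => size r <= d)%N rows -> indep d rows ->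
  exists c : nat -> k, forall j, (j < d)%N ->
     \sum_(i < d) c i * val3 (nth O3 (nth [::] rows j) i) = t j.
Proof.
move=> sz_rows rowsd check.
pose M : 'M[k]_d := \matrix_(i, j) val3 (nth O3 (nth [::] rows j) i).
pose coef (v : 'rV[k]_d) i := if insub i is Some o then v 0 o else 0.
have coefE v (i : 'I_d) : coef v i = v 0 i by rewrite /coef valK.
have coefM v (j : 'I_d) : \sum_(i < d) coef v i * val3 (nth O3 (nth [::] rows j) i)
    = (v *m M) 0 j.
  by rewrite mxE; apply: eq_bigr => i _; rewrite coefE mxE.
have uM : M \in unitmx.
  rewrite -row_free_unit; apply: inj_row_free => v vM; apply/rowP => i.
  rewrite mxE -coefE; apply: (coords_free three rowsd check) => // j.
  by rewrite sz_rows => lt_j; rewrite (coefM v (Ordinal lt_j)) vM mxE.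
exists (coef ((\row_j t j) *m invmx M)) => j lt_j.
by rewrite (coefM _ (Ordinal lt_j)) mulmxKV // mxE.
Qed.

Lemma inj_surj_bij (A B : Type) (f : A -> B) :
  injective f -> (forall y, exists x, f x = y) -> bijective f.
Proof.
move=> f_inj f_surj; exists (fun y => projT1 (cid (f_surj y))) => [x|y].
  by apply: f_inj; exact: projT2 (cid (f_surj (f x))).
exact: projT2 (cid (f_surj y)).
Qed.

(** The [d] elements [e i] are only known to span A. As the coordinates of their images form an
    invertible matrix of size [d], [F] kills no nontrivial combination and reaches every coordinate
    vector. *)
Lemma iso_of_coords (k : fieldType) (three : 3%:R = 0 :> k) (A B : pzAlgType k)
    (F : {rmorphism A -> B}) d (crd : nat -> B -> k) (e : nat -> A) rows :
  (forall c, F (in_pzalg A c) = in_pzalg B c) ->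
  (forall j y z, crd j (y + z) = crd j y + crd j z) ->
  (forall j c z, crd j (in_pzalg B c * z) = c * crd j z) ->
  (forall z, (forall j, (j < d)%N -> crd j z = 0) -> z = 0) ->
  (forall x, exists c : nat -> k, x = \sum_(i < d) in_pzalg A (c i) * e i) ->
  (forall i j, (i < d)%N -> (j < d)%N ->
    crd j (F (e i)) = val3 (nth O3 (nth [::] rows j) i)) ->
  size rows = d -> all (fun r => size r <= d)%N rows ->
  indep d rows ->
  bijective F.
Proof.
move=> Fin crdD crdZ crd_inj span crdF sz_rows rowsd check.
have crd0 j : crd j 0 = 0 by have := crdZ j 0 0; rewrite mulr0 mul0r.
have crd_sum j (c : nat -> k) : (j < d)%N -> crd j (F (\sum_(i < d) in_pzalg A (c i) * e i))
    = \sum_(i < d) c i * val3 (nth O3 (nth [::] rows j) i).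
  move=> lt_j; rewrite rmorph_sum (big_morph (crd j) (crdD j) (crd0 j)).
  by apply: eq_bigr => i _; rewrite rmorphM Fin crdZ crdF.
apply: inj_surj_bij => [x y Fxy|z].
  apply/eqP; rewrite -subr_eq0; have [c e0] := span (x - y).
  have c0 : forall i, (i < d)%N -> c i = 0.
    apply: (coords_free three rowsd check) => j; rewrite sz_rows => lt_j.
    by rewrite -crd_sum // -e0 rmorphB Fxy subrr crd0.
  by rewrite e0 big1 // => i _; rewrite c0 // rmorph0 mul0r.
have [c cE] := coords_full three (crd ^~ z) sz_rows rowsd check.
exists (\sum_(i < d) in_pzalg A (c i) * e i).
apply/eqP; rewrite -subr_eq0; apply/eqP/crd_inj => j lt_j.
by rewrite -mulN1r -(rmorphN1 (in_pzalg B)) crdD crdZ crd_sum // cE // mulN1r subrr.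
Qed.

Lemma wprod_pair (T U : pzRingType) (s : nat -> T) (t : nat -> U) w :
  wprod (gens (fun i => (s i, t i))) w = (wprod (gens s) w, wprod (gens t) w).
Proof. by elim: w => [//|x w /= ->]. Qed.

Lemma rels_pair (T U : pzRingType) n (s : nat -> T) (t : nat -> U) :
  rels n s -> rels n t -> rels n (fun i => (s i, t i)).
Proof.
move=> [s1 s2 s3 s4] [t1 t2 t3 t4]; split.
- by move=> i j ij jn; congr (_, _); [exact: s1|exact: t1].
- by move=> i lt_i; congr (_, _); [exact: s2|exact: t2].
- by move=> i lt_i; congr (_, _); [exact: s3|exact: t3].
have e (ws : seq word) : \sum_(w <- ws) wprod (gens (fun i => (s i, t i))) w
    = (\sum_(w <- ws) wprod (gens s) w, \sum_(w <- ws) wprod (gens t) w).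
  elim: ws => [|w ws IHws]; first by rewrite !big_nil.
  by rewrite !big_cons IHws wprod_pair.
by rewrite e s4 t4.
Qed.

Lemma eq_wprod (A : pzRingType) (a : pred letter) (s t : letter -> A) w :
  (forall x, a x -> s x = t x) -> all a w -> wprod s w = wprod t w.
Proof. by move=> st; elim: w => //= x w IHw /andP[/st -> /IHw ->]. Qed.

Lemma rels_input_eq0 (A : pzRingType) n (s : nat -> A) ls p : rels n s ->
  (forall x, List.In x ls -> letter_index x < n.-1)%N ->
  List.In p (rcons (braid_polys ls) (poly_words Q8words)) -> pev (gens s) p = 0.
Proof.
move=> [s1 s2 s3 s4] lsn; rewrite -cats1 => p_in.
case: (In_cat p_in) => [|[<-|//]]; first exact: (braid_polys_eq0 s1 s2 s3 lsn).
by rewrite /pev /lin big_map.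
Qed.

Section ClosedSpan.
Context (k : fieldType) (char_k : 3%N \in [pchar k]) (A : pzAlgType k).
Context (n : nat) (s : nat -> A) (sR : rels n s) (ls : seq letter) (R : rtrie).
Context (js : seq job) (ws : seq word).
Hypothesis lsn : forall x, List.In x ls -> (letter_index x < n.-1)%N.
Hypothesis RE : R = run (rcons (braid_polys ls) (poly_words Q8words)) js.
Hypothesis closed_ws : closed R ls ws.
Hypothesis nil_ws : List.In [::] ws.

Let sp := spanned (k := k) (wprod (gens s)) (fun y => y = 0) ws.
Let L0 : (fun y : A => y = 0) 0. Proof. by []. Qed.
Let LD (y z : A) : y = 0 -> z = 0 -> y + z = 0.
Proof. by move=> -> ->; rewrite addr0. Qed.
Let LM (a y : A) : y = 0 -> a * y = 0. Proof. by move=> ->; rewrite mulr0. Qed.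
Let LN (y : A) : y = 0 -> - y = 0. Proof. by move=> ->; rewrite oppr0. Qed.

Lemma closed_span : [/\ forall x y, sp x -> sp y -> sp (x + y),
  forall c x, sp x -> sp (in_pzalg A c * x), sp 1 &
  forall x y, List.In x ls -> sp y -> sp (gens s x * y)].
Proof.
have three := three_alg char_k A.
have Rv : rvalid (fun y : A => y = 0) (wprod (gens s)) R.
  apply: (run_rvalid three RE) => p.
  exact: (rels_input_eq0 sR lsn).
split.
- by move=> x y; exact: (spannedD LD).
- by move=> c x; exact: (spannedZ LM).
- exact: (spanned_word (wprod (gens s)) L0 nil_ws).
move=> x y; apply: (spanned_gen L0 LD LM) => // w z.
exact: (closed_step (three_act three) L0 LD LN Rv closed_ws).
Qed.

End ClosedSpan.

Section K3.
Context (k : fieldType) (char_k : 3%N \in [pchar k]).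
Let three : 3%:R = 0 :> k := three_k char_k.

Let B := kK k 3 isT.
Let T : pzAlgType k := ('M[k^o]_3 * 'M[galg k C3]_2)%type.

Definition SL2gen (i : nat) : nmx :=
  if i is 0%N then [:: [:: P3; P3]; [:: O3; P3]]
  else [:: [:: P3; O3]; [:: M3; P3]].

(* The symmetric square of SL2gen. *)
Definition Sym2gen (i : nat) : nmx :=
  if i is 0%N then [:: [:: P3; P3; P3]; [:: O3; P3; M3]; [:: O3; O3; P3]]
  else [:: [:: P3; O3; O3]; [:: P3; P3; O3]; [:: P3; M3; P3]].

Definition K3_rules := run (rcons (braid_polys [:: L3; L2]) (poly_words Q8words)) K3_schedule.
Lemma K3_rulesE : K3_rules = run (rcons (braid_polys [:: L3; L2]) (poly_words Q8words)) K3_schedule.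
Proof. by []. Qed.

Definition wordsK3 := normals 8 K3_rules [:: L3; L2] [:: [::]].
(** The 21 coordinates are the 9 entries of the symmetric square, then, at 9 + 4 d + 2 a + b, the
    coefficient of c^d in the entry (a, b) of the second factor. A word contributes only to the d
    congruent to its length. *)
Definition rowK3 j w : F3 :=
  if (j < 9)%N then ent (nword 3 (nletter Sym2gen) w) (j %/ 3) (j %% 3)
  else if (size w %% 3 == (j - 9) %/ 4)%N
    then ent (nword 2 (nletter SL2gen) w) ((j - 9) %/ 2 %% 2) ((j - 9) %% 2)
  else O3.
Definition rowsK3 := mkseq (fun j => map (rowK3 j) wordsK3) 21.

Lemma checkK3 : [&& (size wordsK3 == 21)%N, closed K3_rules [:: L3; L2] wordsK3,
  has (same_word [::]) wordsK3,
  all (all (fun x => letter_index x < 2)%N) wordsK3, check_rels 3 3 Sym2gen, check_rels 3 2 SL2gen &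
  indep 21 rowsK3].
Proof. by vm_compute. Qed.

Let s3 i : T := (ngen (1 : k^o) 3 Sym2gen i, ngen (cgen k) 2 SL2gen i).

Lemma size_SL2gen i : (size (SL2gen i) <= 2)%N.
Proof. by case: i. Qed.

Lemma size_Sym2gen i : (size (Sym2gen i) <= 3)%N.
Proof. by case: i. Qed.

Lemma rels_s3 : rels 3 s3.
Proof.
have /and5P[_ _ _ _ /and3P[h1 h2 _]] := checkK3.
apply: rels_pair.
  apply: (rels_ngen (three_alg char_k k^o) _ (expr1n _ 3) size_Sym2gen h1) => x.
  by rewrite mul1r mulr1.
exact: (rels_ngen (three_alg char_k _) (@cgenC k) (cgen3 k) size_SL2gen h2).
Qed.

Let crd j (z : T) : k :=
  if (j < 9)%N then z.1 (inord (j %/ 3)) (inord (j %% 3))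
  else cf ((j - 9) %/ 4) (z.2 (inord ((j - 9) %/ 2 %% 2)) (inord ((j - 9) %% 2))).

Lemma crd_eq0 z : (forall j, (j < 21)%N -> crd j z = 0) -> z = 0.
Proof.
case: z => x y z0; congr (_, _); apply/matrixP=> a b; rewrite mxE.
  have lt9 : (a * 3 + b < 9)%N.
    by case: a b => [[|[|[|]]] ?] // [[|[|[|]]] ?].
  have := z0 _ (ltn_trans lt9 (isT : 9 < 21)%N); rewrite /crd lt9 /= divnMDl // modnMDl.
  by rewrite divn_small // modn_small // addn0 !inord_val.
apply: cf_inj => d lt_d.
have ge9 m : (9 + m < 9)%N = false by rewrite ltnNge leq_addr.
have := z0 (9 + (d * 4 + a * 2 + b))%N; rewrite /crd ge9 addKn.
have [-> -> ->] : [/\ (d * 4 + a * 2 + b) %/ 4 = d,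
    (d * 4 + a * 2 + b) %/ 2 %% 2 = a & (d * 4 + a * 2 + b) %% 2 = b]%N.
  by case: (d) lt_d => [|[|[|]]] // _; case: a b => [[|[|]] ?] // [[|[|]] ?].
rewrite !inord_val; apply.
by case: d lt_d => [|[|[|]]] //; case: a b => [[|[|]] ?] // [[|[|]] ?].
Qed.

Lemma crd_wprod j w : (j < 21)%N ->
  crd j (wprod (gens s3) w) = val3 (rowK3 j w).
Proof.
move=> lt_j.
rewrite wprod_pair /crd /rowK3; case: ifP => lt_j9 /=.
  rewrite (wprod_ngen (three_alg char_k _) _ size_Sym2gen); last first.
    by move=> x; rewrite mul1r mulr1.
  by rewrite expr1n mul1r mxE !inordK ?ltn_mod // ltn_divLR.
have lt12 : (j - 9 < 12)%N by rewrite ltn_subLR // leqNgt lt_j9.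
rewrite (wprod_ngen (three_alg char_k _) (@cgenC k) size_SL2gen).
rewrite -[_ * mxn _ _ _]/(_ *m _) mul_scalar_mx !mxE !inordK ?ltn_mod //.
by rewrite cf_cgenX ?ltn_divLR //; case: ifP.
Qed.

Theorem K3_iso : alg_iso B T.
Proof.
have /and5P[/eqP szw cl wnil low_ws _] := checkK3.
move: K3_rules K3_rulesE cl => R RE cl.
have [F [Fin Fgen]] := kK_lift_ex char_k (isT : 3 <= 3)%N rels_s3.
exists F; last exact: Fin.
pose e i : B := wprod (gens (@kgen k 3 isT)) (nth [::] wordsK3 i).
apply: (@iso_of_coords k three B T F 21 crd e rowsK3).
- exact: Fin.
- move=> j y z; rewrite /crd; case: ifP => _; first by rewrite mxE.
  by rewrite -cfD mxE.
- move=> j c z; rewrite /crd; case: ifP => _.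
    rewrite -[LHS]/(((c : k^o)%:M *m z.1) (inord (j %/ 3)) (inord (j %% 3))).
    by rewrite mul_scalar_mx mxE.
  rewrite -[LHS]/(cf _ (((in_pzalg (galg k C3) c)%:M *m z.2) (inord _) (inord _))).
  by rewrite mul_scalar_mx mxE -cfZ.
- exact: crd_eq0.
- move=> x; have [spD spZ sp1 spG] :=
    closed_span char_k (@rels_kK k char_k 3 isT) In_braid1 RE cl (has_same_word wnil).
  have [c /subr0_eq ->] : spanned (wprod (gens (@kgen k 3 isT)))
      (fun y : B => y = 0) wordsK3 x.
    elim/kK_ind: x => [y z|c y| |i y lt_i].
    - exact: spD.
    - exact: spZ.
    - exact: sp1.
    case: i lt_i => [|[|//]] _.
      by apply: (spG L3); left.
    by apply: (spG L2); right; left.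
  by exists c; rewrite /comb szw.
- move=> i j lt_i lt_j; rewrite /e rmorph_wprod.
  have lt_iw : (i < size wordsK3)%N by rewrite szw.
  have low_w := all_nthP [::] low_ws i lt_iw.
  have -> : nth O3 (nth [::] rowsK3 j) i = rowK3 j (nth [::] wordsK3 i).
    by rewrite (nth_mkseq _ _ lt_j) (nth_map [::] O3 (rowK3 j) lt_iw).
  move: (nth [::] wordsK3 i) low_w => w low_w.
  rewrite (eq_wprod (t := gens s3) _ low_w); last by move=> x x2; exact: Fgen.
  exact: crd_wprod.
- by rewrite size_mkseq.
- apply/(all_nthP [::]) => j; rewrite size_mkseq => lt_j.
  by rewrite (nth_mkseq _ _ lt_j) size_map szw.
- by have /and5P[_ _ _ _ /and3P[_ _ ]] := checkK3.
Qed.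

End K3.

(** * The algebra kK_5 *)

(* The matrices of s_1, ..., s_5, up to the generator of C_3, in a basis for which
   the first columns of the matrices of basis_words are the standard basis. *)
Definition mats25 : seq nmx := [::
    nmx_of [:: 1206321397908744; 1225405845121370; 1272312499542361; 1311254881043816;
      1214480541434120; 1166178384217170; 1523957612783650; 1572467095782026;
      1853246180500037; 1271174248113700; 1285407503357573; 1267841731134497;
      1478985444922372; 1453561351767300; 1694661093725824; 1414634997978466;
      1724077824936212; 1769544930726560; 1412501096388128; 1205156170010952;
      1764033607049830; 1559736741173841; 1585949459178664; 1593820892366342;
      1800042696743561]%positive;
    nmx_of [:: 1778538717921306; 1874961686495650; 1691488401033578; 1559460037273110;
      1155082129283078; 1224340712482192; 1867699354473120; 1550952866273418;
      1454177495974977; 1549796134767125; 1549238300378197; 1830276758506064;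
      1425005997565977; 1128670295236625; 1694513481995280; 1735193247459984;
      1585110566574377; 1694453015841284; 1593366368315928; 1304384145298438;
      1555277805938305; 1558592119980392; 1517464132944410; 1295802716938385;
      1548664310437990]%positive;
    nmx_of [:: 1170333044445444; 1417893813529130; 1452735737513221; 1304061128344096;
      1838428004618536; 1835084976523296; 1199018515016010; 1130870834828356;
      1829936606364834; 1414132312581122; 1715547645823489; 1445071973140488;
      1829949636421185; 1724732586330176; 1583589917795993; 1269532362909281;
      1215116488214148; 1220878852041369; 1414014945595497; 1587699661416457;
      1867078472992918; 1519054773445217; 1770839317943378; 1429684355435112;
      1306589803988617]%positive;
    nmx_of [:: 1137484784755328; 1559453939049474; 1735446119977480; 1236025160521766;
      1218572757581893; 1836620984750729; 1224110131921442; 1734381088096784;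
      1761041963061897; 1570199921109402; 1284683146536229; 1730701113169929;
      1801388107864406; 1550337727406625; 1163285477594729; 1288766436185097;
      1452841559999497; 1198770610668865; 1706515239608408; 1489048323899433;
      1219363388531818; 1313264113963040; 1504791861663312; 1854057959524641;
      1803617392943702]%positive;
    nmx_of [:: 1548757692942997; 1847219401922704; 1835439520639620; 1713075226171490;
      1224178423845954; 1711210540586660; 1272161002101137; 1153702410455556;
      1133090053921408; 1409992265144389; 1765311369586193; 1203579230718614;
      1725719539876266; 1710867306644485; 1567940097376289; 1220063449716889;
      1145731289290774; 1233970572690074; 1712122251333798; 1733969654081538;
      1196996719546538; 1409957589436568; 1870991916574880; 1278068559878164;
      1835158224849481]%positive].

(** The products of these words with the column [u25] form a basis of the columns, and those of the
    row [f25] with [right_words] a basis of the rows. Lengths are divisible by 3, so c does not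
    appear. *)
Definition left_words : seq word := [:: [::];
    [:: L3; L3; L1];
    [:: L3; L3; L0];
    [:: L3; L2; L1];
    [:: L3; L1; L0];
    [:: L3; L0; L1];
    [:: L3; L0; L0];
    [:: L2; L1; L0];
    [:: L2; L0; L1];
    [:: L1; L1; L0];
    [:: L1; L0; L1];
    [:: L1; L0; L0];
    [:: L0; L0; L1];
    [:: L3; L3; L2; L3; L1; L0];
    [:: L3; L3; L2; L2; L1; L0];
    [:: L3; L3; L2; L1; L1; L0];
    [:: L3; L3; L2; L1; L0; L1];
    [:: L3; L3; L2; L1; L0; L0];
    [:: L3; L3; L2; L0; L0; L1];
    [:: L3; L3; L1; L2; L0; L1];
    [:: L3; L3; L1; L1; L0; L1];
    [:: L3; L3; L1; L1; L0; L0];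
    [:: L3; L3; L1; L0; L0; L1];
    [:: L3; L2; L3; L1; L0; L1];
    [:: L3; L2; L3; L1; L0; L0]].

Definition right_words : seq word := [:: [::];
    [:: L3; L3; L1];
    [:: L3; L3; L0];
    [:: L3; L1; L2];
    [:: L3; L1; L1];
    [:: L3; L1; L0];
    [:: L3; L0; L1];
    [:: L3; L0; L0];
    [:: L1; L2; L3];
    [:: L1; L2; L2];
    [:: L1; L2; L0];
    [:: L1; L1; L2];
    [:: L1; L1; L0];
    [:: L1; L0; L1];
    [:: L0; L1; L2];
    [:: L0; L1; L1];
    [:: L0; L0; L1];
    [:: L3; L3; L1; L2; L3; L3];
    [:: L3; L3; L1; L2; L3; L0];
    [:: L3; L3; L1; L2; L2; L1];
    [:: L3; L3; L1; L2; L2; L0];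
    [:: L3; L3; L1; L2; L0; L1];
    [:: L3; L3; L1; L1; L2; L0];
    [:: L3; L3; L1; L1; L0; L1];
    [:: L3; L3; L1; L1; L0; L0]].

Definition S25 (i : nat) : nmx := nth [::] mats25 i.

Definition letters : seq letter := [:: L3; L2; L1; L0].

(* The product (1 + z) (1 + a) (1 - b) in kQ, where z is the central involution
   and a = s_1 s_1 s_2, b = s_1 s_2 s_1, so that a G = G and b G = - G. *)
Definition Gpoly : ncpoly := zip Q8words [:: P3; M3; M3; P3; P3; M3; M3; P3].

(* The relations of kK_5, with those of the generator L4 of the left module
   B G / B G (s_4 - 1). *)
Definition left_inputs := braid_polys letters ++
  [:: poly_words Q8words;
      [:: ([:: L3; L3; L2; L4], P3); ([:: L4], M3)];
      [:: ([:: L3; L2; L3; L4], P3); ([:: L4], P3)];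
      [:: ([:: L0; L4], P3); ([:: L4], M3)]].

Definition left_rules := run left_inputs left_schedule.

Lemma left_rulesE : left_rules = run left_inputs left_schedule.
Proof. by []. Qed.

Definition words75 := normals 40 left_rules letters [:: [:: L4]].

Definition stem (w : word) : word := take (size w).-1 w.

Definition W25 := nword 25 (nletter S25).

Definition wordl (X : nmx) (w : word) : nmx :=
  foldr (fun x => nmul (nletter S25 x)) X w.

Definition wordr (X : nmx) (w : word) : nmx :=
  foldl (fun Y x => nmul Y (nletter S25 x)) X w.

Definition G25 := seqsum [seq nscale t.2 (W25 t.1) | t <- Gpoly].

Definition GS25 (j : nat) := iter j (fun X => nmul X (S25 3)) G25.

(* Column j of eta25 is column 6 of G S_4^j; any column for which rows75 is
   invertible would do. *)
Definition eta25 : nmx :=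
  let Gs := [seq GS25 j | j <- iota 0 3] in
  mkseq (fun a => [seq ent X a 6 | X <- Gs]) 25.

(** The row 3 a + d gives the coefficient of c^d in the entry (a, 6) of w G (s_4 - 1)^2. Since (s_4
    - 1)^2 = 1 + s_4 + s_4^2, only the power j of s_4 with j = d - |w| = d + 2 |w| modulo 3
    contributes. *)
Definition rows75 : seq (seq F3) :=
  let us := [seq (size (stem w), wordl eta25 (stem w)) | w <- words75] in
  mkseq (fun r => [seq ent p.2 (r %/ 3) ((r %% 3 + p.1 * 2) %% 3) | p <- us]) 75.

Definition P25 := nmul G25 (nmul (W25 [:: L3; L1; L0]) G25).

Definition u25 : nmx := mkseq (fun a => [:: ent P25 a 0]) 25.

(** The sign is there because the entry (1, 0) of [P25] is -1: the product of [u25] by this row is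
    [P25]. *)
Definition f25 : nmx := [:: scalerow M3 (nth [::] P25 1)].

Definition lrows := let us := map (wordl u25) left_words in
  mkseq (fun j => [seq ent X j 0 | X <- us]) 25.

Definition rrows := let us := map (wordr f25) right_words in
  mkseq (fun j => [seq ent X 0 j | X <- us]) 25.

Lemma check75 : [&& (size words75 == 75)%N, closed left_rules letters words75,
  has (same_word [:: L4]) words75,
  all (fun w => same_word w (rcons (stem w) L4) && pure (stem w)) words75 &
  indep 75 rows75].
Proof. by vm_cast_no_check (erefl true). Qed.

Lemma check_rels25 : check_rels 6 25 S25.
Proof. by vm_cast_no_check (erefl true). Qed.

Lemma check_rank1 : [&& neq 25 P25 (nmul u25 f25), indep 25 lrows & indep 25 rrows].
Proof. by vm_cast_no_check (erefl true). Qed.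

Lemma size_S25 i : (size (S25 i) <= 25)%N.
Proof. by do 5!case: i => [//|i]; rewrite /S25 nth_default. Qed.

Lemma rels_le (T : pzRingType) m n (s : nat -> T) : (m <= n)%N -> rels n s -> rels m s.
Proof.
move=> /leq_predn le_mn [s1 s2 s3 s4]; split=> // [i j lt_ij lt_j|i lt_i|i lt_i].
- by apply: s1 lt_ij _; exact: leq_trans le_mn.
- by apply: s2; exact: leq_trans le_mn.
- by apply: s3; exact: leq_trans le_mn.
Qed.

Lemma rels_rmorph (T U : pzRingType) (f : {rmorphism T -> U}) n (s : nat -> T) :
  rels n s -> rels n (fun i => f (s i)).
Proof.
move=> [s1 s2 s3 s4]; split=> [i j lt_ij lt_j|i lt_i|i lt_i|].
- by rewrite -!rmorphM s1.
- by rewrite -!rmorphM s2.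
- by rewrite -!rmorphM s3 ?rmorph1.
rewrite -[RHS](rmorph0 f) -s4 rmorph_sum; apply: eq_bigr => w _.
by rewrite rmorph_wprod.
Qed.

Section PolynomialEvaluation.
Context (A : pzRingType) (s : letter -> A).

Lemma pev_cat p q : pev s (p ++ q) = pev s p + pev s q.
Proof. exact: lin_cat. Qed.

Lemma pev_mulw u p : pev s [seq (u ++ t.1, t.2) | t <- p] = wprod s u * pev s p.
Proof.
rewrite /pev /lin big_map mulr_sumr; apply: eq_bigr => t _ /=.
by rewrite wprod_cat !act3E mulrA val3C mulrA.
Qed.

Lemma pev_opp p : pev s [seq (t.1, opp3 t.2) | t <- p] = - pev s p.
Proof.
rewrite /pev /lin big_map -sumrN; apply: eq_bigr => t _ /=.
exact: act3N.
Qed.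

Lemma wprod_comm (a : pred letter) y w : (forall x, a x -> y * s x = s x * y) ->
  all a w -> y * wprod s w = wprod s w * y.
Proof.
move=> ys; elim: w => [_|x w IHw /= /andP[/ys yx /IHw yw]]; first by rewrite mulr1 mul1r.
by rewrite mulrA yx -mulrA yw mulrA.
Qed.

Lemma pev_comm (a : pred letter) y p : (forall x, a x -> y * s x = s x * y) ->
  all (fun t => all a t.1) p -> y * pev s p = pev s p * y.
Proof.
move=> ys; rewrite !pevE; elim: p => [|t p IHp] /=; first by rewrite big_nil mulr0 mul0r.
move=> /andP[at_ /IHp]; rewrite !big_cons mulrDl mulrDr => ->.
by rewrite mulrA -val3C -!mulrA (wprod_comm ys).
Qed.

End PolynomialEvaluation.

Lemma braid_polys_pure : all (all (fun t => pure t.1)) (braid_polys letters).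
Proof. by vm_compute. Qed.

(** * The left module B G / B G (s_4 - 1) *)

Section LeftIdeal.
Context (k : fieldType) (char_k : 3%N \in [pchar k]) (B : pzAlgType k).
Context (s : nat -> B) (sR : rels 5 s).
Let g := pev (gens s) Gpoly.
Let x := s 3.
Let three : 3%:R = 0 :> B := three_alg char_k B.

Let rels3 p : List.In p (braid_polys [:: L3; L2]) -> pev (gens s) p = 0.
Proof.
have [s1 s2 s3 _] := rels_le (isT : 3 <= 5)%N sR.
exact: (braid_polys_eq0 s1 s2 s3 In_braid1).
Qed.

Lemma Gpoly_112 : wprod (gens s) [:: L3; L3; L2] * g = g.
Proof.
apply/subr0_eq; rewrite -[RHS](_ : pev (gens s) [::] = 0); last exact: big_nil.
rewrite -pev_mulw -pev_opp -pev_cat; apply: (run_reduce three (Gamma3_rulesE) rels3).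
by vm_compute.
Qed.

Lemma Gpoly_121 : wprod (gens s) [:: L3; L2; L3] * g = - g.
Proof.
apply/eqP; rewrite -addr_eq0; apply/eqP.
rewrite -[RHS](_ : pev (gens s) [::] = 0); last exact: big_nil.
rewrite -pev_mulw -pev_cat; apply: (run_reduce three (Gamma3_rulesE) rels3).
by vm_compute.
Qed.

(** G involves only s_1 and s_2, which commute with s_4. *)
Lemma Gpoly_comm : x * g = g * x.
Proof.
apply: (@pev_comm _ _ (fun y => letter_index y < 2)%N) => // y lt_y.
have [s1 _ _ _] := sR; apply/esym/s1 => //.
Qed.

(* L4 stands for g, and what follows it is ignored. *)
Fixpoint evl (w : word) : B :=
  if w is y :: w' then if y is L4 then g else gens s y * evl w' else 0.

Lemma evl_cat u w : pure u -> evl (u ++ w) = wprod (gens s) u * evl w.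
Proof.
elim: u => [|y u IHu] /=; first by rewrite mul1r.
by case: y => //= pu; rewrite IHu // mulrA.
Qed.

(** As [x] commutes with [g], the element x g - g = g (x - 1) is in this left ideal: modulo it, s_4
    fixes the generator, which is the last relation of [left_inputs]. *)
Definition gideal (y : B) : Prop := exists b, y = b * g * (x - 1).

Lemma gideal0 : gideal 0.
Proof. by exists 0; rewrite !mul0r. Qed.

Lemma gidealD y z : gideal y -> gideal z -> gideal (y + z).
Proof. by move=> [b ->] [c ->]; exists (b + c); rewrite !mulrDl. Qed.

Lemma gidealN y : gideal y -> gideal (- y).
Proof. by move=> [b ->]; exists (- b); rewrite !mulNr. Qed.

Lemma gidealM a y : gideal y -> gideal (a * y).
Proof. by move=> [b ->]; exists (a * b); rewrite !mulrA. Qed.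

Lemma evl_valid_pure p : all (fun t => pure t.1) p -> pev (gens s) p = 0 ->
  valid gideal evl p.
Proof.
move=> pure_p p0 u v pu.
have -> : lin (ctx evl u v) p = wprod (gens s) u * pev (gens s) p * evl v.
  rewrite pevE mulr_sumr mulr_suml /lin; elim: p pure_p {p0} => [|t p IHp] /=.
    by rewrite !big_nil.
  move=> /andP[pt /IHp]; rewrite !big_cons => ->; congr (_ + _).
  by rewrite act3E /ctx !evl_cat // !mulrA val3C.
by rewrite p0 mulr0 mul0r; exact: gideal0.
Qed.

Lemma evl_valid_left u e : pure u -> gideal (wprod (gens s) u * g + val3 e * g) ->
  valid gideal evl [:: (rcons u L4, P3); ([:: L4], e)].
Proof.
move=> pu L u' v pu'; rewrite /lin big_cons big_seq1 !act3E mul1r /ctx -cats1 -catA.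
have evL4 : evl ([:: L4] ++ v) = g by [].
rewrite !(evl_cat _ pu') (evl_cat _ pu) evL4.
rewrite [val3 e * _]mulrA val3C -[wprod _ u' * _ * _]mulrA -mulrDr.
exact: gidealM.
Qed.

Lemma left_rules_valid R js : R = run left_inputs js -> rvalid gideal evl R.
Proof.
move=> ->; apply: (run_valid (three_act three) gideal0 gidealD gidealN).
have [s1 s2 s3 s4] := sR.
move=> p p_in; case: (In_cat p_in) => {}p_in.
  apply: evl_valid_pure; first exact: (allP_In braid_polys_pure p_in).
  exact: (braid_polys_eq0 s1 s2 s3 In_braid3 p_in).
case: p_in => [<-|[<-|[<-|[<-|//]]]].
- by apply: evl_valid_pure => //; rewrite /pev /lin big_map.
- apply: (@evl_valid_left [:: L3; L3; L2] M3) => //.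
  by rewrite Gpoly_112 mulN1r subrr; exact: gideal0.
- apply: (@evl_valid_left [:: L3; L2; L3] P3) => //.
  by rewrite Gpoly_121 mul1r addNr; exact: gideal0.
- apply: (@evl_valid_left [:: L0] M3) => //; exists 1.
  by rewrite /= mulr1 mulN1r mul1r mulrBr mulr1 -Gpoly_comm.
Qed.
End LeftIdeal.

Lemma In_nth (I : Type) (x0 : I) xs i : (i < size xs)%N -> List.In (nth x0 xs i) xs.
Proof. by elim: xs i => //= x xs IHxs [|i] lt_i; [left|right; exact: IHxs]. Qed.

Lemma mxn_wordl (A : pzRingType) (three : 3%:R = 0 :> A) X w : (size X <= 25)%N ->
  mxn A 25 (wordl X w) = mxn A 25 (W25 w) *m mxn A 25 X.
Proof.
move=> X25; rewrite /W25 (mxn_word three _ (fun x => size_S25 _)).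
elim: w => [|x w IHw] /=; first by rewrite mul1mx.
rewrite (mxn_mul three); last by case: w {IHw} => //= y w; rewrite size_map size_S25.
by rewrite IHw -mulmxA.
Qed.

Lemma mxn_wordr (A : pzRingType) (three : 3%:R = 0 :> A) X w :
  mxn A 25 (wordr X w) = mxn A 25 X *m mxn A 25 (W25 w).
Proof.
rewrite /W25 (mxn_word three _ (fun x => size_S25 _)).
elim: w X => [|x w IHw] X /=; first by rewrite mulmx1.
by rewrite IHw (mxn_mul three _ (size_S25 _)) -mulmxA.
Qed.

Lemma scalar_mxMr (R : pzRingType) n (a b : R) :
  a%:M * b%:M = (a * b)%:M :> 'M_n.
Proof. by rewrite scalar_mxM. Qed.

Lemma size_words75 : size words75 = 75%N.
Proof. by have /andP[/eqP] := check75. Qed.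

Definition stem75 i := stem (nth [::] words75 i).

Lemma ent_eta25 a j : (a < 25)%N -> (j < 3)%N -> ent eta25 a j = ent (GS25 j) a 6.
Proof.
move=> lt_a; rewrite /ent (nth_mkseq _ _ lt_a).
by do 3!case: j => [//|j].
Qed.

Lemma size_eta25 : (size eta25 <= 25)%N.
Proof. by rewrite size_mkseq. Qed.

Lemma rows75_size : all (fun r => size r <= 75)%N rows75.
Proof.
apply/(all_nthP [::]) => r; rewrite size_mkseq => lt_r.
by rewrite (nth_mkseq _ _ lt_r) !size_map size_words75.
Qed.

Lemma rows75E r i : (r < 75)%N -> (i < 75)%N ->
  nth O3 (nth [::] rows75 r) i = ent (wordl eta25 (stem75 i)) (r %/ 3)
    ((r %% 3 + size (stem75 i) * 2) %% 3).
Proof.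
move=> lt_r lt_i; rewrite (nth_mkseq _ _ lt_r).
have lt_iw : (i < size words75)%N by rewrite size_words75.
by rewrite (nth_map (0%N, [::])) ?size_map // (nth_map [::]).
Qed.

(** The only solution j of m + j = d modulo 3 is d - m, that is d + 2 m. *)
Lemma sum_mod3 (V : nmodType) (f : nat -> V) m d : (d < 3)%N ->
  \sum_(j < 3) (if ((m + j) %% 3 == d)%N then f j else 0) = f ((d + m * 2) %% 3)%N.
Proof.
move=> lt_d; rewrite -(modnDmr d) -modnMml modnDmr.
under eq_bigr => j _ do rewrite -modnDml.
have := ltn_pmod m (isT : 0 < 3)%N; rewrite !big_ord_recl big_ord0.
by case: (m %% 3)%N => [|[|[|//]]] _; case: d lt_d => [|[|[|//]]] _ /=;
  rewrite ?addr0 ?add0r.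
Qed.

Lemma cf_sum (k : fieldType) d (I : Type) (r : seq I) (F : I -> galg k C3) :
  cf d (\sum_(i <- r) F i) = \sum_(i <- r) cf d (F i).
Proof. exact: raddf_sum. Qed.

Lemma cf0 (k : fieldType) d : cf d (0 : galg k C3) = 0.
Proof. exact: mcoeff0. Qed.

Definition collapse_rules := run (braid_polys letters ++ [:: poly_words Q8words; Gpoly]) collapse_schedule.

Lemma collapse_rulesE : collapse_rules = run (braid_polys letters ++ [:: poly_words Q8words; Gpoly]) collapse_schedule.
Proof. by []. Qed.

Lemma collapse_rules_one : reduce collapse_rules [:: ([::], P3)] = Some [::].
Proof. by vm_compute. Qed.

(** Completing the relations together with G = 0 yields a rule that rewrites 1 to 0; so G lies in no
    proper two-sided ideal. *)
Lemma Gpoly_collapse (k : fieldType) (char_k : 3%N \in [pchar k]) (A : pzAlgType k)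
  (s : nat -> A) : rels 5 s -> pev (gens s) Gpoly = 0 -> 1 = 0 :> A.
Proof.
move=> [s1 s2 s3 s4] G0.
have ins0 p : List.In p (braid_polys letters ++ [:: poly_words Q8words; Gpoly]) ->
    pev (gens s) p = 0.
  move=> p_in; case: (In_cat p_in) => [|[<-|[<-|//]]] //.
    exact: (braid_polys_eq0 s1 s2 s3 In_braid3).
  by rewrite /pev /lin big_map.
have := run_reduce (three_alg char_k A) collapse_rulesE ins0 collapse_rules_one.
by rewrite pev_word /pev /lin big_nil.
Qed.

(** The middle coefficient -2 is 1 in characteristic 3. *)
Lemma sqr_sub1 (R : pzRingType) (z : R) : 3%:R = 0 :> R ->
  (z - 1) * (z - 1) = \sum_(j < 3) z ^+ j.
Proof.
move=> three; have zz : - z - z = z.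
  have /eqP := three_act three z.
  by rewrite !mulrS mulr0n addr0 addr_eq0 -opprD => /eqP <-.
rewrite !big_ord_recr big_ord0 /= add0r expr0 expr1 expr2.
rewrite mulrBl mulrBr mulr1 mul1r opprB addrACA zz.
by rewrite [z * z + 1]addrC addrAC.
Qed.

Lemma cube_sub1 (R : pzRingType) (z : R) : 3%:R = 0 :> R ->
  (z - 1) * ((z - 1) * (z - 1)) = z * z * z - 1.
Proof.
by move=> three; rewrite (sqr_sub1 z three) -subrX1 !exprS expr0 mulr1 mulrA.
Qed.

Lemma rmorph_pev (T U : pzRingType) (f : {rmorphism T -> U}) (s : nat -> T) p :
  f (pev (gens s) p) = pev (gens (fun i => f (s i))) p.
Proof.
rewrite !pevE rmorph_sum; apply: eq_bigr => t _; rewrite rmorphM rmorph_wprod.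
by congr (_ * _); case: t.2; rewrite /= ?rmorph0 ?rmorph1 ?rmorphN1.
Qed.

(** * Injectivity of kK_5 -> Mat_25(kC_3) *)

Section Faithful.
Context (k : fieldType) (char_k : 3%N \in [pchar k]) (B : pzAlgType k).
Context (s : nat -> B) (sR : rels 5 s).
Hypothesis B_ind : forall P : B -> Prop,
  (forall x y, P x -> P y -> P (x + y)) ->
  (forall c x, P x -> P (in_pzalg B c * x)) ->
  P 1 -> (forall i x, (i < 4)%N -> P x -> P (s i * x)) -> forall x, P x.

Let A : pzAlgType k := galg k C3.
Let T : pzAlgType k := 'M[A]_25.
Definition M25 (i : nat) : 'M[galg k C3]_25 := ngen (cgen k) 25 S25 i.
Context (Phi : {rmorphism B -> T}).
Hypothesis Phi_in : forall c, Phi (in_pzalg B c) = in_pzalg T c.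
Hypothesis Phi_s : forall i, (i < 4)%N -> Phi (s i) = M25 i.

Let g := pev (gens s) Gpoly.
Let x := s 3.
Let three : 3%:R = 0 :> A := three_alg char_k A.

Let comb75 (c : nat -> k) : B :=
  \sum_(i < 75) in_pzalg B (c i) * (wprod (gens s) (stem75 i) * g).

Lemma evl_span R js ws b : R = run left_inputs js -> closed R letters ws ->
  List.In [:: L4] ws -> spanned (evl s) (gideal s) ws (b * g).
Proof.
move=> RE cl g_ws.
have Rv := left_rules_valid char_k sR RE.
have J0 := gideal0 s.
have LD := @gidealD _ _ s.
have LM := @gidealM _ _ s.
elim/B_ind: b => [y z sy sz|a y sy||i y lt_i sy].
- rewrite mulrDl; exact: (spannedD LD sy sz).
- rewrite -mulrA; exact: (spannedZ LM a sy).
- rewrite mul1r; exact: (spanned_word (evl s) J0 g_ws).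
have [l ll ->] : exists2 l, List.In l letters & s i = gens s l.
  case: i lt_i => [|[|[|[|//]]]] _; [exists L3|exists L2|exists L1|exists L0] => //.
  + by left.
  + by right; left.
  + by do 2!right; left.
  + by do 3!right; left.
rewrite -mulrA; apply: (spanned_gen J0 LD LM _ _ ll sy).
  by move=> z w; do 4![case=> [<- //|]].
move=> w z.
exact: (closed_step (three_act (three_alg char_k B)) J0 LD (@gidealN _ _ s) Rv cl).
Qed.

Lemma stems75 i : (i < 75)%N ->
  nth [::] words75 i = rcons (stem75 i) L4 /\ pure (stem75 i).
Proof.
have /and5P[/eqP szw _ _ stems _] := check75; rewrite -szw => lt_i.
have /andP[/same_wordP e p] := all_nthP [::] stems i lt_i.
by split.
Qed.

Lemma spanned75 b : spanned (evl s) (gideal s) words75 (b * g).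
Proof.
have /and5P[_ cl g_ws _ _] := check75.
exact: (evl_span b left_rulesE cl (has_same_word g_ws)).
Qed.

Lemma span75 b : exists c b', b * g = comb75 c + b' * g * (x - 1).
Proof.
have [c [b' e]] := spanned75 b; exists c, b'.
suff ec : comb (evl s) words75 c = comb75 c.
  by rewrite -(subrK (comb (evl s) words75 c) (b * g)) e ec addrC.
rewrite /comb size_words75; apply: eq_bigr => i _.
have [-> p] := stems75 (ltn_ord i).
by rewrite -cats1 evl_cat.
Qed.

Let X := M25 3.

Lemma Phi_word w :
  Phi (wprod (gens s) w) = (cgen k ^+ size w)%:M * mxn A 25 (W25 w).
Proof.
rewrite rmorph_wprod (eq_wprod (a := predT) (t := gens M25)) //; last exact: all_predT.
  exact: (wprod_ngen three (@cgenC k) size_S25).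
by move=> y _; rewrite /gens Phi_s //; case: y.
Qed.

Lemma Phi_g : Phi g = mxn A 25 G25.
Proof.
rewrite /G25 (mxn_sum three) /g /pev /lin rmorph_sum; apply: big_In => t tG.
rewrite mxn_scale -(_ : Phi (wprod (gens s) t.1) = mxn A 25 (W25 t.1)).
  by case: t.2; rewrite /= ?rmorph0 ?rmorphN.
rewrite Phi_word C_mod3 ?mul1r //; first exact: cgen3.
apply/eqP; exact: (allP_In (isT : all (fun t => size t.1 %% 3 == 0)%N Gpoly) tG).
Qed.

Lemma mulrACA_comm (R : pzRingType) (p q y z : R) : q * y = y * q ->
  p * y * (q * z) = p * q * (y * z).
Proof. by move=> qy; rewrite mulrA -(mulrA p) -qy !mulrA. Qed.

Lemma GS25_X j : mxn A 25 G25 * X ^+ j = (cgen k ^+ j)%:M * mxn A 25 (GS25 j).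
Proof.
elim: j => [|j IHj]; first by rewrite !expr0 mulr1 mul1r.
rewrite exprSr mulrA IHj -[GS25 j.+1]/(nmul (GS25 j) (S25 3)).
rewrite (mxn_mul three _ (size_S25 _)) exprSr scalar_mxM.
apply: mulrACA_comm; exact: (scalar_mxCA _ (@cgenC k)).
Qed.

Lemma mxE_in (c : k) (Z : T) a b : (in_pzalg T c * Z) a b = in_pzalg A c * Z a b.
Proof. by rewrite -[LHS]/((_%:M *m Z) a b) mul_scalar_mx mxE. Qed.

Definition col6 : 'I_25 := inord 6.

Lemma Phi_comb c a : (Phi (comb75 c) * ((X - 1) * (X - 1))) a col6
  = \sum_(i < 75) \sum_(j < 3) in_pzalg A (c i)
     * (cgen k ^+ (size (stem75 i) + j) * val3 (ent (wordl eta25 (stem75 i)) a j)).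
Proof.
rewrite rmorph_sum mulr_suml summxE; apply: eq_bigr => i _.
rewrite rmorphM Phi_in rmorphM Phi_g -!mulrA mxE_in -mulr_sumr; congr (_ * _).
rewrite Phi_word (sqr_sub1 _ (three_alg char_k T)) !mulr_sumr summxE; apply: eq_bigr => j _.
rewrite GS25_X mulrACA_comm; last first.
  by apply: scalar_mxCA => y; exact: (esym (commrX j (esym (cgenC y)))).
rewrite scalar_mxMr -exprD -[LHS]/((_%:M *m _) a col6) mul_scalar_mx mxE.
congr (_ * _); set w := stem75 i.
have lt_j : (j < 25)%N by apply: leq_trans (ltn_ord j) _.
have <- : (mxn A 25 (wordl eta25 w)) a (inord j) = val3 (ent (wordl eta25 w) a j).
  by rewrite mxE (inordK lt_j).
rewrite (mxn_wordl three _ size_eta25); apply: etrans (mxE _ _ _ _) _.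
apply/esym; apply: etrans (mxE _ _ _ _) _; apply/esym; apply: eq_bigr => l _.
congr (_ * _); rewrite mxE [RHS]mxE (inordK lt_j) (inordK (isT : 6 < 25)%N).
by rewrite (ent_eta25 (ltn_ord l) (ltn_ord j)).
Qed.

(** The 25 entries of column 6 have 75 coefficients in kC_3, and [rows75] expresses them in terms of
    the 75 unknowns [c i]. *)
Lemma comb75_faithful c : Phi (comb75 c) * ((X - 1) * (X - 1)) = 0 ->
  comb75 c = 0.
Proof.
move=> c0; rewrite /comb75 big1 // => i _.
suff -> : c i = 0 by rewrite rmorph0 mul0r.
move: (nat_of_ord i) (ltn_ord i).
have indep75 : indep 75 rows75 by have /and5P[_ _ _ _] := check75.
apply: (coords_free (three_k char_k) rows75_size indep75) => r.
rewrite size_mkseq => lt_r; clear indep75.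
have lt_a : (r %/ 3 < 25)%N by rewrite ltn_divLR.
have lt_d := ltn_pmod r (isT : 0 < 3)%N.
have := congr1 (fun Z : T => cf (r %% 3) (Z (Ordinal lt_a) col6)) c0.
rewrite Phi_comb mxE cf0 => e; rewrite -[RHS]e cf_sum.
apply: eq_bigr => j _; rewrite (rows75E lt_r (ltn_ord j)) cf_sum.
rewrite -(sum_mod3 (fun l => val3 (ent (wordl eta25 (stem75 j)) (r %/ 3) l)) _ lt_d).
rewrite mulr_sumr; apply: eq_bigr => l _; apply/esym.
apply: etrans (cfZ _ _ _) _; congr (_ * _).
exact: (cf_cgenX _ _ _ lt_d).
Qed.

(** Applying [span75] three times writes y g as c_0 + c_1 n + c_2 n^2, with a remainder in n^3 = 0.
    Multiplying by n^2, then by n, then by 1 isolates c_0 n^2, c_1 n^2 and c_2 n^2 in turn; their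
    images are zero, so [comb75_faithful] removes each term. *)
Lemma Phi_ker_g y : Phi y = 0 -> y * g = 0.
Proof.
move=> y0; pose n := x - 1.
have n3 z : z * n * n * n = 0.
  have [_ _ cube _] := sR; have x3 : x * x * x = 1 by exact: cube.
  by rewrite -!mulrA (cube_sub1 x (three_alg char_k B)) x3 subrr mulr0.
have Phi_n : Phi n = X - 1 by rewrite rmorphB rmorph1 Phi_s.
have c_n c : Phi (comb75 c * n * n) = 0 -> comb75 c = 0.
  by move=> z0; apply: comb75_faithful; rewrite mulrA -Phi_n -!rmorphM.
have yg0 z : Phi (y * g * z) = 0 by rewrite !rmorphM y0 !mul0r.
have [c0 [b0 e0]] := span75 y; have [c1 [b1 e1]] := span75 b0.
have [c2 [b2 e2]] := span75 b1.
move: e0 e1 e2; rewrite -/n => e0 e1 e2.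
have c00 : comb75 c0 = 0.
  apply: c_n; rewrite -[RHS](yg0 (n * n)); congr (Phi _).
  by rewrite e0 mulrA !mulrDl n3 addr0.
rewrite c00 add0r in e0.
have c10 : comb75 c1 = 0.
  apply: c_n; rewrite -[RHS](yg0 n); congr (Phi _).
  by rewrite e0 e1 !mulrDl n3 addr0.
rewrite c10 add0r in e1.
have c20 : comb75 c2 = 0.
  apply: c_n; rewrite -[RHS](yg0 1); congr (Phi _).
  by rewrite mulr1 e0 e1 e2 !mulrDl n3 addr0.
by rewrite e0 e1 e2 c20 add0r n3.
Qed.

Lemma Phi_inj : injective Phi.
Proof.
(* This is a left ideal because the kernel is stable under right multiplication, and clearly a right
   ideal. *)
pose J (j : B) := forall y, Phi y = 0 -> y * j = 0.
have J1 : J 1.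
  (* The quotient by the ideal of [g] still satisfies the relations, and [g] is zero there, so it is
     trivial by [Gpoly_collapse]. *)
  have : ideal_gen [set g]%classic (1 : B).
    have /quot_projP : quot_proj [set g]%classic 1 = quot_proj [set g]%classic (0 : B).
      pose Q : pzAlgType k := quotalg [set g]%classic.
      pose p : {rmorphism B -> Q} := quot_proj [set g]%classic.
      rewrite -[LHS](rmorph1 p) -[RHS](rmorph0 p).
      apply: (Gpoly_collapse char_k (rels_rmorph p sR)).
      rewrite -(rmorph_pev p) -[RHS](rmorph0 p).
      by apply/quot_projP; rewrite subr0 => I [_]; apply.
    by rewrite subr0.
  move=> /(_ J); apply; split; last by move=> _ -> y; exact: Phi_ker_g.
  split=> [y _|a b Ja Jb y y0|a j b Jj y y0]; first by rewrite mulr0.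
    by rewrite mulrDr Ja // Jb // addr0.
  by rewrite !mulrA Jj ?mul0r // rmorphM y0 mul0r.
move=> y z /eqP; rewrite -subr_eq0 -rmorphB => /eqP /J1.
by rewrite mulr1 => /subr0_eq.
Qed.

End Faithful.

Lemma size_W25 w : (size (W25 w) <= 25)%N.
Proof. by case: w => [|x w]; rewrite /W25 /= ?size_mkseq // size_map size_S25. Qed.

Lemma size_G25 : (size G25 <= 25)%N.
Proof. by vm_compute. Qed.

Lemma size_f25 : (size f25 <= 25)%N.
Proof. by vm_compute. Qed.

Lemma size_u25 : (size u25 <= 25)%N.
Proof. by rewrite size_mkseq. Qed.

Lemma left_right_words :
  all (fun w => size w %% 3 == 0)%N (left_words ++ right_words).
Proof. by vm_compute. Qed.

Lemma S25_cube : neq 25 (nmul (S25 0) (nmul (S25 0) (S25 0))) (nid 25).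
Proof. by have /and4P[_ _ /allP/(_ 0%N isT)] := check_rels25. Qed.

Lemma P25_rank1 : neq 25 P25 (nmul u25 f25).
Proof. by have /andP[] := check_rank1. Qed.

Lemma lrowsE i j : (i < 25)%N -> (j < 25)%N ->
  nth O3 (nth [::] lrows j) i = ent (wordl u25 (nth [::] left_words i)) j 0.
Proof.
move=> lt_i lt_j; rewrite (nth_mkseq _ _ lt_j) (nth_map [::]) ?size_map //.
by rewrite (nth_map [::]).
Qed.

Lemma rrowsE i j : (i < 25)%N -> (j < 25)%N ->
  nth O3 (nth [::] rrows j) i = ent (wordr f25 (nth [::] right_words i)) 0 j.
Proof.
move=> lt_i lt_j; rewrite (nth_mkseq _ _ lt_j) (nth_map [::]) ?size_map //.
by rewrite (nth_map [::]).
Qed.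

Lemma lrows_size : all (fun r => size r <= 25)%N lrows.
Proof.
by apply/(all_nthP [::]) => r; rewrite size_mkseq => lt_r; rewrite (nth_mkseq _ _ lt_r).
Qed.

Lemma rrows_size : all (fun r => size r <= 25)%N rrows.
Proof.
by apply/(all_nthP [::]) => r; rewrite size_mkseq => lt_r; rewrite (nth_mkseq _ _ lt_r).
Qed.

Lemma size_lrows : size lrows = 25%N.
Proof. exact: size_mkseq. Qed.

Lemma size_rrows : size rrows = 25%N.
Proof. exact: size_mkseq. Qed.

Lemma in_mulmxl (k : pzRingType) (A : pzAlgType k) n (c : k) (M N : 'M[A]_n) a b :
  (in_pzalg 'M[A]_n c * M *m N) a b = in_pzalg A c * (M *m N) a b.
Proof. by rewrite -[X in X *m N]/(_%:M *m M) -mulmxA mul_scalar_mx mxE. Qed.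

Lemma in_mulmxr (k : pzRingType) (A : pzAlgType k) n (c : k) (M N : 'M[A]_n) a b :
  (M *m (in_pzalg 'M[A]_n c * N)) a b = in_pzalg A c * (M *m N) a b.
Proof.
rewrite -[X in M *m X]/(_%:M *m N) mulmxA.
by rewrite -[X in X *m N]/(M * in_pzalg 'M[A]_n c) -in_pzalgC -in_mulmxl.
Qed.

(** Since [u] lives in its column 0, the product of [u] and [f] is a column times a row; [U] and [V]
    move these to the basis vectors of indices [i] and [j]. *)
Lemma mul_delta (R : pzRingType) n (U u f V : 'M[R]_n.+1) i j :
  (forall a l, l != ord0 -> u a l = 0) ->
  (forall a, (U *m u) a ord0 = (a == i)%:R) ->
  (forall b, (f *m V) ord0 b = (b == j)%:R) ->
  U * (u *m f * V) = delta_mx i j.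
Proof.
move=> u0 Uu fV; rewrite -[LHS]/(U *m (u *m f *m V)) !mulmxA -mulmxA.
apply/matrixP=> a b; rewrite mxE (bigD1 ord0) //= Uu fV big1 ?addr0 => [|l l0].
  by rewrite mxE -natrM mulnb.
by rewrite [X in X * _]mxE big1 ?mul0r // => m _; rewrite u0 ?mulr0.
Qed.

(** * Surjectivity onto Mat_25(kC_3) *)

Section Full.
Context (k : fieldType) (char_k : 3%N \in [pchar k]) (B : pzAlgType k).
Context (s : nat -> B).
Let A : pzAlgType k := galg k C3.
Let T : pzAlgType k := 'M[A]_25.
Context (Phi : {rmorphism B -> T}).
Hypothesis Phi_in : forall c, Phi (in_pzalg B c) = in_pzalg T c.
Hypothesis Phi_s : forall i, (i < 4)%N -> Phi (s i) = M25 k i.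
Let three : 3%:R = 0 :> A := three_alg char_k A.

Let im (Z : T) : Prop := exists y, Phi y = Z.

Lemma imD Y Z : im Y -> im Z -> im (Y + Z).
Proof. by move=> [y <-] [z <-]; exists (y + z); rewrite rmorphD. Qed.

Lemma imM Y Z : im Y -> im Z -> im (Y * Z).
Proof. by move=> [y <-] [z <-]; exists (y * z); rewrite rmorphM. Qed.

Lemma im_in c : im (in_pzalg T c).
Proof. by exists (in_pzalg B c). Qed.

Lemma im_sum (I : Type) (r : seq I) (P : pred I) (F : I -> T) :
  (forall i, im (F i)) -> im (\sum_(i <- r | P i) F i).
Proof.
move=> imF; apply: big_ind => [||i _]; [|exact: imD|exact: imF].
by exists 0; rewrite rmorph0.
Qed.

Lemma im_word w : (size w %% 3 = 0)%N -> im (mxn A 25 (W25 w)).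
Proof.
move=> w3; exists (wprod (gens s) w).
by rewrite (Phi_word char_k Phi_s) (C_mod3 (cgen3 k) w3) mul1r.
Qed.

Lemma mxn_P25 : mxn A 25 P25 = mxn A 25 u25 *m mxn A 25 f25.
Proof. exact: etrans (mxn_eq A P25_rank1) (mxn_mul three u25 size_f25). Qed.

Lemma im_P25 : im (mxn A 25 P25).
Proof.
have imG : im (mxn A 25 G25).
  by exists (pev (gens s) Gpoly); exact: (Phi_g char_k Phi_s).
have -> : mxn A 25 P25
    = mxn A 25 G25 * (mxn A 25 (W25 [:: L3; L1; L0]) * mxn A 25 G25).
  have sz : (size (nmul (W25 [:: L3; L1; L0]) G25) <= 25)%N.
    by rewrite size_map size_W25.
  apply: etrans (mxn_mul three G25 sz) _; congr (_ *m _).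
  exact: (mxn_mul three _ size_G25).
by apply: (imM imG); apply: (imM _ imG); apply: im_word.
Qed.

(** The rank one matrix [P25] is in the image, and combinations of [left_words] and [right_words]
    turn it into any matrix unit. *)
Lemma im_delta i j : im (delta_mx i j).
Proof.
have /and3P[_ indl indr] := check_rank1.
have [c cE] := coords_full (three_k char_k) (fun a => (a == i :> nat)%:R)
  size_lrows lrows_size indl.
have [d dE] := coords_full (three_k char_k) (fun b => (b == j :> nat)%:R)
  size_rrows rrows_size indr.
clear indl indr.
pose U : T := \sum_(l < 25) in_pzalg T (c l) * mxn A 25 (W25 (nth [::] left_words l)).
pose V : T := \sum_(l < 25) in_pzalg T (d l) * mxn A 25 (W25 (nth [::] right_words l)).
have words3 w : w \in [seq size w | w <- left_words ++ right_words] -> (w %% 3 = 0)%N.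
  move=> /mem_map_In[v vw ->]; apply/eqP; exact: (allP_In left_right_words vw).
have imU : im U.
  apply: im_sum => l; apply: imM; first exact: im_in.
  apply: im_word; apply: words3; rewrite map_cat mem_cat.
  by rewrite -(nth_map _ 0%N) // mem_nth // size_map.
have imV : im V.
  apply: im_sum => l; apply: imM; first exact: im_in.
  apply: im_word; apply: words3; rewrite map_cat mem_cat orbC.
  by rewrite -(nth_map _ 0%N) // mem_nth // size_map.
suff <- : U * (mxn A 25 P25 * V) = delta_mx i j.
  by apply: (imM imU); apply: imM imV; exact: im_P25.
have Uu a : (U *m mxn A 25 u25) a ord0 = (a == i)%:R.
  have e : in_pzalg A (\sum_(l < 25) c l * val3 (nth O3 (nth [::] lrows a) l))
      = (a == i)%:R by rewrite (cE a (ltn_ord a)) rmorph_nat.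
  rewrite -e rmorph_sum mulmx_suml summxE.
  apply: eq_bigr => l _.
  rewrite in_mulmxl rmorphM in_val3; congr (_ * _).
  by rewrite -(mxn_wordl three _ size_u25) mxE lrowsE.
have fV b : (mxn A 25 f25 *m V) ord0 b = (b == j)%:R.
  have e : in_pzalg A (\sum_(l < 25) d l * val3 (nth O3 (nth [::] rrows b) l))
      = (b == j)%:R by rewrite (dE b (ltn_ord b)) rmorph_nat.
  rewrite -e rmorph_sum mulmx_sumr summxE.
  apply: eq_bigr => l _.
  rewrite in_mulmxr rmorphM in_val3; congr (_ * _).
  by rewrite -(mxn_wordr three) mxE rrowsE.
rewrite mxn_P25; apply: mul_delta Uu fV => a l l0; rewrite mxE.
rewrite /ent (nth_mkseq _ _ (ltn_ord a)).
by case: l l0 => [[|l] lt_l] //= _; rewrite nth_nil.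
Qed.

Lemma Phi_surj Z : im Z.
Proof.
have im_num X : im (mxn A 25 X).
  rewrite [mxn A 25 X]matrix_sum_delta; apply: im_sum => i; apply: im_sum => j.
  rewrite mxE; case: (ent X _ _) => /=.
  - by rewrite scale0r; exists 0; rewrite rmorph0.
  - by rewrite scale1r; exact: im_delta.
  rewrite scaleN1r; have [y <-] := im_delta i j.
  by exists (- y); rewrite rmorphN.
have imC : im (cgen k)%:M.
  (* With all numerical matrices in the image, c is recovered as (c S_1) S_1^2, because S_1^3 =
     1. *)
  have -> : (cgen k)%:M = M25 k 0 * mxn A 25 (nmul (S25 0) (S25 0)) :> T.
    rewrite /M25 /ngen -mulrA.
    rewrite -[X in _ * X](mxn_mul three) ?size_map ?size_S25 //.
    by rewrite (mxn_eq A S25_cube) mxn_id mulr1.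
  apply: imM (im_num _); exists (s 0); exact: Phi_s.
have im_scal a : im (a%:M).
  elim/galg_ind: a => [|a b ima imb|c h].
  - by exists 0; rewrite rmorph0 raddf0.
  - by rewrite raddfD; exact: imD.
  have -> : << c *g h >> = in_pzalg A c * cgen k ^+ (h : 'I_3).
    by rewrite cgenX C3_genX [RHS]galg_mulUU mulr1 mul1g.
  rewrite -scalar_mxMr; apply: imM; first exact: im_in.
  elim: (nat_of_ord _) => [|n IHn]; first by exists 1; rewrite expr0 rmorph1.
  by rewrite exprS -scalar_mxMr; exact: imM.
rewrite [Z]matrix_sum_delta; apply: im_sum => i; apply: im_sum => j.
by rewrite -mul_scalar_mx; apply: imM (im_delta i j).
Qed.

End Full.

Lemma bij_rmorph_inv (R U : pzRingType) (f : {rmorphism R -> U}) :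
  bijective f -> exists h : {rmorphism U -> R}, cancel f h /\ cancel h f.
Proof.
move=> [h fK hK].
pose hZ := GRing.isZmodMorphism.Build U R h (can2_zmod_morphism fK hK).
pose hM := GRing.isMonoidMorphism.Build U R h (can2_monoid_morphism fK hK).
by exists (HB.pack h hZ hM : {rmorphism U -> R}).
Qed.

Section K5.
Context (k : fieldType) (char_k : 3%N \in [pchar k]).

Lemma three_galg : 3%:R = 0 :> galg k C3.
Proof. exact: three_alg. Qed.

Lemma rels_M25 n : (n <= 6)%N -> rels n (M25 k).
Proof.
move=> le_n; apply: rels_le le_n _.
exact: (rels_ngen three_galg (@cgenC k) (cgen3 k) size_S25 check_rels25).
Qed.

Theorem K5_mx : exists Phi : {rmorphism kK k 5 isT -> 'M[galg k C3]_25},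
  [/\ bijective Phi, forall c, Phi (in_pzalg _ c) = in_pzalg 'M[galg k C3]_25 c &
   forall i, (i < 4)%N -> Phi (@kgen k 5 isT i) = M25 k i].
Proof.
have [Phi [Phi_in Phi_s]] := @kK_lift_ex k char_k 5 isT _ _ (@rels_M25 5 isT).
exists Phi; split; [|exact: Phi_in|exact: Phi_s].
apply: inj_surj_bij; last exact: (Phi_surj char_k Phi_in Phi_s).
exact: (Phi_inj char_k (@rels_kK k char_k 5 isT) (@kK_ind k 5 isT) Phi_in Phi_s).
Qed.

End K5.

(** * Recognition of the fifth generator *)

(** Words in s_1, s_2, s_3 only, with which the unknown [y] commutes, and of length divisible by 3,
    so that their matrices are numerical. *)
Definition basis_words : seq word := [:: [::];
    [:: L3; L3; L2];
    [:: L3; L2; L3];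
    [:: L2; L2; L3];
    [:: L3; L2; L2];
    [:: L2; L3; L3];
    [:: L3; L3; L1];
    [:: L3; L1; L1];
    [:: L2; L2; L1];
    [:: L2; L1; L1];
    [:: L2; L3; L1];
    [:: L3; L2; L1];
    [:: L3; L3; L2; L3; L3; L2];
    [:: L3; L3; L1; L3; L3; L2];
    [:: L3; L1; L1; L3; L3; L2];
    [:: L2; L2; L1; L3; L3; L2];
    [:: L2; L1; L1; L3; L3; L2];
    [:: L2; L3; L1; L3; L3; L2];
    [:: L3; L2; L1; L3; L3; L2];
    [:: L3; L3; L1; L3; L2; L3];
    [:: L3; L1; L1; L3; L2; L3];
    [:: L2; L2; L1; L3; L2; L3];
    [:: L2; L1; L1; L3; L2; L3];
    [:: L2; L3; L1; L3; L2; L3];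
    [:: L3; L3; L1; L2; L2; L3]].

(* The row j of kappa gives the coordinates of beta_j in terms of the eight
   parameters alpha_i = beta_(free8_i), on which all the beta_j depend. *)
Definition kappa : nmx := nmx_of [::
    65537; 107108; 69928; 84324; 83584; 91144; 76388; 100756; 65700;
    100692; 82432; 75792; 84352; 100388; 98664; 65540; 69792; 86144;
    65552; 66880; 65600; 65792; 66560; 69632; 81920]%positive.

Definition free8 : seq nat := [:: 0; 15; 18; 20; 21; 22; 23; 24].

(* The coordinates of the matrix of s_5. *)
Definition tau8 : seq F3 := [:: P3; P3; M3; M3; O3; O3; O3; P3].

Definition basis_mats := [seq W25 w | w <- basis_words].

(* The column l of the matrix number j is the column j of the matrix of the
   basis word number l. *)
Definition Xmats : seq nmx :=
  mkseq (fun j => mkseq (fun i => [seq ent W i j | W <- basis_mats]) 25) 25.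

Definition Xmat j := nth [::] Xmats j.

Definition ncomm (X Y : nmx) := nadd (nmul X Y) (nscale M3 (nmul Y X)).

(* The linear equations expressing that an element commutes with s_1 s_1 s_2;
   the first two rows of the matrix already give the full rank. *)
Definition rows1 : seq (seq F3) :=
  let cs := [seq ncomm (Xmat j) (W25 [:: L3; L3; L2]) | j <- iota 0 25] in
  [seq [seq ent Z a b | Z <- cs] | a <- iota 0 2, b <- iota 0 25].

Fixpoint spread (fs : seq nat) (r : seq F3) : seq F3 :=
  if fs is f :: fs' then
    addrow (scalerow (head O3 r) (urow f)) (spread fs' (behead r))
  else [::].

Definition check1 := let bs := echelon rows1 in
  all (fun j => entails bs (addrow (urow j)
    (scalerow M3 (spread free8 (nth [::] kappa j))))) (iota 0 25).

(** Eliminating the dependent beta_j with [kappa] gives y as the sum of the [dmat i] times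
    alpha_i. *)
Definition dmats : seq nmx :=
  mkseq (fun i => seqsum [seq nscale (ent kappa j i) (Xmat j) | j <- iota 0 25]) 8.

Definition dmat i := nth [::] dmats i.

(* In the braid relation of y with s_4, inl i stands for the unknown
   C alpha_i C and inr (i, j) for alpha_i C alpha_j. *)
Definition pairs8 : seq (nat + nat * nat) :=
  [seq inl i | i <- iota 0 8] ++ [seq inr (i, j) | i <- iota 0 8, j <- iota 0 8].

Definition braid_mat (u : nat + nat * nat) : nmx :=
  match u with
  | inl i => nmul (S25 3) (nmul (dmat i) (S25 3))
  | inr (i, j) => nscale M3 (nmul (dmat i) (nmul (S25 3) (dmat j)))
  end.

Definition rows2 : seq (seq F3) :=
  let zs := map braid_mat pairs8 in
  [seq [seq ent Z a b | Z <- zs] | a <- iota 0 4, b <- iota 0 25].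

(** The unknown number 8 is alpha_0 C alpha_0 and the number 0 is C alpha_0 C: the first test is the
    braid relation of alpha_0 with C, and the others give C alpha_i C = tau_i C alpha_0 C. *)
Definition check2 := let bs := echelon rows2 in
  entails bs (addrow (urow 8) (scalerow M3 (urow 0))) &&
  all (fun i => entails bs (addrow (urow i)
    (scalerow M3 (scalerow (nth O3 tau8 i) (urow 0))))) (iota 0 8).

Definition tmat := seqsum [seq nscale (nth O3 tau8 i) (dmat i) | i <- iota 0 8].

Lemma check1P : check1.
Proof. by vm_cast_no_check (erefl true). Qed.

Lemma check2P : check2.
Proof. by vm_cast_no_check (erefl true). Qed.

Lemma tmatE : neq 25 tmat (S25 4).
Proof. by vm_cast_no_check (erefl true). Qed.

Lemma Xmat0 : neq 25 (Xmat 0) (nid 25).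
Proof. by vm_compute. Qed.

Lemma basis_words_low :
  all (fun w => (size w %% 3 == 0)%N && all (fun x => letter_index x < 3)%N w) basis_words.
Proof. by vm_compute. Qed.

Lemma In_iota i n : List.In i (iota 0 n) -> (i < n)%N.
Proof. by move=> /(In_map_mem id); rewrite map_id mem_iota. Qed.

Lemma In_rows (f : nat -> nat -> seq F3) p q r :
  List.In r [seq f a b | a <- iota 0 p, b <- iota 0 q] ->
  exists a b, [/\ (a < p)%N, (b < q)%N & r = f a b].
Proof.
move=> r_in; have [rs rs_in {}r_in] := In_flatten r_in.
have [a /In_iota ap e] := In_map rs_in; rewrite e in r_in.
by have [b /In_iota bq ->] := In_map r_in; exists a, b.
Qed.

Section LinfLists.
Context (T : zmodType) (three : forall x : T, x *+ 3 = 0).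

Lemma linf_spread fs r (b : nat -> T) :
  linf (spread fs r) b = \sum_(i < size fs) act3 (nth O3 r i) (b (nth 0%N fs i)).
Proof.
elim: fs r => [|f fs IHfs] r /=; first by rewrite big_ord0.
rewrite (linf_addrow three) linf_scalerow linf_urow IHfs big_ord_recl /= nth0.
by congr (_ + _); apply: eq_bigr => i _; rewrite nth_behead.
Qed.

Lemma linf_map (I : Type) (f : I -> F3) (h : I -> T) us :
  linf (map f us) (nth 0 (map h us)) = \sum_(i <- us) act3 (f i) (h i).
Proof.
by elim: us => [|i us IHis] /=; rewrite ?big_nil // big_cons -IHis.
Qed.

End LinfLists.

Lemma mxn_delta (A : pzRingType) n X :
  mxn A n X = \sum_(i < n) \sum_(j < n) val3 (ent X i j) *: delta_mx i j.
Proof.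
rewrite [LHS]matrix_sum_delta; apply: eq_bigr => i _; apply: eq_bigr => j _.
by rewrite mxE.
Qed.

Lemma entails_eq (T : zmodType) (three : forall x : T, x *+ 3 = 0) rs i r (b : nat -> T) :
  (forall s, List.In s rs -> linf s b = 0) ->
  entails (echelon rs) (addrow (urow i) (scalerow M3 r)) -> b i = linf r b.
Proof.
move=> rs0 ent_r; have := entails_linf three rs0 ent_r.
rewrite (linf_addrow three) linf_urow linf_scalerow /= => /eqP.
by rewrite subr_eq0 => /eqP.
Qed.

Lemma check1E j : (j < 25)%N -> entails (echelon rows1)
  (addrow (urow j) (scalerow M3 (spread free8 (nth [::] kappa j)))).
Proof. by move=> lt_j; apply: (allP check1P); rewrite mem_iota. Qed.

Lemma check2E : entails (echelon rows2) (addrow (urow 8) (scalerow M3 (urow 0))).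
Proof. by have /andP[] := check2P. Qed.

Lemma check2iE i : (i < 8)%N -> entails (echelon rows2)
  (addrow (urow i) (scalerow M3 (scalerow (nth O3 tau8 i) (urow 0)))).
Proof.
have /andP[_ h] := check2P.
by move=> lt_i; apply: (allP h); rewrite mem_iota.
Qed.

Lemma size_Xmat j : (size (Xmat j) <= 25)%N.
Proof.
rewrite /Xmat; have [lt_j|le_j] := ltnP j 25.
  by rewrite (nth_mkseq _ _ lt_j) size_mkseq.
by rewrite nth_default // size_mkseq.
Qed.

Lemma size_seqsum (I : Type) (f : I -> nmx) us m :
  (forall i, size (f i) <= m)%N -> (size (seqsum (map f us)) <= m)%N.
Proof.
move=> fm; elim: us => //= i us IHus.
have sz X Y : size (nadd X Y) = maxn (size X) (size Y).
  by elim: X Y => [|r X IHX] [|t Y] //=; rewrite IHX maxnSS.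
by rewrite sz geq_max fm.
Qed.

Lemma dmatE i : (i < 8)%N ->
  dmat i = seqsum [seq nscale (ent kappa j i) (Xmat j) | j <- iota 0 25].
Proof. by move=> lt_i; rewrite /dmat (nth_mkseq _ _ lt_i). Qed.

Lemma size_dmat i : (size (dmat i) <= 25)%N.
Proof.
have [lt_i|le_i] := ltnP i 8; last by rewrite /dmat nth_default // size_mkseq.
rewrite (dmatE lt_i); apply: size_seqsum => j; rewrite size_map.
exact: size_Xmat.
Qed.

Lemma conj_rearrange (R : pzRingType) (c s d a : R) :
  c * s = s * c -> c * d = d * c -> a * s = s * a ->
  c * s * (d * a) * (c * s) = s * (d * s) * (c * a * c).
Proof.
move=> cs cd as_; rewrite [c * s in X in _ * X]cs -!mulrA.
by rewrite (mulrA c s) cs -!mulrA; congr (_ * _); rewrite (mulrA c d) cd -!mulrA;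
  congr (_ * _); rewrite (mulrA a s) as_ -!mulrA (mulrA c s) cs -!mulrA.
Qed.

(** Moving the commuting factors brings the hypothesis to t s (a c) = t s (c a), and t s is
    invertible since t and s have order 3. *)
Lemma commute_cancel (R : pzRingType) (t s a c : R) :
  c * s = s * c -> c * t = t * c -> a * s = s * a ->
  s * t = t * s -> t * t * t = 1 -> s * s * s = 1 ->
  t * a * (c * s) = c * s * (t * a) -> a * c = c * a.
Proof.
move=> cs ct as_ st t3 s3 e.
have e1 : t * s * (a * c) = t * s * (c * a).
  by rewrite -[LHS]mulrA (mulrA s a) -as_ -(mulrA a) -cs mulrA e cs -mulrA
    (mulrA c) ct -!mulrA mulrA st -mulrA.
have inv : s * s * (t * t) * (t * s) = 1.
  by rewrite -mulrA (mulrA (t * t)) t3 mul1r s3.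
by rewrite -[LHS]mul1r -[RHS]mul1r -inv -!(mulrA (s * s * (t * t))) e1.
Qed.

Lemma central_comm_cube (R : pzRingType) (c s : R) : c * s = s * c ->
  c * s * (c * s) * (c * s) = c * c * c * (s * s * s).
Proof.
move=> cs; rewrite -!mulrA; congr (_ * _); rewrite (mulrA s c) -cs -!mulrA.
by congr (_ * _); rewrite (mulrA s c) -cs -!mulrA (mulrA s c) -cs -!mulrA.
Qed.

(** Both sides of the braid relation contain the invertible factors c a; cancelling them, after one
    more multiplication by c, gives a c = c c, then a = c. *)
Lemma braid_commute_eq (R : pzRingType) (a c : R) :
  a * c = c * a -> a * a * a = 1 -> c * c * c = 1 ->
  a * c * a = c * a * c -> a = c.
Proof.
move=> ac a3 c3; rewrite ac => e.
have {}e : c * a * (a * c) = c * a * (c * c) by rewrite mulrA e !mulrA.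
have inv : a * a * (c * c) * (c * a) = 1.
  by rewrite -mulrA (mulrA (c * c)) c3 mul1r a3.
have {}e : a * c = c * c.
  by rewrite -[LHS]mul1r -[RHS]mul1r -inv -!(mulrA (a * a * (c * c))) e.
by rewrite -[LHS]mulr1 -[RHS]mulr1 -c3 !mulrA e.
Qed.

Section Recognition.
Context (A : pzRingType) (Cg : A) (three : 3%:R = 0 :> A).
Hypothesis CgC : forall a, Cg * a = a * Cg.
Hypothesis Cg3 : Cg ^+ 3 = 1.
Context (D : pzRingType) (psi : {rmorphism 'M[A]_25 -> D}).

Let num X : D := psi (mxn A 25 X).
Let e (a b : 'I_25) : D := psi (delta_mx a b).
Let C : D := psi Cg%:M.

Let threeD : 3%:R = 0 :> D.
Proof.
rewrite -(rmorph_nat psi) -(rmorph0 psi); congr (psi _).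
by rewrite -[LHS](rmorph_nat (@scalar_mx A 25)) three raddf0.
Qed.

Lemma num_mul X Y : (size Y <= 25)%N -> num (nmul X Y) = num X * num Y.
Proof. by move=> Y25; rewrite -rmorphM; congr (psi _); exact: mxn_mul. Qed.

Lemma num_act3 c X : num (nscale c X) = act3 c (num X).
Proof. by rewrite /num mxn_scale; case: c; rewrite /= ?rmorph0 ?rmorphN. Qed.

Lemma num_add X Y : num (nadd X Y) = num X + num Y.
Proof. by rewrite -rmorphD; congr (psi _); exact: mxn_add. Qed.

Lemma num_ncomm X Y : (size X <= 25)%N -> (size Y <= 25)%N ->
  num (ncomm X Y) = num X * num Y - num Y * num X.
Proof.
move=> szX szY; rewrite /ncomm num_add num_act3.
by rewrite (num_mul _ szX) (num_mul _ szY).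
Qed.

Lemma num_sum (I : Type) (f : I -> nmx) xs :
  num (seqsum (map f xs)) = \sum_(x <- xs) num (f x).
Proof. by rewrite /num (mxn_sum three) rmorph_sum. Qed.

Lemma eM a b c d : e a b * e c d = if b == c then e a d else 0.
Proof.
rewrite -rmorphM -[X in psi X]/(_ *m _) mul_delta_mx_cond.
by case: eqP => _; rewrite ?mulr1n // mulr0n rmorph0.
Qed.

Lemma num_e X : num X = \sum_(a < 25) \sum_(b < 25) val3 (ent X a b) * e a b.
Proof.
rewrite /num mxn_delta rmorph_sum; apply: eq_bigr => a _.
rewrite rmorph_sum; apply: eq_bigr => b _; rewrite /e.
by case: (ent X a b); rewrite /= ?scale0r ?scale1r ?scaleN1r ?rmorph0 ?rmorphN
  ?mul0r ?mul1r ?mulN1r.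
Qed.

Lemma sum_e : \sum_m e m m = 1.
Proof.
rewrite -rmorph_sum -(rmorph1 psi); congr (psi _).
apply/matrixP=> a b; rewrite summxE (bigD1 a) //= big1 => [|m ma].
  by rewrite !mxE eqxx addr0 eq_sym.
by rewrite mxE (negPf (_ : a != m)) // eq_sym.
Qed.

(** The [e a b] are matrix units of D, so D is the algebra of matrices of size 25 over this
    centralizer. *)
Definition cent (z : D) := forall a b, e a b * z = z * e a b.

Lemma centM z w : cent z -> cent w -> cent (z * w).
Proof. by move=> cz cw a b; rewrite mulrA cz -mulrA cw mulrA. Qed.

Lemma cent_num X z : cent z -> num X * z = z * num X.
Proof.
move=> cz; rewrite num_e mulr_suml mulr_sumr; apply: eq_bigr => a _.
rewrite mulr_suml mulr_sumr; apply: eq_bigr => b _.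
by rewrite -mulrA cz mulrA val3C -!mulrA.
Qed.

Lemma C_psi M : C * psi M = psi M * C.
Proof. by rewrite -!rmorphM; congr (psi _); exact: scalar_mxCA. Qed.

Lemma centC : cent C.
Proof. by move=> a b; rewrite C_psi. Qed.

Lemma num_forms (I : Type) (us : seq I) (Z : I -> nmx) (h : I -> D) :
  \sum_(i <- us) num (Z i) * h i
  = \sum_(a < 25) \sum_(b < 25) e a b * linf [seq ent (Z i) a b | i <- us] (nth 0 (map h us)).
Proof.
under [RHS]eq_bigr => a _ do under eq_bigr => b _ do
  rewrite linf_map mulr_sumr.
under [RHS]eq_bigr => a _ do rewrite exchange_big /=.
rewrite [RHS]exchange_big /=; apply: eq_bigr => i _; rewrite num_e mulr_suml.
apply: eq_bigr => a _; rewrite mulr_suml; apply: eq_bigr => b _.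
by rewrite act3E mulrA val3C.
Qed.

(** An element of D has unique entries in the centralizer: the entry (a, b) of Z is the sum over m
    of e_(m a) Z e_(b m). A vanishing sum thus vanishes entry by entry. *)
Lemma forms_eq0 (I : Type) (us : seq I) (Z : I -> nmx) (h : I -> D) (a b : 'I_25) :
  (forall i, cent (h i)) -> \sum_(i <- us) num (Z i) * h i = 0 ->
  linf [seq ent (Z i) a b | i <- us] (nth 0 (map h us)) = 0.
Proof.
move=> ch s0; pose L (c d : 'I_25) := linf [seq ent (Z i) c d | i <- us] (nth 0 (map h us)).
have e0 : \sum_c \sum_d e c d * L c d = 0 by rewrite -num_forms.
have cL a' b' : cent (L a' b').
  rewrite /L linf_map => c d; rewrite mulr_sumr mulr_suml.
  by apply: eq_bigr => i _; rewrite act3E mulrA -val3C -mulrA ch mulrA.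
have term m c d : e m a * (e c d * L c d) * e b m
    = if (a == c) && (d == b) then e m m * L c d else 0.
  rewrite -mulrA -(mulrA (e c d)) -(cL c d b m) mulrA eM mulrA.
  by case: (a == c); rewrite /= ?mul0r // eM; case: eqP; rewrite ?mul0r.
have key m : e m a * (\sum_c \sum_d e c d * L c d) * e b m = e m m * L a b.
  rewrite mulr_sumr mulr_suml (bigD1 a) //= mulr_sumr mulr_suml (bigD1 b) //=.
  rewrite term !eqxx big1 => [|d /negPf db]; last by rewrite term db andbF.
  rewrite addr0 big1 ?addr0 // => c ca.
  by rewrite mulr_sumr mulr_suml big1 // => d _; rewrite term eq_sym (negPf ca).
rewrite -/(L a b) -[LHS]mul1r -sum_e mulr_suml big1 // => m _.
by rewrite -key e0 mulr0 mul0r.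
Qed.

Section Centralizer.
Context (y : D).

(** The entry (j, 0) of [y], as an element of the centralizer of the matrix units. *)
Definition beta (j : nat) : D := \sum_m e m (inord j) * y * e ord0 m.

Lemma cent_beta j : cent (beta j).
Proof.
move=> a b; rewrite /beta mulr_sumr mulr_suml (bigD1 b) //= [RHS](bigD1 a) //=.
rewrite !mulrA eM eqxx -[in RHS]mulrA eM eqxx.
rewrite big1 => [|m mb]; last by rewrite !mulrA eM eq_sym (negPf mb) !mul0r.
rewrite big1 ?addr0 // => m ma.
by rewrite -mulrA eM (negPf ma) mulr0.
Qed.

Hypothesis y_word : forall w, List.In w basis_words ->
  y * num (W25 w) = num (W25 w) * y.

Lemma ent_Xmat j i l : (j < 25)%N -> (i < 25)%N -> (l < 25)%N ->
  ent (Xmat j) i l = ent (W25 (nth [::] basis_words l)) i j.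
Proof.
move=> lt_j lt_i lt_l; rewrite /Xmat (nth_mkseq _ _ lt_j) /ent (nth_mkseq _ _ lt_i).
by rewrite (nth_map [::]) ?size_map // (nth_map [::]).
Qed.

Lemma e_beta a b j : e a b * beta j = e a (inord j) * y * e ord0 b.
Proof.
rewrite /beta mulr_sumr (bigD1 b) //= !mulrA eM eqxx big1 ?addr0 // => m mb.
by rewrite !mulrA eM eq_sym (negPf mb) !mul0r.
Qed.

Lemma num_word_e (l : 'I_25) : num (W25 (nth [::] basis_words l)) * e ord0 l = e l l.
Proof.
rewrite num_e mulr_suml (bigD1 l) //= [X in _ + X]big1 ?addr0 => [|a al].
  rewrite mulr_suml (bigD1 ord0) //= -mulrA eM eqxx -ent_Xmat //.
  rewrite (neqP _ _ _ Xmat0) // ent_nid // eqxx mul1r.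
  by rewrite big1 ?addr0 // => b b0; rewrite -mulrA eM (negPf b0) mulr0.
rewrite mulr_suml big1 // => b _; rewrite -mulrA eM; case: eqP => [->|]; last by rewrite mulr0.
rewrite -(ent_Xmat (isT : 0 < 25)%N (ltn_ord a) (ltn_ord l)).
by rewrite (neqP _ _ _ Xmat0) // ent_nid // (inj_eq val_inj) (negPf al) mul0r.
Qed.

(** The matrix W_l of the basis word number l has the basis vector number l as first column, so W_l
    e_(0 l) = e_(l l). Then y is the sum of the y W_l e_(0 l) = W_l y e_(0 l): as it commutes with
    the W_l, its first column determines it. *)
Lemma beta_decomp : y = \sum_(j <- iota 0 25) num (Xmat j) * beta j.
Proof.
have y_sum : y = \sum_(l < 25) num (W25 (nth [::] basis_words l)) * y * e ord0 l.
  rewrite -[LHS]mulr1 -sum_e mulr_sumr; apply: eq_bigr => l _.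
  rewrite -y_word; last by apply: In_nth.
  by rewrite -mulrA num_word_e.
rewrite -[iota 0 25]/(index_iota 0 25) big_mkord [LHS]y_sum.
pose F (l a j : 'I_25) :=
  val3 (ent (W25 (nth [::] basis_words l)) a j) * (e a j * y * e ord0 l).
have -> : \sum_(j < 25) num (Xmat j) * beta j = \sum_j \sum_a \sum_l F l a j.
  apply: eq_bigr => j _; rewrite num_e mulr_suml; apply: eq_bigr => a _.
  rewrite mulr_suml; apply: eq_bigr => l _.
  by rewrite -mulrA e_beta inord_val ent_Xmat.
rewrite [RHS]exchange_big /= [RHS](eq_bigr (fun a => \sum_l \sum_j F l a j)); last first.
  by move=> a _; exact: exchange_big.
rewrite [RHS]exchange_big; apply: eq_bigr => l _.
rewrite num_e !mulr_suml; apply: eq_bigr => a _.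
by rewrite !mulr_suml; apply: eq_bigr => j _; rewrite /F !mulrA.
Qed.

Definition alpha i := beta (nth 0%N free8 i).

(** The entries of y W - W y = 0, for the word W = s_1 s_1 s_2, are linear equations between the
    beta_j; [check1] solves them. *)
Lemma beta_alpha j : (j < 25)%N ->
  beta j = \sum_(i <- iota 0 8) act3 (ent kappa j i) (alpha i).
Proof.
move=> lt_j; pose bb := nth 0 (map beta (iota 0 25)).
have bbE i : (i < 25)%N -> bb i = beta i.
  by move=> lt_i; rewrite /bb (nth_map 0%N) ?size_iota // nth_iota.
rewrite -(bbE j lt_j) (entails_eq (three_act threeD) _ (check1E lt_j)).
  rewrite linf_spread; last exact: three_act.
  rewrite -[iota 0 8]/(index_iota 0 8) big_mkord; apply: eq_bigr => i _.
  congr (act3 _ _); rewrite bbE //.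
  by case: i => [i lt_i]; do 8?[case: i lt_i => [//|i] lt_i].
move=> r /In_rows[a [b [lt_a lt_b ->]]]; rewrite -map_comp.
pose W := W25 [:: L3; L3; L2].
apply: (@forms_eq0 _ _ (fun j => ncomm (Xmat j) W) beta (Ordinal (leq_trans lt_a _))
  (Ordinal lt_b) cent_beta) => //.
pose nW := num W.
pose S := \sum_(j <- iota 0 25) num (Xmat j) * beta j.
apply: (@etrans _ _ (S * nW - nW * S)); last first.
  by rewrite /S -beta_decomp /nW y_word ?subrr //; right; left.
rewrite /S mulr_suml mulr_sumr -sumrB; apply: eq_bigr => i _.
rewrite (num_ncomm (size_Xmat i) (size_W25 _)) mulrBl.
by rewrite -!mulrA (cent_num _ (cent_beta i)).
Qed.

Lemma alpha_decomp : y = \sum_(i <- iota 0 8) num (dmat i) * alpha i.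
Proof.
rewrite [LHS]beta_decomp.
rewrite -![iota 0 8]/(index_iota 0 8) -![iota 0 25]/(index_iota 0 25) !big_mkord.
transitivity (\sum_(j < 25) \sum_(i < 8)
    act3 (ent kappa j i) (num (Xmat j)) * alpha i).
  apply: eq_bigr => j _; rewrite beta_alpha // -[iota 0 8]/(index_iota 0 8) big_mkord.
  rewrite mulr_sumr; apply: eq_bigr => i _.
  by rewrite !act3E mulrA -val3C.
rewrite exchange_big; apply: eq_bigr => i _; rewrite dmatE // num_sum.
rewrite -![iota 0 25]/(index_iota 0 25) !big_mkord mulr_suml; apply: eq_bigr => j _.
by rewrite num_act3.
Qed.

Let M i : D := psi (ngen Cg 25 S25 i).

Lemma M_num i : M i = C * num (S25 i).
Proof. exact: rmorphM. Qed.

Hypothesis y_braid : M 3 * y * M 3 = y * M 3 * y.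

Lemma cent_alpha i : cent (alpha i).
Proof. exact: cent_beta. Qed.

Definition braid_val (u : nat + nat * nat) : D :=
  match u with
  | inl i => C * alpha i * C
  | inr (i, j) => alpha i * C * alpha j
  end.

Lemma cent_braid_val u : cent (braid_val u).
Proof.
by case: u => [i|[i j]]; do ?apply: centM; try exact: cent_alpha; exact: centC.
Qed.

Lemma num_braid_mat u : num (braid_mat u) =
  match u with
  | inl i => num (S25 3) * (num (dmat i) * num (S25 3))
  | inr (i, j) => - (num (dmat i) * (num (S25 3) * num (dmat j)))
  end.
Proof.
have sz X Y : (size X <= 25)%N -> (size (nmul X Y) <= 25)%N by rewrite size_map.
case: u => [i|[i j]]; rewrite /braid_mat.
  by rewrite (num_mul _ (sz _ _ (size_dmat i))) (num_mul _ (size_S25 3)).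
by rewrite num_act3 (num_mul _ (sz _ _ (size_S25 3))) (num_mul _ (size_dmat j)).
Qed.

(** The braid relation is quadratic in the alpha_i, but becomes linear once the products C alpha_i C
    and alpha_i C alpha_j are taken as independent unknowns of the centralizer. *)
Lemma braid_sum : \sum_(u <- pairs8) num (braid_mat u) * braid_val u = 0.
Proof.
pose S := \sum_(i <- iota 0 8) num (dmat i) * alpha i.
apply: (@etrans _ _ (M 3 * S * M 3 - S * M 3 * S)); last first.
  by rewrite /S -alpha_decomp y_braid subrr.
rewrite /pairs8 big_cat big_map big_allpairs_dep; congr (_ + _).
  rewrite /S mulr_sumr mulr_suml; apply: eq_bigr => i _.
  rewrite num_braid_mat !M_num conj_rearrange ?C_psi //.
  exact/esym/cent_num/cent_alpha.
rewrite /S !mulr_suml -sumrN; apply: eq_bigr => i _.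
rewrite mulr_sumr -sumrN; apply: eq_bigr => j _.
rewrite num_braid_mat M_num mulNr; congr (- _).
rewrite C_psi !mulrA; congr (_ * _).
rewrite -!mulrA; congr (_ * _).
rewrite (mulrA (alpha i)) -(cent_num _ (cent_alpha i)) -!mulrA; congr (_ * _).
by rewrite [RHS]mulrA; exact: (cent_num (dmat j) (centM (cent_alpha i) centC)).
Qed.

Lemma braid_forms r : List.In r rows2 -> linf r (nth 0 (map braid_val pairs8)) = 0.
Proof.
move=> /In_rows[a [b [lt_a lt_b ->]]]; rewrite -map_comp.
exact: (@forms_eq0 _ _ braid_mat braid_val (Ordinal (leq_trans lt_a (isT : 4 <= 25)%N))
  (Ordinal lt_b) cent_braid_val braid_sum).
Qed.

Lemma alpha_braid : alpha 0 * C * alpha 0 = C * alpha 0 * C.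
Proof.
have := entails_eq (three_act threeD) braid_forms check2E.
by rewrite linf_urow.
Qed.

Let C_cube : C * C * C = 1.
Proof.
rewrite -!rmorphM -(rmorph1 psi); congr (psi _).
by have := Cg3; rewrite !exprS expr0 mulr1 mulrA => ->; rewrite rmorph1.
Qed.

(** The relation between the C alpha_i C passes to the alpha_i because C is invertible, with inverse
    C C. *)
Lemma alpha_tau i : (i < 8)%N -> alpha i = act3 (nth O3 tau8 i) (alpha 0).
Proof.
move=> lt_i; have := entails_eq (three_act threeD) braid_forms (check2iE lt_i).
rewrite linf_scalerow linf_urow.
have -> : nth 0 (map braid_val pairs8) i = C * alpha i * C.
  by do 8?[case: i lt_i => [//|i] lt_i].
rewrite -[nth _ _ 0]/(C * alpha 0 * C) => e_i.
have CK z : C * C * (C * z * C) * (C * C) = z.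
  by rewrite !mulrA C_cube mul1r -2!(mulrA z) C_cube mulr1.
rewrite -[LHS]CK e_i -[in RHS](CK (alpha 0)).
by case: (nth _ _ _); rewrite /= ?mulr0 ?mul0r ?mulrN ?mulNr.
Qed.

Lemma y_num : y = num (S25 4) * alpha 0.
Proof.
have <- : num tmat = num (S25 4) by exact: (congr1 psi (mxn_eq A tmatE)).
rewrite [LHS]alpha_decomp num_sum mulr_suml.
apply: big_In => i /In_iota lt_i.
by rewrite num_act3 (alpha_tau lt_i) !act3E mulrA -val3C.
Qed.

Hypothesis y_comm : y * M 0 = M 0 * y.
Hypothesis y_cube : y * y * y = 1.

Hypothesis M_rels : rels 6 M.

Theorem recognition : y = M 4.
Proof.
have [comm _ cube _] := M_rels.
have Cnum X : C * num X = num X * C by exact: C_psi.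
have CCK z : C * (C * C * z) = z by rewrite !mulrA C_cube mul1r.
have num_cube i : (i < 5)%N -> num (S25 i) * num (S25 i) * num (S25 i) = 1.
  move=> lt_i; rewrite -(cube i lt_i) !M_num.
  set s := num (S25 i); have Cs : C * s = s * C by exact: Cnum.
  by rewrite [RHS](central_comm_cube Cs) C_cube mul1r.
have t3 := num_cube 4 isT; have s3 := num_cube 0 isT.
(* The commutation of [M 0] and [M 4] carries the factor C C, which [CCK] cancels. *)
have st : num (S25 0) * num (S25 4) = num (S25 4) * num (S25 0).
  have := comm 0 4 isT isT; rewrite !M_num.
  rewrite (mulrACA_comm _ _ (Cnum (S25 0))) (mulrACA_comm _ _ (Cnum (S25 4))) => e04.
  by rewrite -[LHS]CCK e04 CCK.
have ca := cent_num _ (cent_alpha 0).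
(* Now y = S_5 alpha_0 commutes with C S_1, while S_1 commutes with S_5 and with alpha_0. *)
have aC : alpha 0 * C = C * alpha 0.
  apply: (commute_cancel (Cnum (S25 0)) (Cnum (S25 4)) (esym (ca _)) st t3 s3).
  by rewrite -M_num -y_num y_comm.
have a3 : alpha 0 * alpha 0 * alpha 0 = 1.
  rewrite -y_cube y_num.
  by rewrite [RHS](central_comm_cube (ca _)) t3 mul1r.
rewrite [LHS]y_num M_num (braid_commute_eq aC a3 C_cube alpha_braid).
exact/esym/Cnum.
Qed.

End Centralizer.

End Recognition.

(** * The algebras kK_n for n >= 6 *)

Lemma kK_hom_eq (k : fieldType) n (le3n : (3 <= n)%N) (D : pzAlgType k)
    (F H : {rmorphism kK k n le3n -> D}) :
  (forall c, F (in_pzalg _ c) = in_pzalg D c) ->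
  (forall c, H (in_pzalg _ c) = in_pzalg D c) ->
  (forall i, (i < n.-1)%N -> F (kgen k le3n i) = H (kgen k le3n i)) -> F =1 H.
Proof.
move=> Fin Hin FH; elim/kK_ind => [y z Fy Fz|c y Fy||i y lt_i Fy].
- by rewrite !rmorphD Fy Fz.
- by rewrite !rmorphM Fin Hin Fy.
- by rewrite !rmorph1.
by rewrite !rmorphM FH // Fy.
Qed.

Section Tower.
Context (k : fieldType) (char_k : 3%N \in [pchar k]).
Let T : pzAlgType k := 'M[galg k C3]_25.

Lemma fifth_generator (D : pzRingType) (s : nat -> D) (psi : {rmorphism T -> D}) :
  rels 6 s -> (forall i, (i < 4)%N -> psi (M25 k i) = s i) -> s 4 = psi (M25 k 4).
Proof.
move=> [comm braid cube _] psi_s.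
have psiR := rels_rmorph psi (rels_M25 char_k (isT : 6 <= 6)%N).
apply: (recognition (three_galg char_k) (@cgenC k) (cgen3 k) _ _ _ _ psiR).
- move=> w /(allP_In basis_words_low)/andP[/eqP w3 w_low].
  have -> : mxn (galg k C3) 25 (W25 w) = wprod (gens (M25 k)) w.
    by rewrite (wprod_ngen (three_galg char_k) (@cgenC k) size_S25) (C_mod3 (cgen3 k) w3)
      mul1r.
  rewrite rmorph_wprod; apply: wprod_comm w_low => x lt_x.
  by rewrite /gens (psi_s _ (ltnW lt_x)); exact: (esym (comm _ 4 lt_x isT)).
- rewrite (psi_s 3 isT); exact: (braid 3 isT).
- by rewrite (psi_s 0 isT); exact: (esym (comm 0 4 isT isT)).
exact: (cube 4 isT).
Qed.

(** Here [psi] is [iota] after the inverse of [Phi]. It reaches s_5 by [fifth_generator], so the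
    first five generators are all in the image of kK_5. *)
Lemma matrix_morphism (D : pzAlgType k) (s : nat -> D) : rels 6 s ->
  exists (Phi : {rmorphism kK k 5 isT -> T}) (iota : {rmorphism kK k 5 isT -> D})
    (psi : {rmorphism T -> D}),
  [/\ bijective Phi, iota =1 psi \o Phi,
   forall c, Phi (in_pzalg _ c) = in_pzalg T c,
   forall c, iota (in_pzalg _ c) = in_pzalg D c &
   (forall i, (i < 4)%N -> Phi (@kgen k 5 isT i) = M25 k i) /\
   (forall i, (i < 5)%N -> psi (M25 k i) = s i)].
Proof.
move=> sR; have [Phi [Phi_bij Phi_in Phi_s]] := K5_mx char_k.
have [iota [iota_in iota_s]] := @kK_lift_ex k char_k 5 isT _ _ (rels_le (isT : 5 <= 6)%N sR).
have [Psi [PhiK PsiK]] := bij_rmorph_inv Phi_bij.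
pose psi : {rmorphism T -> D} := iota \o Psi.
exists Phi, iota, psi; split=> // [x|]; first by rewrite /= PhiK.
split=> //; have psi_s i : (i < 4)%N -> psi (M25 k i) = s i.
  by move=> lt_i; rewrite /= -Phi_s // PhiK iota_s.
move=> i; rewrite ltnS leq_eqVlt => /orP[/eqP ->|]; last exact: psi_s.
exact/esym/fifth_generator.
Qed.

Lemma K56_iso : alg_iso (kK k 5 isT) (kK k 6 isT) /\ alg_iso (kK k 6 isT) T.
Proof.
have [Phi [iota [psi [Phi_bij iotaE Phi_in iota_in [Phi_s psi_s]]]]] :=
  matrix_morphism (@rels_kK k char_k 6 isT).
have [Phi6 [Phi6_in Phi6_s]] := @kK_lift_ex k char_k 6 isT _ _ (@rels_M25 k char_k 6 isT).
have psi_in c : psi (in_pzalg T c) = in_pzalg _ c.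
  by rewrite -Phi_in -[LHS]iotaE iota_in.
(* Both composites are compared on the generators: those of kK_6 here, those of kK_5 below, where
   [Phi] is onto. *)
have PhiK : cancel Phi6 psi.
  have := @kK_hom_eq k 6 isT _ (psi \o Phi6) idfun.
  apply => // [c|i lt_i]; first by rewrite /= Phi6_in psi_in.
  by rewrite /= Phi6_s ?psi_s.
have PsiK : cancel psi Phi6.
  have e : Phi6 \o iota =1 Phi.
    apply: kK_hom_eq => // [c|i lt_i]; first by rewrite /= iota_in Phi6_in.
    by rewrite /= iotaE /= Phi_s // psi_s ?Phi6_s // ltnW.
  have [Psi _ PsiK] := Phi_bij.
  by move=> Z; have := e (Psi Z); rewrite /= iotaE /= PsiK.
split; [exists iota => //|by exists Phi6 => //; exists psi].
by apply: (eq_bij (bij_comp _ Phi_bij) (fun x => esym (iotaE x))); exists Phi6.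
Qed.

End Tower.

Section Collapse.
Context (k : fieldType) (char_k : 3%N \in [pchar k]).

Lemma rels_collapse (D : pzAlgType k) (s : nat -> D) : rels 7 s -> 1 = 0 :> D.
Proof.
move=> sR; have [comm braid cube q0] := sR.
have [Phi [iota [psi [Phi_bij iotaE Phi_in iota_in [Phi_s psi_s]]]]] :=
  matrix_morphism char_k (rels_le (isT : 6 <= 7)%N sR).
have iota_s i : (i < 4)%N -> iota (@kgen k 5 isT i) = s i.
  by move=> lt_i; rewrite iotaE /= Phi_s // psi_s // ltnW.
(* In this indexing [s 5] is s_6, which commutes with s_1, ..., s_4 and so with the image of kK_5.
   This image contains s_5, whence [e45]. *)
have comm5 x : s 5 * iota x = iota x * s 5.
  elim/kK_ind: x => [y z cy cz|c y cy||i y lt_i cy].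
  - by rewrite rmorphD mulrDl mulrDr cy cz.
  - by rewrite rmorphM iota_in mulrA -in_pzalgC -!mulrA cy.
  - by rewrite rmorph1 mulr1 mul1r.
  by rewrite rmorphM iota_s // mulrA -(comm i 5) // -!mulrA cy.
have eq_s i : (i < 5)%N -> s i * s i.+1 = s i.+1 * s i -> s i = s i.+1.
  move=> lt_i c_i; apply: braid_commute_eq c_i _ _ _; [|exact: cube|exact: braid].
  by apply: cube; exact: ltnW.
have e45 : s 4 = s 5.
  apply: eq_s => //; have [Psi _ PsiK] := Phi_bij.
  have -> : s 4 = iota (Psi (M25 k 4)) by rewrite iotaE /= PsiK psi_s.
  by rewrite comm5.
(* Each equality makes the previous generator commute with its neighbour, now equal to s_6, and the
   braid relation identifies them. *)
have e34 : s 3 = s 4 by apply: eq_s => //; rewrite e45 comm.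
have e23 : s 2 = s 3 by apply: eq_s => //; rewrite e34 e45 comm.
have e12 : s 1 = s 2 by apply: eq_s => //; rewrite e23 e34 e45 comm.
have e01 : s 0 = s 1 by apply: eq_s => //; rewrite e12 e23 e34 e45 comm.
(* The words of Q have length divisible by 3, and a single generator of order 3 is left. *)
have s_gen w : List.In w Q8words -> wprod (gens s) w = 1.
  move=> ww; have w_low := low_Q8words ww.
  rewrite (eq_wprod (t := fun=> s 0) _ w_low); last first.
    by case=> //= _; rewrite /gens /= -?e01.
  have /eqP w3 := allP_In (isT : all (fun w => size w %% 3 == 0)%N Q8words) ww.
  have -> : wprod (fun=> s 0) w = s 0 ^+ size w.
    by elim: (w) => [|x v IHv] /=; rewrite ?expr0 // IHv exprS.
  rewrite (divn_eq (size w) 3) w3 addn0 mulnC exprM.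
  by rewrite !exprS expr0 mulr1 mulrA cube // expr1n.
have : \sum_(w <- Q8words) (1 : D) = 0.
  by rewrite -[RHS]q0; apply: big_In => w /s_gen.
have three := three_alg char_k D.
(* Removing 3 twice from the eight terms leaves 1 + 1 = 0, and then 1 = 3 = 0. *)
have D3 : 1 + 1 + 1 = 0 :> D by rewrite -[RHS]three !mulrS mulr0n addr0 addrA.
rewrite !big_cons big_nil addr0 !addrA D3 add0r D3 add0r => two.
by rewrite -[LHS]add0r -[X in X + _]two D3.
Qed.

Lemma kK_trivial n (le3n : (3 <= n)%N) : (7 <= n)%N -> forall x : kK k n le3n, x = 0.
Proof.
move=> le7n x; rewrite -[x]mul1r.
by rewrite (rels_collapse (rels_le le7n (rels_kK char_k le3n))) mul0r.
Qed.

End Collapse.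

Theorem theorem4p9 (k : fieldType) (char_k : 3%N \in [pchar k]) :
  [/\ alg_iso (kK k 3 isT) ('M[k^o]_3 * 'M[galg k C3]_2)%type,
      alg_iso (kK k 5 isT) (kK k 6 isT)
      /\ alg_iso (kK k 6 isT) 'M[galg k C3]_25
    & forall (n : nat) (le3n : (3 <= n)%N), (7 <= n)%N ->
        forall x : kK k n le3n, x = 0].
Proof.
split; [exact: K3_iso|exact: K56_iso|exact: kK_trivial].
Qed.
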